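(* Let $Q$ be a local Noetherian ring with residue field $k$, $R=Q/I$ a cyclic $Q$-algebra ($I$ proper), $M$ a finitely generated $R$-module, and let $A$ and $G$ be the minimal $Q$-free resolutions of $R$ and $M$, with an $A_\infty$-algebra structure $m=(m_n)$ on $A$ and an $A_\infty$ $A$-module structure $m^G=(m_n^G)$ on $G$. Let $E^r$ be the Avramov spectral sequence, i.e. the spectral sequence of the complex $X=(R\otimes\operatorname{Bar}A\otimes G)\otimes_Rk$ filtered by number of bars. Then $$E^2_{p,q}\cong\left(\operatorname{Tor}_p^{\operatorname{Tor}^Q_*(R,k)}(\operatorname{Tor}^Q_*(M,k),k)\right)_q\Rightarrow\operatorname{Tor}^R_{p+q}(M,k),$$ and the $A_\infty$-structures describe its differentials: an element $x\in E^0_p$ survives to $E^r_p$ if and only if there exist $x_i\in E^0_i$ for $i=p-r,\dots,p-1$ such that, with $x_p=x$, $$\sum_{i=1}^nt_i(x_{p-n+i})=0\quad\text{for }n=1,\dots,r;$$ and in this case $d^r(x)$ is the image in $E^r_{p-r}$ of $\sum_{i=1}^{r+1}t_i(x_{p-r-1+i})$.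
   Context: Conventions: $\otimes=\otimes_Q$. Complexes are graded homologically. $M[1]_n=M_{n-1}$, $d_{M[1]}=-d_M$, and $s:M\to M[1]$ is the degree $1$ map $s(m)=m$. Signs: $(f\otimes g)(x\otimes y)=(-1)^{|g||x|}f(x)\otimes g(y)$. $A_0=Q$ and $A_+=A_{\ge 1}$. A free resolution is minimal if its differentials have image in the maximal ideal times the target. An $A_\infty$-algebra structure on $A$ is a sequence of degree $-1$ maps $m_n:A_+[1]^{\otimes n}\to A_+[1]$, $n\ge1$, such that $m_1$ is the differential of the complex $A_+[1]$; $m_1m_2+m_2(m_1\otimes1+1\otimes m_1)=d_1^A\otimes1-1\otimes d_1^A$, where $d_1^A:A_1\to A_0=Q$ is viewed as a degree $-2$ map $A_+[1]\to A_0$ and $A_0\otimes A_+[1]=A_+[1]=A_+[1]\otimes A_0$; and $\sum_{i=1}^n\sum_{j=0}^{n-i}m_{n-i+1}(1^{\otimes j}\otimes m_i\otimes1^{\otimes n-i-j})=0$ for all $n\ge3$. Given $(m_n)$, an $A_\infty$ $A$-module structure on $G$ is a sequence of degree $-1$ maps $m_n^G:A_+[1]^{\otimes n-1}\otimes G\to G$, $n\ge1$, such that $m_1^G=d^G$; $m_1^Gm_2^G+m_2^G(m_1\otimes1+1\otimes m_1^G)=d_1^A\otimes1$; and $\sum_{i=1}^n\sum_{j=0}^{n-i}m^G_{n-i+1}(1^{\otimes j}\otimes m_i\otimes1^{\otimes n-i-j})=0$ for all $n\ge3$, where $m_i$ means $m_i^G$ when $j=n-i$. The bar resolution $R\otimes\operatorname{Bar}A\otimes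 G=\bigoplus_{p\ge0}R\otimes A_+[1]^{\otimes p}\otimes G$ has $R$-linear differential which on the $p$-th summand is $R\otimes\sum_{i=1}^{p+1}\sum_{j=0}^{p-i+1}1^{\otimes j}\otimes m_i\otimes1^{\otimes p-i-j+1}$, where $m_i$ means $m_i^G$ when $j=p-i+1$; it is an $R$-projective resolution of $M$. Write $\overline A=A\otimes k$, $\overline G=G\otimes k$, so $X=\bigoplus_{p\ge0}E^0_p$ with $E^0_p=\overline A_+[1]^{\otimes_kp}\otimes_k\overline G$. Filter by $F_pX=\bigoplus_{l\le p}E^0_l$. Here $E^0_{p,q}=(E^0_p)_{p+q}$. Define $t_i:E^0_p\to E^0_{p-i+1}$ by $t_i=\sum_{j=0}^{p-i+1}1^{\otimes j}\otimes\overline m_i\otimes1^{\otimes p-i-j+1}$, where $\overline m_i=m_i\otimes k$ for $j<p-i+1$ and $\overline m_i=m_i^G\otimes k$ for $j=p-i+1$; then $d=t_1+\dots+t_{p+1}$ on $E^0_p$. Elements $x_i$ with $i<0$ are $0$. With $Z^r_p=F_pX\cap d^{-1}F_{p-r}X$ and $B^r_p=d(Z^r_{p+r})$, $E^r_p=Z^r_p/(Z^{r-1}_{p-1}+B^{r-1}_p)$, regarded as a subquotient of $E^0_p=F_pX/F_{p-1}X$; ''$x$ survives to $E^r_p$'' means that $x$ is the $E^0_p$-component of an element of $Z^r_p$. The graded $k$-algebra structure on $\operatorname{Tor}^Q_*(R,k)=H_*(A\otimes k)$ and its action on $\operatorname{Tor}^Q_*(M,k)=H_*(G\otimes k)$ are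 the Cartan–Eilenberg products, induced by any chain maps $A\otimes A\to A$ and $A\otimes G\to G$ lifting the multiplications $R\otimes R\to R$ and $R\otimes M\to M$. The index $q$ on the right of the $E^2$ formula is the internal degree, and $k$ is a $\operatorname{Tor}^Q_*(R,k)$-module via the projection to degree $0$. *)

(* Defs.v *)
From HB Require Import structures.
From mathcomp Require Import all_boot all_order all_algebra finmap.
From mathcomp Require Export monalg.

Set Implicit Arguments.
Unset Strict Implicit.
Unset Printing Implicit Defensive.

Import GRing.Theory.
Local Open Scope ring_scope.

(* Free modules are presented with a basis: {malg S[V]} is the free left       *)
(* S-module on V, the tensor product of free modules on U and V is the free    *)
(* module on U * V, and a graded free module is a basis V with a degree        *)
(* function V -> nat.  Subspaces are Prop-valued predicates.                   *)

Section Rings.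
Variable Q : comNzRingType.

Definition is_ideal (I : Q -> Prop) : Prop :=
  I 0 /\ forall a x y, I x -> I y -> I (a * x + y).

Definition noetherian : Prop :=
  forall I, is_ideal I ->
  exists (n : nat) (g : 'I_n -> Q), forall x,
    I x <-> exists c : 'I_n -> Q, x = \sum_i c i * g i.

Definition maximal_ideal (I : Q -> Prop) : Prop :=
  [/\ is_ideal I, ~ I 1 &
      forall J, is_ideal J -> ~ J 1 ->
        (forall x, I x -> J x) -> forall x, J x -> I x].

Definition local_ring : Prop :=
  exists2 I, maximal_ideal I &
    forall J, maximal_ideal J -> forall x, J x <-> I x.

Definition surjective (X Y : Type) (f : X -> Y) : Prop :=
  forall y, exists x, f x = y.

Definition finitely_generated (M : lmodType Q) : Prop :=
  exists (n : nat) (g : 'I_n -> M), forall x,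
    exists c : 'I_n -> Q, x = \sum_i c i *: g i.

End Rings.

Section FreeModules.
Variable S : nzRingType.

Definition homog (V : choiceType) (deg : V -> nat) (n : nat)
    (x : {malg S[V]}) : Prop :=
  forall v, v \in msupp x -> deg v = n.

Definition lin (V : choiceType) (N : lmodType S) (f : V -> N)
    (x : {malg S[V]}) : N :=
  \sum_(v <- msupp x) x@_v *: f v.

Definition tens (U V : choiceType) (x : {malg S[U]}) (y : {malg S[V]}) :
    {malg S[(U * V)%type]} :=
  \sum_(u <- msupp x) \sum_(v <- msupp y) << x@_u * y@_v *g (u, v) >>.

Definition base_change (S' : nzRingType) (phi : S -> S') (V : choiceType)
    (x : {malg S[V]}) : {malg S'[V]} :=
  \sum_(v <- msupp x) << phi x@_v *g v >>.

End FreeModules.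

(* The map S' (x)_S f : S'^(U) -> S'^(V) obtained from an S-linear map f.      *)
Definition bc_map (S S' : nzRingType) (phi : S -> S') (U V : choiceType)
    (f : {malg S[U]} -> {malg S[V]}) : {malg S'[U]} -> {malg S'[V]} :=
  lin (fun u => base_change phi (f << u >>)).

(* eps exhibits (V, d) as an S-free resolution of the S'-module N, regarded as *)
(* an S-module along phi : S -> S'.                                            *)
Record free_resolution (S S' : nzRingType) (phi : S -> S') (N : lmodType S')
    (V : choiceType) (deg : V -> nat)
    (d : {linear {malg S[V]} -> {malg S[V]}})
    (eps : {malg S[V]} -> N) : Prop := {
  res_diff_deg : forall u v, v \in msupp (d << u >>) -> (deg v).+1 = deg u;
  res_diff_sq : forall x, d (d x) = 0;
  res_aug_lin : forall c x y, eps (c *: x + y) = phi c *: eps x + eps y;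
  res_aug_deg : forall v, (0 < deg v)%N -> eps << v >> = 0;
  res_aug_diff : forall x, eps (d x) = 0;
  res_aug_surj : surjective eps;
  res_exact0 : forall x, homog deg 0 x -> eps x = 0 -> exists y, x = d y;
  res_exact : forall n x, (0 < n)%N -> homog deg n x -> d x = 0 ->
    exists y, x = d y
}.

(* kap is the projection of a local ring onto its residue field.               *)
Definition minimal_differential (Q : nzRingType) (k : fieldType) (kap : Q -> k)
    (V : choiceType) (d : {malg Q[V]} -> {malg Q[V]}) : Prop :=
  forall x v, kap (d x)@_v = 0.

(* Cycles and boundaries of k (x)_S P in degree n: for a free resolution P of  *)
(* N over S, their quotient is Tor^S_n(N, k).                                  *)
Section Homology.
Variables (S : nzRingType) (k : fieldType) (eta : S -> k) (V : choiceType).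
Variables (deg : V -> nat) (d : {malg S[V]} -> {malg S[V]}).

Definition tor_cycles (n : nat) (x : {malg k[V]}) : Prop :=
  homog deg n x /\ bc_map eta d x = 0.

Definition tor_boundaries (n : nat) (x : {malg k[V]}) : Prop :=
  homog deg n x /\ exists y, x = bc_map eta d y.

End Homology.

Section Subspaces.
Variable k : fieldType.

Definition subspace (V : lmodType k) (U : V -> Prop) : Prop :=
  U 0 /\ forall c x y, U x -> U y -> U (c *: x + y).

(* U / D is isomorphic to U' / D'.  Over a field every linear map U / D ->     *)
(* U' / D' is induced by a linear map of the ambient spaces.                   *)
Definition subquotient_iso (V V' : lmodType k) (U D : V -> Prop)
    (U' D' : V' -> Prop) : Prop :=
  exists f : {linear V -> V'},
    [/\ forall x, U x -> U' (f x),
        forall x, U x -> (D' (f x) <-> D x) &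
        forall y, U' y -> exists2 x, U x & D' (y - f x)].

End Subspaces.

(* mu is a chain map A (x)_Q G -> G that lifts the action R (x) N -> N, for a  *)
(* resolution A of R and a resolution G of the R-module N.                     *)
Record lifts_action (Q R : comNzRingType) (N : lmodType R) (U V : choiceType)
    (degU : U -> nat) (degV : V -> nat)
    (dU : {malg Q[U]} -> {malg Q[U]}) (dV : {malg Q[V]} -> {malg Q[V]})
    (epsU : {malg Q[U]} -> R^o) (epsV : {malg Q[V]} -> N)
    (mu : {linear {malg Q[(U * V)%type]} -> {malg Q[V]}}) : Prop := {
  lift_deg : forall u v,
    homog degV (degU u + degV v) (mu << (u, v) >>);
  lift_chain : forall u v,
    dV (mu << (u, v) >>) =
      mu (tens (dU << u >>) << v >>)
      + (-1) ^+ degU u *: mu (tens << u >> (dV << v >>));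
  lift_aug : forall u v,
    epsV (mu << (u, v) >>) = (epsU << u >> : R) *: epsV << v >>
}.

(* cls sends a cycle to its homology class and identifies H with ker d / im d. *)
(* Its values on elements that are not cycles are irrelevant.                  *)
Definition is_homology (V H : zmodType) (d : V -> V) (cls : V -> H) : Prop :=
  (forall h, exists2 x, d x = 0 & cls x = h) /\
  (forall x, d x = 0 -> (cls x = 0 <-> exists y, x = d y)).

Definition odeg (B : Type) (degB : B -> nat) (u : option B) : nat :=
  if u is Some b then degB b else 0%N.

(* T is the k-algebra H_*(A (x)_Q k) and N the T-module H_*(G (x)_Q k), with   *)
(* products induced by mu and muG; eta is the projection of T onto its degree  *)
(* 0 part k.  A has basis option B, where None is 1 in A_0 = Q.  The data      *)
(* (T, N, clsT, clsN, eta) are unique up to unique isomorphism.                *)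
Record tor_algebra_module (Q : comNzRingType) (k : fieldType) (kap : Q -> k)
    (B C : choiceType)
    (dA : {malg Q[option B]} -> {malg Q[option B]})
    (dG : {malg Q[C]} -> {malg Q[C]})
    (mu : {malg Q[(option B * option B)%type]} -> {malg Q[option B]})
    (muG : {malg Q[(option B * C)%type]} -> {malg Q[C]})
    (T : algType k) (N : lmodType T)
    (clsT : {linear {malg k[option B]} -> T})
    (clsN : {malg k[C]} -> N)
    (eta : {rmorphism T -> k}) : Prop := {
  tor_clsT : is_homology (bc_map kap dA) clsT;
  tor_clsN : is_homology (bc_map kap dG) clsN;
  tor_clsN_lin : forall c x y, clsN (c *: x + y) = c%:A *: clsN x + clsN y;
  tor_mul : forall x y, bc_map kap dA x = 0 -> bc_map kap dA y = 0 ->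
    clsT x * clsT y = clsT (bc_map kap mu (tens x y));
  tor_act : forall x y, bc_map kap dA x = 0 -> bc_map kap dG y = 0 ->
    clsT x *: clsN y = clsN (bc_map kap muG (tens x y));
  tor_eta : forall x, bc_map kap dA x = 0 -> eta (clsT x) = x@_None
}.

(* The degree n part of the homology H of a graded complex.                    *)
Definition homology_degree (k : fieldType) (V : choiceType) (deg : V -> nat)
    (d : {malg k[V]} -> {malg k[V]}) (H : Type) (cls : {malg k[V]} -> H)
    (n : nat) (h : H) : Prop :=
  exists x, [/\ homog deg n x, d x = 0 & cls x = h].

(* A resolution of the graded T-module N by graded free T-modules with maps    *)
(* preserving the internal degree; hdeg is the homological degree and ideg     *)
(* the internal degree of basis elements.  degT n and degN n are the degree n  *)
(* parts of T and N.                                                           *)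
Record graded_free_resolution (T : nzRingType) (N : lmodType T)
    (degT : nat -> T -> Prop) (degN : nat -> N -> Prop)
    (V : choiceType) (hdeg ideg : V -> nat)
    (d : {linear {malg T[V]} -> {malg T[V]}})
    (eps : {malg T[V]} -> N) : Prop := {
  gres_res : free_resolution idfun hdeg d eps;
  gres_diff_deg : forall u v, v \in msupp (d << u >>) ->
    (ideg v <= ideg u)%N /\ degT (ideg u - ideg v)%N (d << u >>)@_v;
  gres_aug_deg : forall v, degN (ideg v) (eps << v >>)
}.

Section AInfinity.
Variables (Q : comNzRingType) (B C : choiceType).
Variables (degB : B -> nat) (degC : C -> nat).
Variables (dA : {malg Q[option B]} -> {malg Q[option B]}).
Variables (dG : {malg Q[C]} -> {malg Q[C]}).

(* A word w of length n is a basis element of A_+[1]^(x)n.  m_n and m^G_n are  *)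
(* given by their values m w and mG w' c on basis elements, where n = size w   *)
(* and n - 1 = size w'; m [::] is never used.                                  *)
Variables (m : seq B -> {malg Q[B]}) (mG : seq B -> C -> {malg Q[C]}).

Definition sdeg (w : seq B) : nat := (\sum_(b <- w) (degB b).+1)%N.

Definition bar_deg (u : seq B * C) : nat := (sdeg u.1 + degC u.2)%N.

Definition d1 (b : B) : Q := (dA << Some b >>)@_None.

(* 1^(x)j (x) m_i (x) 1^(x)(n-i-j) on words of length n >= i + j, with the     *)
(* Koszul sign of m_i, of degree -1, moving past the first j letters.          *)
Definition insert_m (i j : nat) (w : seq B) : {malg Q[seq B]} :=
  (-1) ^+ sdeg (take j w) *:
    lin (fun b => << take j w ++ b :: drop (j + i) w >>)
        (m (take i (drop j w))).

(* 1^(x)j (x) m_i (x) 1^(x)(p-i-j+1) on the p-th summand of the bar complex,   *)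
(* 1 <= i <= p - j + 1, where m_i means m^G_i for j = p - i + 1.               *)
Definition insert_mG (i j : nat) (u : seq B * C) : {malg Q[(seq B * C)%type]} :=
  let: (w, c) := u in
  (-1) ^+ sdeg (take j w) *:
    (if (j + i <= size w)%N
     then lin (fun b => << (take j w ++ b :: drop (j + i) w, c) >>)
              (m (take i (drop j w)))
     else lin (fun c' => << (take j w, c') >>) (mG (drop j w) c)).

Definition bar_t (i : nat) (u : seq B * C) : {malg Q[(seq B * C)%type]} :=
  \sum_(0 <= j < (size u.1).+2 - i) insert_mG i j u.

Definition stasheff (w : seq B) : {malg Q[B]} :=
  \sum_(1 <= i < (size w).+1) \sum_(0 <= j < (size w - i).+1)
    lin m (insert_m i j w).

Definition stasheffG (u : seq B * C) : {malg Q[C]} :=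
  \sum_(1 <= i < (size u.1).+2) lin (fun v => mG v.1 v.2) (bar_t i u).

Record ainf_algebra : Prop := {
  ainf_deg : forall w b, w != [::] -> b \in msupp (m w) ->
    (degB b).+2 = sdeg w;
  (* d_{A_+[1]} = - d_A *)
  ainf_m1 : forall b b', (m [:: b])@_b' = - (dA << Some b >>)@_(Some b');
  ainf_m2 : forall b b',
    stasheff [:: b; b'] = d1 b *: << b' >> - d1 b' *: << b >>;
  ainf_stasheff : forall w, (3 <= size w)%N -> stasheff w = 0
}.

Record ainf_module : Prop := {
  ainfG_deg : forall w c c', c' \in msupp (mG w c) ->
    (degC c').+1 = bar_deg (w, c);
  ainfG_m1 : forall c, mG [::] c = dG << c >>;
  ainfG_m2 : forall b c, stasheffG ([:: b], c) = d1 b *: << c >>;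
  ainfG_stasheff : forall w c, (2 <= size w)%N -> stasheffG (w, c) = 0
}.

(* The filtered complex X = (R (x) Bar A (x) G) (x)_R k, with basis the words. *)
Section SpectralSequence.
Variables (k : fieldType) (kap : Q -> k).
Local Notation X := {malg k[(seq B * C)%type]}.

Definition t_ (i : nat) : X -> X := lin (fun u => base_change kap (bar_t i u)).

Definition dX : X -> X :=
  lin (fun u => base_change kap (\sum_(1 <= i < (size u.1).+2) bar_t i u)).

Definition E0 (p : int) (x : X) : Prop :=
  forall u, u \in msupp x -> (size u.1)%:Z = p.

Definition Fil (p : int) (x : X) : Prop :=
  forall u, u \in msupp x -> (size u.1)%:Z <= p.

Definition Z_ (r p : int) (x : X) : Prop := Fil p x /\ Fil (p - r) (dX x).

Definition B_ (r p : int) (x : X) : Prop :=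
  exists2 y, Z_ r (p + r) y & x = dX y.

(* E^r_p = Z_ r p / E_den r p *)
Definition E_den (r p : int) (x : X) : Prop :=
  exists y z, [/\ Z_ (r - 1) (p - 1) y, B_ (r - 1) p z & x = y + z].

(* The part E^r_{p,n-p} of total degree n. *)
Definition E_num_deg (r p : int) (n : nat) (x : X) : Prop :=
  Z_ r p x /\ homog bar_deg n x.
Definition E_den_deg (r p : int) (n : nat) (x : X) : Prop :=
  E_den r p x /\ homog bar_deg n x.

(* z in Z^r_p has E^0_p-component x, so that the class of z in E^r_p is the    *)
(* image of x.                                                                 *)
Definition represents (r p : int) (x z : X) : Prop :=
  [/\ E0 p x, Z_ r p z & Fil (p - 1) (z - x)].

Definition survives (r p : int) (x : X) : Prop := exists z, represents r p x z.

(* d^r maps the image of x in E^r_p to the image of y in E^r_{p-r}.            *)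
Definition differential_maps (r p : int) (x y : X) : Prop :=
  [/\ survives r p x, survives r (p - r) y &
      forall z w, represents r p x z -> represents r (p - r) y w ->
        E_den r (p - r) (dX z - w)].

(* In total degree n the spectral sequence converges to H = Zn / Bn: there is  *)
(* a finite filtration of H, given by subspaces Phi p between Bn and Zn, and   *)
(* for each p the pages E^r_{p,n-p} are eventually constant (the differentials *)
(* out of and into them vanish) and isomorphic to the p-th graded piece of H.  *)
Definition converges_in_degree (n : nat) (W : lmodType k) (Zn Bn : W -> Prop) :
    Prop :=
  exists Phi : int -> W -> Prop,
    [/\ forall p, subspace (Phi p),
        forall p x, Phi p x -> Phi (p + 1) x,
        forall p x, p < 0 -> (Phi p x <-> Bn x),
        exists p0, forall p x, p0 <= p -> (Phi p x <-> Zn x) &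
        forall p : int, exists r0 : nat, forall r : nat, (r0 <= r)%N ->
          [/\ forall z, E_num_deg r%:Z p n z -> E_den r%:Z (p - r%:Z) (dX z),
              forall z, E_num_deg r%:Z (p + r%:Z) n.+1 z -> E_den r%:Z p (dX z) &
              subquotient_iso (E_num_deg r%:Z p n) (E_den_deg r%:Z p n)
                              (Phi p) (Phi (p - 1))]].

End SpectralSequence.
End AInfinity.

(* Main.v *)
(** On Bar A (x) G over Q the bar differential delta is compatible with
   deconcatenation, so the Stasheff identities give
   delta^2 (b | w) = d_1(b) w.  This vanishes after tensoring with R, and
   R (x) Bar A (x) G resolves M because the part of a cycle with the longest
   tail is a cycle of A.  Comparing with another resolution gives convergence;
   the description of Z^r and d^r is read off from d = t_1 + t_2 + ... by
   looking at one word length at a time.  By minimality t_1 = 0 over k, so E^2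
   is the homology of t_2.  The maps m_2 and m^G_2, with signs, lift the
   multiplications, hence induce the products of T = Tor^Q(R, k) and
   N = Tor^Q(M, k), and t_2 is then the reduced bar differential of (T, N). *)
Require Import Defs.
From HB Require Import structures.
From mathcomp Require Import all_boot all_order all_algebra finmap.
From mathcomp Require Import zify.
From Stdlib Require Import ClassicalEpsilon.
Import GRing.Theory.
Local Open Scope ring_scope.

Set Implicit Arguments.
Unset Strict Implicit.
Unset Printing Implicit Defensive.

(** Over [Q] the map delta is not a differential, and this failure is used rather than avoided. A
    cycle over [R] lifts to some v for which delta v has coefficients in I; as I is the image of
    d_1, delta v = delta^2 y, and v - delta y is a true delta-cycle. Exactness can therefore be
    proved over [Q], from the acyclicity of A and G. There the curvature helps again: the letters in
    front of a tail of top degree are killed by m_1, but to bound in A they must also be killed by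
    d_1, and this is the vanishing of delta^2 on the cycle. On the second page the obstacle is that
    T and N are abstract, with an arbitrary graded resolution of N. Minimality makes T and N copies
    of A and G over k, and makes any two lifts of a product equal over k, not just homotopic. The
    bar resolution of N over T is then built on words, with an explicit contraction. The contraction
    respects the internal degree, so the comparison map into the bar resolution can be chosen
    graded; the map back need not be, and is projected to one internal degree after passing to k. *)

Lemma eq_addf (N : nmodType) (a a' b b' : N) : a = a' -> b = b' -> a + b = a' + b'.
Proof. by move=> -> ->. Qed.

Lemma eq_scale (S : nzRingType) (N : lmodType S) (c : S) (a a' : N) :
  a = a' -> c *: a = c *: a'.
Proof. by move=> ->. Qed.

(** * Supports, linear extension from a basis, and projections *)

Section Supports.
Context {G : zmodType} {V : choiceType}.
Implicit Types (x y : {malg G[V]}) (P : V -> Prop).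

(** The predicates [homog], [E0] and [Fil] all unfold to this form, so one set of closure lemmas
    serves degrees and filtrations alike. *)
Definition supp_in P x : Prop := forall v, v \in msupp x -> P v.

Lemma supp_inP P x : supp_in P x <-> forall v, x@_v <> 0 -> P v.
Proof.
split=> H v; first by move/eqP; rewrite mcoeff_neq0; apply: H.
by rewrite -mcoeff_neq0 => /eqP; apply: H.
Qed.

Lemma supp_inW P P' x : (forall v, P v -> P' v) -> supp_in P x -> supp_in P' x.
Proof. by move=> h H v /H /h. Qed.

Lemma supp_in0 P : supp_in P 0.
Proof. by move=> v; rewrite msupp0 in_fset0. Qed.

Lemma supp_inD P x y : supp_in P x -> supp_in P y -> supp_in P (x + y).
Proof.
move=> Hx Hy v /(fsubsetP (msuppD_le _ _)); rewrite in_fsetU.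
by case/orP; [apply: Hx | apply: Hy].
Qed.

Lemma supp_inN P x : supp_in P x -> supp_in P (- x).
Proof. by move=> Hx v; rewrite msuppN; apply: Hx. Qed.

Lemma supp_inB P x y : supp_in P x -> supp_in P y -> supp_in P (x - y).
Proof. by move=> Hx Hy; apply: supp_inD => //; apply: supp_inN. Qed.

Lemma supp_inU P c v : P v -> supp_in P << c *g v >>.
Proof. by move=> h w /(fsubsetP msuppU_le); rewrite in_fset1 => /eqP ->. Qed.

Lemma supp_in_sum P (I : Type) (r : seq I) (p : pred I) (F : I -> {malg G[V]}) :
  (forall i, p i -> supp_in P (F i)) -> supp_in P (\sum_(i <- r | p i) F i).
Proof.
move=> H; elim/big_rec: _ => [|i x pi Hx]; first exact: supp_in0.
by apply: supp_inD => //; apply: H.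
Qed.

Lemma supp_in_sum_seq P (I : eqType) (r : seq I) (F : I -> {malg G[V]}) :
  (forall i, i \in r -> supp_in P (F i)) -> supp_in P (\sum_(i <- r) F i).
Proof.
move=> H; rewrite big_seq_cond; apply: supp_in_sum => i /andP[ir _]; exact: H.
Qed.

Lemma supp_in_empty P x : (forall v, ~ P v) -> supp_in P x -> x = 0.
Proof.
move=> nP Hx; apply/malgP => v; rewrite mcoeff0; apply/eqP.
by rewrite mcoeff_eq0; apply/negP => /Hx /nP.
Qed.

End Supports.

Lemma supp_inZ (S : nzRingType) (V : choiceType) (P : V -> Prop) (c : S)
    (x : {malg S[V]}) : supp_in P x -> supp_in P (c *: x).
Proof.
move=> Hx; apply/supp_inP => v; rewrite mcoeffZ => nz.
by move/supp_inP: Hx; apply => z; apply: nz; rewrite z mulr0.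
Qed.

Lemma big_msupp (S : nzRingType) (V : choiceType) (N : lmodType S)
    (f : V -> N) (x : {malg S[V]}) (d : {fset V}) :
  (msupp x `<=` d)%fset -> lin f x = \sum_(v <- d) x@_v *: f v.
Proof.
move=> le; rewrite /lin (big_fset_incl _ le) // => v _ nv.
by rewrite mcoeff_outdom // scale0r.
Qed.

Section LinTheory.
Context {S : nzRingType} {V : choiceType} {N : lmodType S} (f : V -> N).

Lemma lin_is_linear : linear (lin f).
Proof.
move=> c x y.
pose d := (msupp x `|` msupp y `|` msupp (c *: x + y))%fset.
have sx : (msupp x `<=` d)%fset by rewrite /d -fsetUA fsubsetUl.
have sy : (msupp y `<=` d)%fset
  by rewrite /d (fsetUC (msupp x)) -fsetUA fsubsetUl.
rewrite (big_msupp f sx) (big_msupp f sy) (@big_msupp _ _ _ f _ d); last first.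
  by rewrite /d fsubsetUr.
rewrite scaler_sumr -big_split /=; apply: eq_bigr => v _.
by rewrite mcoeffD mcoeffZ scalerDl scalerA.
Qed.

HB.instance Definition _ := GRing.isLinear.Build S {malg S[V]} N _ (lin f)
  lin_is_linear.

Lemma linE c v : lin f << c *g v >> = c *: f v.
Proof. by rewrite (big_msupp f msuppU_le) big_seq_fset1 mcoeffUU. Qed.

Lemma lin1 v : lin f << v >> = f v.
Proof. by rewrite linE scale1r. Qed.

Lemma lin0 : lin f 0 = 0. Proof. exact: linear0. Qed.
Lemma linD x y : lin f (x + y) = lin f x + lin f y. Proof. exact: linearD. Qed.
Lemma linN x : lin f (- x) = - lin f x. Proof. exact: linearN. Qed.
Lemma linZ c x : lin f (c *: x) = c *: lin f x. Proof. exact: linearZ. Qed.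
Lemma linP c x y : lin f (c *: x + y) = c *: lin f x + lin f y.
Proof. exact: linearP. Qed.
Lemma lin_sum (I : Type) (r : seq I) (P : pred I) (F : I -> {malg S[V]}) :
  lin f (\sum_(i <- r | P i) F i) = \sum_(i <- r | P i) lin f (F i).
Proof. exact: linear_sum. Qed.

End LinTheory.

Arguments lin : simpl never.

Section LinExt.
Context {S : nzRingType} {V : choiceType} {N : lmodType S}.

Lemma malgUZ (c : S) (v : V) : << c *g v >> = c *: << v >> :> {malg S[V]}.
Proof. by apply/malgP => w; rewrite mcoeffZ !mcoeffU mulrnAr mulr1. Qed.

Lemma eq_lin_supp (f g : V -> N) (x : {malg S[V]}) :
  supp_in (fun v => f v = g v) x -> lin f x = lin g x.
Proof. by move=> H; apply: eq_big_seq => v /H ->. Qed.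

Lemma eq_lin (f g : V -> N) : f =1 g -> lin f =1 lin g.
Proof. by move=> H x; apply: eq_lin_supp => v _. Qed.

Lemma linear_linE (F : {linear {malg S[V]} -> N}) x :
  F x = lin (fun v => F << v >>) x.
Proof.
rewrite {1}[x]monalgE linear_sum; apply: eq_bigr => v _.
by rewrite malgUZ linearZ.
Qed.

Lemma linear_eq_supp (F H : {linear {malg S[V]} -> N}) x :
  supp_in (fun v => F << v >> = H << v >>) x -> F x = H x.
Proof. by move=> E; rewrite (linear_linE F) (linear_linE H); apply: eq_lin_supp. Qed.

Lemma linear_eq (F H : {linear {malg S[V]} -> N}) :
  (forall v, F << v >> = H << v >>) -> F =1 H.
Proof. by move=> E x; apply: linear_eq_supp => v _. Qed.

Lemma lin_eq0 (f : V -> N) (x : {malg S[V]}) :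
  supp_in (fun v => f v = 0) x -> lin f x = 0.
Proof.
move=> H; rewrite (@eq_lin_supp f (fun _ => 0)) //.
by apply: big1 => v _; rewrite scaler0.
Qed.

Lemma lin_addf (f g : V -> N) x : lin (fun v => f v + g v) x = lin f x + lin g x.
Proof.
by rewrite -big_split; apply: eq_bigr => v _; rewrite scalerDr.
Qed.

Lemma lin_oppf (f : V -> N) x : lin (fun v => - f v) x = - lin f x.
Proof. by rewrite -sumrN; apply: eq_bigr => v _; rewrite scalerN. Qed.

Lemma lin_sumf (I : Type) (r : seq I) (P : pred I) (f : I -> V -> N) x :
  lin (fun v => \sum_(i <- r | P i) f i v) x = \sum_(i <- r | P i) lin (f i) x.
Proof.
rewrite /lin exchange_big; apply: eq_bigr => v _; by rewrite scaler_sumr.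
Qed.

End LinExt.

Lemma lin_id (S : nzRingType) (V : choiceType) (x : {malg S[V]}) :
  lin (fun v => << v >>) x = x.
Proof.
by rewrite [RHS]monalgE; apply: eq_bigr => v _; rewrite -malgUZ.
Qed.

Lemma linear_lin (S : nzRingType) (V : choiceType) (N N' : lmodType S)
    (F : {linear N -> N'}) (f : V -> N) x : F (lin f x) = lin (fun v => F (f v)) x.
Proof. by rewrite linear_sum; apply: eq_bigr => v _; rewrite linearZ. Qed.

Lemma lin_lin (S : nzRingType) (U V : choiceType) (N : lmodType S)
    (g : V -> N) (f : U -> {malg S[V]}) x : lin g (lin f x) = lin (fun u => lin g (f u)) x.
Proof. exact: linear_lin. Qed.

Lemma lin_scalef (S : comNzRingType) (V : choiceType) (N : lmodType S)
    (c : S) (f : V -> N) x : lin (fun v => c *: f v) x = c *: lin f x.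
Proof.
by rewrite scaler_sumr; apply: eq_bigr => v _; rewrite !scalerA mulrC.
Qed.

Lemma supp_in_lin (S : nzRingType) (V W : choiceType) (P : W -> Prop)
    (f : V -> {malg S[W]}) x :
  supp_in (fun v => supp_in P (f v)) x -> supp_in P (lin f x).
Proof. by move=> H; apply: supp_in_sum_seq => v /H h; apply: supp_inZ. Qed.

Lemma supp_in_linear (S : nzRingType) (V W : choiceType) (P : W -> Prop)
    (F : {linear {malg S[V]} -> {malg S[W]}}) x :
  supp_in (fun v => supp_in P (F << v >>)) x -> supp_in P (F x).
Proof. by move=> H; rewrite linear_linE; apply: supp_in_lin. Qed.

Section Part.
Context {S : nzRingType} {V : choiceType}.

Definition part (P : pred V) : {malg S[V]} -> {malg S[V]} :=
  lin (fun v => if P v then << v >> else 0).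

HB.instance Definition _ P := GRing.Linear.on (part P).

Lemma mcoeff_part P x v : (part P x)@_v = if P v then x@_v else 0.
Proof.
rewrite -[part P x]/(lin _ x) [x in RHS]monalgE /lin !raddf_sum /=.
case: ifP => Pv; last first.
  apply: big1 => w _; rewrite mcoeffZ; case: ifP => Pw; last by rewrite mcoeff0 mulr0.
  by rewrite mcoeffU; case: eqP => [E|_]; [rewrite E Pv in Pw | rewrite mulr0].
apply: eq_bigr => w _; rewrite mcoeffZ; case: ifP => Pw.
  by rewrite !mcoeffU mulrnAr mulr1.
by rewrite mcoeff0 mulr0 mcoeffU; case: eqP => [E|_] //; rewrite E Pv in Pw.
Qed.

Lemma supp_in_part (P : pred V) x : supp_in P (part P x).
Proof. by apply/supp_inP => v; rewrite mcoeff_part; case: ifP. Qed.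

Lemma supp_in_part_sub (P : pred V) (P' : V -> Prop) x :
  supp_in P' x -> supp_in P' (part P x).
Proof.
move/supp_inP=> H; apply/supp_inP => v; rewrite mcoeff_part; case: ifP => // _; exact: H.
Qed.

Lemma part_id (P : pred V) x : supp_in P x -> part P x = x.
Proof.
move=> H; apply/malgP => v; rewrite mcoeff_part; case: ifP => // Pv.
by apply/esym/eqP; rewrite mcoeff_eq0; apply/negP => /H; rewrite Pv.
Qed.

Lemma part_eq0 (P : pred V) x : supp_in (fun v => ~~ P v) x -> part P x = 0.
Proof.
move=> H; apply/malgP => v; rewrite mcoeff_part mcoeff0; case: ifP => // Pv.
by apply/eqP; rewrite mcoeff_eq0; apply/negP => /H; rewrite Pv.
Qed.

Lemma partC (P : pred V) x : x = part P x + part (predC P) x.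
Proof.
apply/malgP => v; rewrite mcoeffD !mcoeff_part /=.
by case: (P v); rewrite ?addr0 ?add0r.
Qed.

End Part.

(* [F] maps each basis element to the part of the target cut out by [P'] or to
   its complement, as [P] says. *)
Lemma part_linear (S : nzRingType) (V W : choiceType) (P : pred V) (P' : pred W)
    (F : {linear {malg S[V]} -> {malg S[W]}}) x :
  (forall v, supp_in (fun w => P' w = P v) (F << v >>)) ->
  part P' (F x) = F (part P x).
Proof.
move=> H; suff E : part P' \o F =1 F \o part P by exact: E.
apply: linear_eq => v; rewrite /= {2}/part lin1; case: ifP => Pv.
  by apply: part_id => w /H ->.
by rewrite linear0; apply: part_eq0 => w /H ->; rewrite Pv.
Qed.

(** * Base change and maps that are linear along a ring morphism *)

Section BaseChange.
Context {S S' : nzRingType} (phi : {rmorphism S -> S'}) {V : choiceType}.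

Lemma mcoeff_base_change (x : {malg S[V]}) v : (base_change phi x)@_v = phi x@_v.
Proof.
rewrite [x in RHS]monalgE /base_change !raddf_sum /=; apply: eq_bigr => w _.
by rewrite !mcoeffU rmorphMn.
Qed.

Lemma base_change_is_additive : zmod_morphism (base_change (V := V) phi).
Proof.
by move=> x y; apply/malgP => v; rewrite mcoeffB !mcoeff_base_change mcoeffB rmorphB.
Qed.

HB.instance Definition _ := GRing.isZmodMorphism.Build {malg S[V]} {malg S'[V]}
  (@base_change S S' phi V) base_change_is_additive.

Lemma base_changeZ c (x : {malg S[V]}) :
  base_change phi (c *: x) = phi c *: base_change phi x.
Proof.
by apply/malgP => v; rewrite mcoeffZ !mcoeff_base_change mcoeffZ rmorphM.
Qed.

Lemma base_changeP c (x y : {malg S[V]}) :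
  base_change phi (c *: x + y) = phi c *: base_change phi x + base_change phi y.
Proof. by rewrite raddfD /= base_changeZ. Qed.

Lemma base_changeU c (v : V) : base_change phi << c *g v >> = << phi c *g v >>.
Proof. by apply/malgP => w; rewrite mcoeff_base_change !mcoeffU rmorphMn. Qed.

Lemma base_change1 (v : V) : base_change phi << v >> = << v >>.
Proof. by rewrite base_changeU rmorph1. Qed.

Lemma supp_in_base_change (P : V -> Prop) x : supp_in P x -> supp_in P (base_change phi x).
Proof.
move/supp_inP=> H; apply/supp_inP => v; rewrite mcoeff_base_change => nz.
by apply: H => z; apply: nz; rewrite z rmorph0.
Qed.

(** Coefficients are lifted along a set-theoretic section [s] of [phi]. Summing over the support of
    [y] only keeps the support condition, whatever the value [s 0] is. *)
Lemma base_change_surj : surjective phi -> forall (P : V -> Prop) y, supp_in P y ->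
  exists2 x, supp_in P x & base_change phi x = y.
Proof.
move=> sp P y Py; pose s c := epsilon (inhabits 0) (fun q => phi q = c).
have sK c : phi (s c) = c by exact: (epsilon_spec _ _ (sp c)).
exists (\sum_(v <- msupp y) << s y@_v *g v >>).
  by apply: supp_in_sum_seq => v /Py; apply: supp_inU.
rewrite raddf_sum [RHS]monalgE; apply: eq_bigr => v _.
by rewrite /= base_changeU sK.
Qed.

End BaseChange.

Lemma base_change_comp (S S' S'' : nzRingType) (phi : {rmorphism S -> S'})
    (psi : {rmorphism S' -> S''}) (chi : {rmorphism S -> S''}) (V : choiceType)
    (x : {malg S[V]}) :
  (forall q, psi (phi q) = chi q) ->
  base_change psi (base_change phi x) = base_change chi x.
Proof. by move=> E; apply/malgP => v; rewrite !mcoeff_base_change E. Qed.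

Section Semilinear.
Context {S S' : nzRingType} (phi : {rmorphism S -> S'}) {V : choiceType}.
Context {N : lmodType S'}.
Implicit Types (F H : {malg S[V]} -> N).

(** Augmentations, and composites with base change, go from a module over one ring to a module over
    another and are not [{linear}] maps. This is the form in which they can still be compared on a
    basis. *)
Definition semilinear_along F := forall c x y, F (c *: x + y) = phi c *: F x + F y.

Lemma semilinear0 F : semilinear_along F -> F 0 = 0.
Proof.
move=> sF; have := sF 1 0 0; rewrite scale1r addr0 rmorph1 scale1r => /esym/eqP.
by rewrite -subr_eq0 addrK => /eqP.
Qed.

Lemma semilinearD F x y : semilinear_along F -> F (x + y) = F x + F y.
Proof. by move=> sF; have := sF 1 x y; rewrite rmorph1 !scale1r. Qed.

Lemma semilinearZ F c x : semilinear_along F -> F (c *: x) = phi c *: F x.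
Proof. by move=> sF; have := sF c x 0; rewrite !addr0 (semilinear0 sF) addr0. Qed.

Lemma semilinearN F x : semilinear_along F -> F (- x) = - F x.
Proof. by move=> sF; rewrite -(scaleN1r x) (semilinearZ _ _ sF) rmorphN1 scaleN1r. Qed.

Lemma semilinear_sumE F x : semilinear_along F ->
  F x = \sum_(v <- msupp x) phi x@_v *: F << v >>.
Proof.
move=> sF; rewrite {1}[x]monalgE.
elim/big_rec2: _ => [|v y1 y2 _ <-]; first exact: semilinear0.
by rewrite malgUZ sF.
Qed.

Lemma semilinear_eq_supp F H x : semilinear_along F -> semilinear_along H ->
  supp_in (fun v => F << v >> = H << v >>) x -> F x = H x.
Proof.
move=> sF sH E; rewrite (semilinear_sumE _ sF) (semilinear_sumE _ sH).
by apply: eq_big_seq => v /E ->.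
Qed.

Lemma semilinear_eq0 F x : semilinear_along F ->
  supp_in (fun v => F << v >> = 0) x -> F x = 0.
Proof.
move=> sF E; rewrite (semilinear_sumE _ sF); apply: big1_seq => v /andP[_ /E ->].
by rewrite scaler0.
Qed.

Lemma semilinear_lin (U : choiceType) F (f : U -> {malg S[V]}) x : semilinear_along F ->
  F (lin f x) = \sum_(u <- msupp x) phi x@_u *: F (f u).
Proof.
move=> sF; rewrite /lin; elim/big_rec2: _ => [|u y1 y2 _ <-]; first exact: semilinear0.
by rewrite sF.
Qed.

End Semilinear.

Section BaseChangeMaps.
Context {S S' : nzRingType} (phi : {rmorphism S -> S'}).

HB.instance Definition _ (U V : choiceType) (f : {malg S[U]} -> {malg S[V]}) :=
  GRing.Linear.on (bc_map phi f).

Lemma bc_map1 (U V : choiceType) (f : {malg S[U]} -> {malg S[V]}) u :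
  bc_map phi f << u >> = base_change phi (f << u >>).
Proof. exact: lin1. Qed.

Lemma bc_map_base_change (U V : choiceType) (f : {linear {malg S[U]} -> {malg S[V]}}) x :
  bc_map phi f (base_change phi x) = base_change phi (f x).
Proof.
apply: (semilinear_eq_supp (phi := phi)
  (F := fun x => bc_map phi f (base_change phi x))
  (H := fun x => base_change phi (f x)) (x := x)).
- by move=> c a b; rewrite base_changeP linearP.
- by move=> c a b; rewrite linearP base_changeP.
by move=> u _; rewrite base_change1 bc_map1.
Qed.

Lemma bc_map_comp (U V W : choiceType) (f : {linear {malg S[V]} -> {malg S[W]}})
    (g : {malg S[U]} -> {malg S[V]}) x :
  bc_map phi (f \o g) x = bc_map phi f (bc_map phi g x).
Proof.
suff E : bc_map phi (f \o g) =1 bc_map phi f \o bc_map phi g by exact: E.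
by apply: linear_eq => u /=; rewrite !bc_map1 bc_map_base_change.
Qed.

Lemma bc_map_id (V : choiceType) (x : {malg S'[V]}) : bc_map phi (id : {malg S[V]} -> _) x = x.
Proof.
suff E : bc_map phi (id : {malg S[V]} -> _) =1 idfun by exact: E.
by apply: linear_eq => u /=; rewrite bc_map1 base_change1.
Qed.

Lemma supp_in_bc_map (U V : choiceType) (P : V -> Prop) (f : {malg S[U]} -> {malg S[V]}) x :
  supp_in (fun u => supp_in P (f << u >>)) x -> supp_in P (bc_map phi f x).
Proof. by move=> H; apply: supp_in_lin => u /H; apply: supp_in_base_change. Qed.

End BaseChangeMaps.

(** * Comparison of free resolutions *)

(** [stage n] is a solution on the degrees below [n], continued by [x0]. As [good u f] looks at [f]
    in lower degrees only, the stages stabilise at each [u], and the diagonal value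
    [stage (deg u).+1 u] meets every requirement. *)
Lemma recursion_on_degree (U X : Type) (x0 : X) (deg : U -> nat)
    (good : U -> (U -> X) -> X -> Prop) :
  (forall u f g x, (forall v, (deg v < deg u)%N -> f v = g v) ->
     good u f x -> good u g x) ->
  (forall u f, (forall v, (deg v < deg u)%N -> good v f (f v)) ->
     exists x, good u f x) ->
  exists f, forall u, good u f (f u).
Proof.
move=> local ex.
pose stage := fix stage n : U -> X := if n is n'.+1 then
   fun u => if deg u == n' then epsilon (inhabits x0) (good u (stage n')) else stage n' u
  else fun=> x0.
have stable n u : (deg u < n)%N -> stage n u = stage (deg u).+1 u.
  elim: n => // n IH; rewrite ltnS leq_eqVlt => /predU1P[<- //|lt /=].
  by rewrite (ltn_eqF lt) IH.
exists (fun u => stage (deg u).+1 u) => u.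
have [n] := ubnP (deg u); elim: n u => // n IH u; rewrite ltnS => le.
have agree v : (deg v < deg u)%N -> stage (deg v).+1 v = stage (deg u) v.
  by move=> lt; rewrite (stable (deg u) v lt).
have {}IH v : (deg v < deg u)%N -> good v (stage (deg u)) (stage (deg u) v).
  move=> lt; rewrite -agree //.
  apply: local (IH v (leq_trans lt le)) => w ltw; exact/agree/(ltn_trans ltw).
have E : stage (deg u).+1 u = epsilon (inhabits x0) (good u (stage (deg u))).
  by rewrite /= eqxx.
apply: (local u (stage (deg u))) => [v lt|]; first exact/esym/agree.
rewrite E; exact: epsilon_spec (ex u _ IH).
Qed.

Section Filling.
Context {S S' : nzRingType} {phi : {rmorphism S -> S'}} {N : lmodType S'}.
Context {V : choiceType} {deg : V -> nat} {d : {linear {malg S[V]} -> {malg S[V]}}}.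
Context {eps : {malg S[V]} -> N}.
Hypothesis res : free_resolution phi deg d eps.

Lemma res_aug_semilinear : semilinear_along phi eps.
Proof. exact: (res_aug_lin res). Qed.

Lemma res_diff_part n x : part (fun v => deg v == n) (d x) = d (part (fun v => deg v == n.+1) x).
Proof. by apply: part_linear => u v /(res_diff_deg res) <-. Qed.

Lemma res_diff_eq0 u : deg u = 0%N -> d << u >> = 0.
Proof. by move=> E; apply: (@supp_in_empty _ _ (fun v => (deg v).+1 = 0%N)) => // v /(res_diff_deg res); rewrite E. Qed.

(** Joins exactness in degree 0, where the augmentation must vanish, with exactness in positive
    degrees. Cutting out the component of degree [n.+1] makes the preimage homogeneous. *)
Lemma res_fill n x : homog deg n x -> d x = 0 -> (n = 0%N -> eps x = 0) ->
  exists2 y, homog deg n.+1 y & d y = x.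
Proof.
move=> Hx dx ex.
have [y E] : exists y, x = d y.
  by case: n Hx ex => [|n] Hx ex; [apply: (res_exact0 res) => //; exact: ex|exact: (res_exact res _ Hx)].
exists (part (fun v => deg v == n.+1) y); first by move=> v /supp_in_part /eqP.
rewrite -res_diff_part -E; apply: part_id => v /Hx ->; exact: eqxx.
Qed.

Lemma res_aug_surj_homog (a : N) : exists2 y, homog deg 0 y & eps y = a.
Proof.
have [y E] := res_aug_surj res a.
exists (part (fun v => deg v == 0%N) y); first by move=> v /supp_in_part /eqP.
rewrite -E [in RHS](partC (fun v => deg v == 0%N) y) (semilinearD _ _ res_aug_semilinear).
rewrite [X in _ + X](semilinear_eq0 res_aug_semilinear) ?addr0 // => v /supp_in_part /= nz.
by apply: (res_aug_deg res); rewrite lt0n.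
Qed.

(* With [e = 0] and [g = 0] this lifts chain maps; with [e = 1] and [D] minus
   the differential it constructs homotopies. *)
Lemma fill_linear (U : choiceType) (degU : U -> nat)
    (D : {linear {malg S[U]} -> {malg S[U]}}) (e : nat)
    (g : U -> {malg S[V]}) (a : U -> N) :
  (forall u v, v \in msupp (D << u >>) -> (degU v).+1 = degU u) ->
  (forall u, D (D << u >>) = 0) ->
  (forall u n, (degU u + e = n.+1)%N -> homog deg n (g u)) ->
  (forall u, (degU u + e = 0)%N -> g u = 0) ->
  (forall u, d (g u) + lin g (D << u >>) = 0) ->
  (forall u, (degU u + e = 1)%N ->
     eps (g u) + \sum_(v <- msupp (D << u >>)) phi (D << u >>)@_v *: a v = 0) ->
  exists f : U -> {malg S[V]}, forall u,
    [/\ homog deg (degU u + e) (f u), d (f u) = g u + lin f (D << u >>) &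
        (degU u + e = 0)%N -> eps (f u) = a u].
Proof.
move=> Ddeg Dsq gdeg g0 gcyc geps.
apply: (recursion_on_degree 0 (deg := degU) (good := fun u f x =>
  [/\ homog deg (degU u + e) x, d x = g u + lin f (D << u >>) &
        (degU u + e = 0)%N -> eps x = a u])).
  move=> u f f' x E [h -> H]; split => //; congr (_ + _).
  by apply: eq_lin_supp => v /Ddeg lt; apply: E; rewrite -lt.
move=> u f IH.
have {}IH v : v \in msupp (D << u >>) ->
    [/\ homog deg (degU v + e) (f v), d (f v) = g v + lin f (D << v >>) &
        (degU v + e = 0)%N -> eps (f v) = a v].
  by move/Ddeg=> lt; apply: IH; rewrite -lt.
case En: (degU u + e)%N => [|n].
  have [x Hx Ex] := res_aug_surj_homog (a u).
  have z : D << u >> = 0.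
    apply: (@supp_in_empty _ _ (fun v => (degU v).+1 = 0%N)) => // v /Ddeg.
    by move/eqP: En; rewrite addn_eq0 => /andP[/eqP -> _].
  exists x; split => //; rewrite z linear0 (g0 u En) addr0.
  by rewrite linear_linE; apply: lin_eq0 => v /Hx; apply: res_diff_eq0.
have degf v : v \in msupp (D << u >>) -> (degU v + e)%N = n.
  by move=> Hv; have := Ddeg _ _ Hv => E; move: En; rewrite -E addSn => -[].
have [] := @res_fill n (g u + lin f (D << u >>)).
- apply: supp_inD; first exact: gdeg.
  by apply: supp_in_lin => v Hv; have [] := IH v Hv; rewrite (degf v Hv).
- rewrite linearD /= linear_lin.
  rewrite (@eq_lin_supp _ _ _ _ (fun v => g v + lin f (D << v >>))); last first.
    by move=> v /IH [].
  rewrite lin_addf addrA gcyc add0r -linear_lin.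
  by rewrite -[lin _ _]/(lin (fun v => (D << v >>)) (D << u >>)) -linear_linE Dsq linear0.
- move=> n0; rewrite (semilinearD _ _ res_aug_semilinear).
  rewrite -[RHS](geps u); last by rewrite En n0.
  congr (_ + _); rewrite (semilinear_lin _ _ res_aug_semilinear).
  by apply: eq_big_seq => v Hv; have [_ _ ->] := IH v Hv; rewrite ?(degf v Hv).
by move=> x Hx E; exists x; rewrite ?En.
Qed.

End Filling.

Section Comparison.
Context {S S' : nzRingType} {phi : {rmorphism S -> S'}} {N : lmodType S'}.
Context {V : choiceType} {deg : V -> nat} {d : {linear {malg S[V]} -> {malg S[V]}}}.
Context {eps : {malg S[V]} -> N}.
Hypothesis res : free_resolution phi deg d eps.

Lemma chain_map_exists (U : choiceType) (degU : U -> nat)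
    (D : {linear {malg S[U]} -> {malg S[U]}}) (epsU : {malg S[U]} -> N) :
  free_resolution phi degU D epsU ->
  exists f : U -> {malg S[V]},
    [/\ forall u, homog deg (degU u) (f u),
        forall x, d (lin f x) = lin f (D x) &
        forall x, eps (lin f x) = epsU x].
Proof.
move=> resU; have sU := res_aug_semilinear resU; have sV := res_aug_semilinear res.
have [||||||f Hf] := @fill_linear _ _ _ _ _ _ _ _ res U degU D 0%N (fun=> 0)
  (fun u => epsU << u >>).
- exact: res_diff_deg resU.
- by move=> u; apply: (res_diff_sq resU).
- by move=> u n _; apply: supp_in0.
- by [].
- by move=> u; rewrite linear0 add0r; apply: lin_eq0.
- move=> u _; rewrite (semilinear0 sV) add0r -(semilinear_sumE _ sU).
  exact: (res_aug_diff resU).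
exists f; split=> [u|x|x].
- by have [] := Hf u; rewrite addn0.
- rewrite (linear_linE D) !linear_lin; apply: eq_lin => u.
  by have [_ -> _] := Hf u; rewrite add0r.
rewrite (semilinear_lin _ _ sV) (semilinear_sumE _ sU); apply: eq_bigr => u _.
have [homf _ e0] := Hf u; case: (posnP (degU u)) => [z|pos].
  by rewrite e0 // z.
rewrite (res_aug_deg resU pos) (semilinear_eq0 sV) // => v /homf.
by rewrite addn0 => E; apply: (res_aug_deg res); rewrite E.
Qed.

Lemma homotopy_exists (U : choiceType) (degU : U -> nat)
    (D : {linear {malg S[U]} -> {malg S[U]}}) (F : {linear {malg S[U]} -> {malg S[V]}}) :
  (forall u v, v \in msupp (D << u >>) -> (degU v).+1 = degU u) ->
  (forall u, D (D << u >>) = 0) ->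
  (forall u, homog deg (degU u) (F << u >>)) ->
  (forall u, d (F << u >>) = F (D << u >>)) ->
  (forall u, degU u = 0%N -> eps (F << u >>) = 0) ->
  exists s : U -> {malg S[V]},
    (forall u, homog deg (degU u).+1 (s u)) /\
    forall x, F x = d (lin s x) + lin s (D x).
Proof.
move=> Ddeg Dsq Fdeg Fd Fe.
have [||||||s Hs] := @fill_linear _ _ _ _ _ _ _ _ res U degU (\- D) 1%N
  (fun u => F << u >>) (fun=> 0).
- by move=> u v /=; rewrite msuppN; apply: Ddeg.
- by move=> u /=; rewrite linearN Dsq oppr0 oppr0.
- by move=> u n; rewrite addn1 => -[<-].
- by move=> u; rewrite addn1.
- by move=> u /=; rewrite linearN Fd [F (D _)]linear_linE subrr.
- move=> u; rewrite addn1 => -[z]; rewrite (Fe _ z) add0r big1 // => v _.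
  by rewrite scaler0.
exists s; split=> [u|x]; first by have [] := Hs u; rewrite addn1.
rewrite (linear_linE F) (linear_linE D) !linear_lin -lin_addf; apply: eq_lin => u.
by have [_ -> _] := Hs u; rewrite /= linearN subrK.
Qed.

(** The null-homotopy of the difference between [F] and the identity. It serves for both composites
    of a pair of comparison maps. *)
Lemma homotopy_id (F : {linear {malg S[V]} -> {malg S[V]}}) :
  (forall u, homog deg (deg u) (F << u >>)) ->
  (forall u, d (F << u >>) = F (d << u >>)) ->
  (forall u, eps (F << u >>) = eps << u >>) ->
  exists s : V -> {malg S[V]},
    (forall u, homog deg (deg u).+1 (s u)) /\
    forall x, F x = x + d (lin s x) + lin s (d x).
Proof.
move=> Fdeg Fd Fe; have sV := res_aug_semilinear res.
have [|||||s [Hs E]] := @homotopy_exists V deg d (F \- idfun).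
- exact: res_diff_deg res.
- by move=> u; apply: (res_diff_sq res).
- by move=> u; apply: supp_inB; [exact: Fdeg | apply: supp_inU].
- by move=> u; rewrite /= linearB Fd.
- by move=> u _; rewrite /= (semilinearD _ _ sV) (semilinearN _ sV) Fe subrr.
by exists s; split=> // x; rewrite -addrA -E /= addrC subrK.
Qed.

End Comparison.

Section BaseChangeHomotopy.
Context {S k : nzRingType} (eta : {rmorphism S -> k}) {V W : choiceType}.

Lemma eq_bc_map (f g : {malg S[V]} -> {malg S[W]}) : f =1 g -> bc_map eta f =1 bc_map eta g.
Proof. by move=> E x; apply: eq_lin => v; rewrite E. Qed.

Lemma bc_mapD (f g : {malg S[V]} -> {malg S[W]}) x :
  bc_map eta (fun x => f x + g x) x = bc_map eta f x + bc_map eta g x.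
Proof. by rewrite -lin_addf; apply: eq_lin => v; rewrite raddfD. Qed.

(** A homotopy is an identity between linear maps, so it survives a base change that destroys
    exactness. *)
Lemma bc_map_homotopy (d : {linear {malg S[V]} -> {malg S[V]}})
    (d' : {linear {malg S[W]} -> {malg S[W]}})
    (F : {linear {malg S[V]} -> {malg S[W]}})  (s : V -> {malg S[W]}) :
  (forall x, F x = d' (lin s x) + lin s (d x)) ->
  forall x, bc_map eta F x
    = bc_map eta d' (bc_map eta (lin s) x) + bc_map eta (lin s) (bc_map eta d x).
Proof.
by move=> E x; rewrite -!bc_map_comp -bc_mapD; apply: eq_bc_map => y; rewrite E.
Qed.

End BaseChangeHomotopy.

Lemma bc_map_homotopy_id (S k : nzRingType) (eta : {rmorphism S -> k}) (V W : choiceType) (d : {linear {malg S[V]} -> {malg S[V]}})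
    (f : V -> {malg S[W]}) (g : W -> {malg S[V]}) (s : V -> {malg S[V]}) :
  (forall x, lin g (lin f x) = x + d (lin s x) + lin s (d x)) ->
  forall x, bc_map eta (lin g) (bc_map eta (lin f) x)
    = x + bc_map eta d (bc_map eta (lin s) x) + bc_map eta (lin s) (bc_map eta d x).
Proof.
move=> E x; rewrite -!bc_map_comp -{2}(bc_map_id eta x). rewrite -!bc_mapD.
by apply: eq_bc_map => y; rewrite /= E.
Qed.

(** * Deconcatenation of words and the bar differential *)

Section Splittings.
Context {B : Type} {N : nmodType}.
Implicit Types (F : seq B -> seq B -> N) (w : seq B).

(** This is [F] applied to the deconcatenation coproduct of [w]. The recursive form, in place of the
    sum in [splittingsE], makes coassociativity a short induction. *)
Fixpoint splittings F w : N :=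
  F [::] w + (if w is b :: w' then splittings (fun w1 => F (b :: w1)) w' else 0).

Lemma splittingsE F w :
  splittings F w = \sum_(0 <= i < (size w).+1) F (take i w) (drop i w).
Proof.
elim: w F => [|b w IH] F; first by rewrite big_nat1 /= addr0.
by rewrite big_nat_recl //= IH.
Qed.

Lemma eq_splittings F F' w : (forall w1 w2, F w1 w2 = F' w1 w2) ->
  splittings F w = splittings F' w.
Proof. by move=> E; rewrite !splittingsE; apply: eq_bigr => i _; apply: E. Qed.

Lemma splittings_eq0 F w : (forall w1 w2, F w1 w2 = 0) -> splittings F w = 0.
Proof. by move=> E; rewrite splittingsE; apply: big1 => i _; apply: E. Qed.

Lemma splittingsD F F' w :
  splittings (fun w1 w2 => F w1 w2 + F' w1 w2) w = splittings F w + splittings F' w.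
Proof. by rewrite !splittingsE -big_split. Qed.

(** Coassociativity of deconcatenation: both sides run over the ways to cut [w] into three
    consecutive words. *)
Lemma splittings_assoc (H : seq B -> seq B -> seq B -> N) w :
  splittings (fun w1 w2 => splittings (fun w3 w4 => H w1 w3 w4) w2) w
  = splittings (fun w1 w2 => splittings (fun w3 w4 => H w3 w4 w2) w1) w.
Proof.
elim: w H => [//|b w IH] H /=.
by rewrite IH splittingsD addr0 addrA.
Qed.

End Splittings.

Section SplittingsLinear.
Context {S : nzRingType} {B : Type}.

Lemma splittings_lin (V : choiceType) (N : lmodType S)
    (F : seq B -> seq B -> V -> N) w (x : {malg S[V]}) :
  splittings (fun w1 w2 => lin (F w1 w2) x) w
  = lin (fun v => splittings (fun w1 w2 => F w1 w2 v) w) x.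
Proof.
rewrite splittingsE -lin_sumf; apply: eq_lin => v; by rewrite splittingsE.
Qed.

Lemma lin_splittings (V : choiceType) (N : lmodType S) (f : V -> N)
    (F : seq B -> seq B -> {malg S[V]}) w :
  lin f (splittings F w) = splittings (fun w1 w2 => lin f (F w1 w2)) w.
Proof. by rewrite !splittingsE lin_sum. Qed.

Lemma splittingsZ (N : lmodType S) c (F : seq B -> seq B -> N) w :
  c *: splittings F w = splittings (fun w1 w2 => c *: F w1 w2) w.
Proof. by rewrite !splittingsE scaler_sumr. Qed.

End SplittingsLinear.

Section BarDifferential.
Context {Q : comNzRingType} {B C : choiceType} (degB : B -> nat) (degC : C -> nat).
Context (m : seq B -> {malg Q[B]}) (mG : seq B -> C -> {malg Q[C]}).
Local Notation U := {malg Q[(seq B * C)%type]}.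
Implicit Types (b : B) (w : seq B) (c : C) (u v : seq B * C).

Local Notation sgn w := ((-1) ^+ sdeg degB w).

Arguments insert_mG : simpl never.
Arguments insert_m : simpl never.

Lemma sdeg_nil : sdeg degB [::] = 0%N. Proof. exact: big_nil. Qed.

Lemma sdeg_cons b w : sdeg degB (b :: w) = ((degB b).+1 + sdeg degB w)%N.
Proof. exact: big_cons. Qed.

Lemma sdeg_cat w w' : sdeg degB (w ++ w') = (sdeg degB w + sdeg degB w')%N.
Proof. exact: big_cat. Qed.

Definition bar_diff u : U := \sum_(1 <= i < (size u.1).+2) bar_t degB m mG i u.

Definition word_diff w : {malg Q[seq B]} :=
  \sum_(1 <= i < (size w).+1) \sum_(0 <= j < (size w - i).+1) insert_m degB m i j w.

Definition prepend b : U -> U := lin (fun v => << (b :: v.1, v.2) >>).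
HB.instance Definition _ b := GRing.Linear.on (prepend b).

Definition head_tens v : {malg Q[B]} -> U := lin (fun b => << (b :: v.1, v.2) >>).
HB.instance Definition _ v := GRing.Linear.on (head_tens v).

Definition empty_word : {malg Q[C]} -> U := lin (fun c => << ([::], c) >>).
HB.instance Definition _ := GRing.Linear.on empty_word.

Lemma prepend1 b v : prepend b << v >> = << (b :: v.1, v.2) >>.
Proof. exact: lin1. Qed.

Lemma prepend_lin (V : choiceType) b (f : V -> U) x :
  prepend b (lin f x) = lin (fun t => prepend b (f t)) x.
Proof. exact: linear_lin. Qed.

Lemma insert_mG_cons i j b w c :
  insert_mG degB m mG i j.+1 (b :: w, c)
  = (-1) ^+ (degB b).+1 *: prepend b (insert_mG degB m mG i j (w, c)).
Proof.
rewrite /insert_mG /= sdeg_cons exprD -scalerA addSn ltnS; apply: eq_scale.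
rewrite linearZ /=; apply: eq_scale.
by case: (j + i <= size w)%N; rewrite prepend_lin; apply: eq_lin => x; rewrite prepend1.
Qed.

Lemma insert_mG_head i b w c : (i <= size w)%N ->
  insert_mG degB m mG i.+1 0 (b :: w, c) = head_tens (drop i w, c) (m (b :: take i w)).
Proof. by move=> le; rewrite /insert_mG /= sdeg_nil scale1r add0n ltnS le. Qed.

Lemma insert_mG_total u : insert_mG degB m mG (size u.1).+1 0 u = empty_word (mG u.1 u.2).
Proof.
by case: u => w c; rewrite /insert_mG /= take0 drop0 sdeg_nil scale1r add0n ltnn.
Qed.

Lemma bar_diff_nil c : bar_diff ([::], c) = empty_word (mG [::] c).
Proof. by rewrite /bar_diff big_nat1 /bar_t big_nat1 (insert_mG_total ([::], c)). Qed.

(** An operation either starts at the first letter or leaves it alone and passes it with a Koszul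
    sign. Inductions on words use this recursion instead of the double sum over the arity [i] and
    the position [j]. *)
Lemma bar_diff_cons b w c :
  bar_diff (b :: w, c)
  = splittings (fun w1 w2 => head_tens (w2, c) (m (b :: w1))) w
    + empty_word (mG (b :: w) c) + (-1) ^+ (degB b).+1 *: prepend b (bar_diff (w, c)).
Proof.
rewrite /bar_diff /bar_t /=.
rewrite (eq_big_nat _ _ (F2 := fun i => insert_mG degB m mG i 0 (b :: w, c) +
   \sum_(0 <= j < (size w).+2 - i) insert_mG degB m mG i j.+1 (b :: w, c))); last first.
  by move=> i /andP[_ lt]; rewrite subSn // big_nat_recl.
rewrite big_split /=; apply: eq_addf.
  rewrite big_nat_recr //=; apply: eq_addf; last exact: (insert_mG_total (b :: w, c)).
  rewrite splittingsE big_add1 /=; apply: eq_big_nat => i /andP[_ lt].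
  by rewrite insert_mG_head.
rewrite big_nat_recr //= subnn [X in _ + X]big_geq // addr0 (linear_sum (prepend b)) scaler_sumr.
apply: eq_big_nat => i _; rewrite (linear_sum (prepend b)) scaler_sumr.
by apply: eq_bigr => j _; rewrite insert_mG_cons.
Qed.

Lemma insert_m_cons i j b w :
  insert_m degB m i j.+1 (b :: w)
  = (-1) ^+ (degB b).+1 *: lin (fun w' => << b :: w' >>) (insert_m degB m i j w).
Proof.
rewrite /insert_m /= sdeg_cons exprD -scalerA; apply: eq_scale.
rewrite linZ; apply: eq_scale; rewrite lin_lin.
by apply: eq_lin => x; rewrite lin1.
Qed.

Lemma word_diff_nil : word_diff [::] = 0.
Proof. exact: big_geq. Qed.

Lemma word_diff_cons b w :
  word_diff (b :: w)
  = splittings (fun w1 w2 => lin (fun b' => << b' :: w2 >>) (m (b :: w1))) w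
    + (-1) ^+ (degB b).+1 *: lin (fun w' => << b :: w' >>) (word_diff w).
Proof.
rewrite /word_diff /=.
rewrite (eq_big_nat _ _ (F2 := fun i => insert_m degB m i 0 (b :: w) +
   \sum_(0 <= j < (size w).+1 - i) insert_m degB m i j.+1 (b :: w))); last first.
  by move=> i /andP[_ lt]; rewrite big_nat_recl //.
rewrite big_split /=; apply: eq_addf.
  rewrite splittingsE big_add1 /=; apply: eq_big_nat => i /andP[_ lt].
  by rewrite /insert_m /= sdeg_nil scale1r.
rewrite big_nat_recr //= subnn [X in _ + X]big_geq // addr0 lin_sum scaler_sumr.
apply: eq_big_nat => i /andP[_ lt]; rewrite lin_sum scaler_sumr subSn //.
by apply: eq_bigr => j _; rewrite insert_m_cons.
Qed.

Lemma lin_head_tens (N : lmodType Q) (F : seq B * C -> N) v x :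
  lin F (head_tens v x) = lin (fun b => F (b :: v.1, v.2)) x.
Proof. by rewrite lin_lin; apply: eq_lin => b; rewrite lin1. Qed.

Lemma lin_prepend (N : lmodType Q) (F : seq B * C -> N) b x :
  lin F (prepend b x) = lin (fun v => F (b :: v.1, v.2)) x.
Proof. by rewrite lin_lin; apply: eq_lin => v; rewrite lin1. Qed.

Lemma lin_empty_word (N : lmodType Q) (F : seq B * C -> N) x :
  lin F (empty_word x) = lin (fun c => F ([::], c)) x.
Proof. by rewrite lin_lin; apply: eq_lin => c; rewrite lin1. Qed.

(* The bar differential is compatible with deconcatenation of words. *)
Lemma bar_diff_splittings (N : lmodType Q) (F : seq B -> seq B * C -> N) w c :
  lin (fun v => splittings (fun w1 w2 => F w1 (w2, v.2)) v.1) (bar_diff (w, c))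
  = splittings (fun w1 w2 => lin (fun w' => F w' (w2, c)) (word_diff w1)
                   + sgn w1 *: lin (F w1) (bar_diff (w2, c))) w.
Proof.
elim: w F => [|b w IH] F.
  rewrite /= addr0 word_diff_nil lin0 add0r sdeg_nil scale1r bar_diff_nil !lin_empty_word.
  by apply: eq_lin => c'; rewrite /= addr0.
(* [F'] collects the splittings with a nonempty first part; the remaining one is the term of [F
   [::]]. *)
pose F' v := if v.1 is b' :: w' then splittings (fun w1 w2 => F (b' :: w1) (w2, v.2)) w' else 0.
rewrite [LHS](_ : _ = lin (F [::]) (bar_diff (b :: w, c)) + lin F' (bar_diff (b :: w, c))); last first.
  by rewrite -lin_addf; apply: eq_lin => -[[|b' w'] c'].
rewrite /= word_diff_nil lin0 add0r sdeg_nil scale1r; apply: eq_addf; first exact: erefl.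
rewrite {1}bar_diff_cons !linD linZ lin_empty_word lin_prepend lin_splittings.
rewrite [X in _ + X + _]lin_eq0 ?addr0; last by [].
rewrite (IH (fun w1 => F (b :: w1))) splittingsZ.
rewrite (eq_splittings (F' := fun w1 w2 => splittings (fun w3 w4 =>
   lin (fun b' => F (b' :: w3) (w4, c)) (m (b :: w1))) w2)); last first.
  by move=> w1 w2; rewrite splittings_lin lin_head_tens; apply: eq_lin.
(* An operation at the head followed by a cut of what remains is regrouped, by coassociativity, into
   a cut whose first part contains the operation. *)
rewrite splittings_assoc -splittingsD; apply: eq_splittings => w1 w2.
rewrite word_diff_cons linD linZ sdeg_cons exprD scalerDr scalerA addrA lin_splittings.
apply: eq_addf; last exact: erefl.
apply: eq_addf.
  apply: eq_splittings => w3 w4.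
  by rewrite lin_lin; apply: eq_lin => b'; rewrite lin1.
by apply: eq_scale; rewrite lin_lin; apply: eq_lin => w'; rewrite lin1.
Qed.

End BarDifferential.

(** * The square of the bar differential *)

Lemma lin_swap (S : comNzRingType) (U V : choiceType) (N : lmodType S)
    (F : U -> V -> N) (x : {malg S[U]}) (y : {malg S[V]}) :
  lin (fun u => lin (F u) y) x = lin (fun v => lin (F^~ v) x) y.
Proof.
rewrite [RHS]lin_sumf; apply: eq_bigr => u _.
by rewrite -lin_scalef; apply: eq_lin.
Qed.

Lemma splittingsN (B : Type) (N : zmodType) (F : seq B -> seq B -> N) w :
  splittings (fun w1 w2 => - F w1 w2) w = - splittings F w.
Proof. by rewrite !splittingsE sumrN. Qed.

Section BarSquare.
Context {Q : comNzRingType} {B C : choiceType} (degB : B -> nat) (degC : C -> nat).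
Context (dA : {linear {malg Q[option B]} -> {malg Q[option B]}}).
Context (dG : {linear {malg Q[C]} -> {malg Q[C]}}).
Context (m : seq B -> {malg Q[B]}) (mG : seq B -> C -> {malg Q[C]}).
Hypothesis ainfA : ainf_algebra degB dA m.
Hypothesis ainfG : ainf_module degB degC dA dG m mG.
Local Notation U := {malg Q[(seq B * C)%type]}.
Implicit Types (b : B) (w : seq B) (c : C) (u v : seq B * C).

Local Notation sgn w := ((-1) ^+ sdeg degB w).
Local Notation bar_diff := (bar_diff degB m mG).
Local Notation word_diff := (word_diff degB m).

(** [m] is extended by 0 to the empty word, where its value has no meaning. *)
Definition head_term w v : U := if w is b :: w' then head_tens v (m w) else 0.

(** The part of [bar_diff] whose operation starts at the first position, including the one that
    consumes the whole word together with the generator of G. *)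
Definition head_diff u : U :=
  splittings (fun w1 w2 => head_term w1 (w2, u.2)) u.1 + empty_word (mG u.1 u.2).

Lemma bar_diff_headE w c :
  bar_diff (w, c) = head_diff (w, c) +
    (if w is b :: w' then (-1) ^+ (degB b).+1 *: prepend b (bar_diff (w', c)) else 0).
Proof.
case: w => [|b w]; rewrite /head_diff /=.
  by rewrite bar_diff_nil !addr0 add0r.
by rewrite bar_diff_cons add0r.
Qed.

Lemma bar_diff_prepend b (y : U) :
  lin bar_diff (prepend b y)
  = lin head_diff (prepend b y) + (-1) ^+ (degB b).+1 *: prepend b (lin bar_diff y).
Proof.
rewrite !lin_prepend prepend_lin -lin_scalef -lin_addf.
by apply: eq_lin => -[w c]; exact: bar_diff_headE.
Qed.

(** A letter of [m w] has suspended degree one less than [w], so passing it costs minus the sign of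
    [w]. *)
Lemma bar_diff_head_term w v :
  lin bar_diff (head_term w v)
  = lin head_diff (head_term w v) - sgn w *: lin (head_term w) (bar_diff v).
Proof.
case: w => [|b w]; rewrite /head_term.
  by rewrite !lin0 [lin _ (bar_diff v)]lin_eq0 // scaler0 subr0.
rewrite !lin_head_tens.
have -> : lin (fun v => head_tens v (m (b :: w))) (bar_diff v)
  = lin (fun b' => prepend b' (bar_diff v)) (m (b :: w)) by rewrite lin_swap.
rewrite -lin_scalef -lin_oppf -lin_addf; apply: eq_lin_supp => b' Hb'.
rewrite bar_diff_headE; apply: eq_addf; first exact: erefl.
have E := ainf_deg ainfA (isT : b :: w != [::]) Hb'.
by rewrite -E [(-1) ^+ _.+2]exprS mulN1r scaleNr opprK; case: (v).
Qed.

Lemma word_diff_nonempty w : supp_in (fun w' => w' != [::]) (word_diff w).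
Proof.
apply: supp_in_sum => i _; apply: supp_in_sum => j _; apply: supp_inZ.
by apply: supp_in_lin => b _; apply: supp_inU; rewrite -size_eq0 size_cat addnS.
Qed.

Lemma stasheffE w : stasheff degB m w = lin m (word_diff w).
Proof. by rewrite lin_sum; apply: eq_bigr => i _; rewrite lin_sum. Qed.

Lemma stasheffGE u : stasheffG degB m mG u = lin (fun v => mG v.1 v.2) (bar_diff u).
Proof. by rewrite lin_sum. Qed.

(** Write [bar_diff] as [head_diff] plus the term [T] that keeps the first letter. Compatibility
    with deconcatenation evaluates [head_diff] on all of [bar_diff] ([E4]). The terms with two
    operations on disjoint stretches, one of them at the head, occur in [E2] and [E4] and cancel. In
    [E3] the sign of the first letter occurs twice and disappears. *)
Lemma bar_diff_bar_diff w c :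
  lin bar_diff (bar_diff (w, c))
  = splittings (fun w1 w2 => head_tens (w2, c) (stasheff degB m w1)) w
    + empty_word (stasheffG degB m mG (w, c))
    + (if w is b :: w' then prepend b (lin bar_diff (bar_diff (w', c))) else 0).
Proof.
pose T := if w is b :: w' then (-1) ^+ (degB b).+1 *: prepend b (bar_diff (w', c)) else 0.
have E1 : bar_diff (w, c) = head_diff (w, c) + T by exact: bar_diff_headE.
have E2 : lin bar_diff (head_diff (w, c)) = lin head_diff (head_diff (w, c))
    - splittings (fun w1 w2 => sgn w1 *: lin (head_term w1) (bar_diff (w2, c))) w.
  rewrite /head_diff /= -/head_diff !linD !lin_splittings -splittingsN.
  rewrite [RHS]addrAC -splittingsD; apply: eq_addf.
    by apply: eq_splittings => w1 w2; rewrite bar_diff_head_term.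
  by rewrite !lin_empty_word; apply: eq_lin => c'; rewrite bar_diff_headE addr0.
have E3 : lin bar_diff T = lin head_diff T
    + (if w is b :: w' then prepend b (lin bar_diff (bar_diff (w', c))) else 0).
  rewrite /T; case: (w) => [|b w']; first by rewrite !lin0 addr0.
  rewrite !linZ bar_diff_prepend scalerDr; apply: eq_addf; first exact: erefl.
  by rewrite scalerA -exprMn mulrNN mulr1 expr1n scale1r.
have E4 : lin head_diff (bar_diff (w, c))
  = splittings (fun w1 w2 => head_tens (w2, c) (stasheff degB m w1)) w
    + splittings (fun w1 w2 => sgn w1 *: lin (head_term w1) (bar_diff (w2, c))) w
    + empty_word (stasheffG degB m mG (w, c)).
  rewrite /head_diff lin_addf bar_diff_splittings splittingsD; apply: eq_addf.
    apply: eq_addf; last exact: erefl.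
    apply: eq_splittings => w1 w2; rewrite stasheffE [head_tens _ (lin _ _)]lin_lin.
    by apply: eq_lin_supp => -[|b w'] /word_diff_nonempty.
  by rewrite stasheffGE [empty_word (lin _ _)]lin_lin.
have cancel (N : zmodType) (x y z t q r : N) :
  x + z = q + y + r -> x - y + (z + t) = q + r + t.
  by move=> E; rewrite addrA (addrAC x) E (addrAC _ r) addrK.
rewrite E1 linD E2 E3; apply: cancel; rewrite -linD -E1; exact: E4.
Qed.

Hypothesis dA_sq : forall x, dA (dA x) = 0.
Hypothesis dA_None : dA << None >> = 0.
Hypothesis dG_sq : forall x, dG (dG x) = 0.

Definition letters : {malg Q[B]} -> {malg Q[option B]} := lin (fun b => << Some b >>).

Lemma mcoeff_letters x o : (letters x)@_o = if o is Some b then x@_b else 0.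
Proof.
rewrite [x in RHS]monalgE /letters /lin raddf_sum; case: o => [b|] /=.
  rewrite raddf_sum; apply: eq_bigr => b' _.
  by rewrite /= mcoeffZ !mcoeffU mulr_natr.
by apply: big1 => b' _; rewrite mcoeffZ mcoeffU mulr0.
Qed.

Lemma dA_Some b : dA << Some b >> = d1 dA b *: << None >> - letters (m [:: b]).
Proof.
apply/malgP => -[b'|]; rewrite mcoeffB mcoeffZ mcoeffU mcoeff_letters.
  by rewrite (ainf_m1 ainfA) mulr0 sub0r opprK.
by rewrite mulr1 subr0.
Qed.

(** The length 1 identity, m_1 m_1 = 0, comes from [dA] squaring to zero: [dA] kills the component
    at [None], so [dA] vanishes on the letters of [m [:: b]], and forgetting [None] turns this into
    a statement about m_1. *)
Lemma stasheff_letter b : stasheff degB m [:: b] = 0.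
Proof.
rewrite stasheffE word_diff_cons word_diff_nil lin0 scaler0 addr0 [splittings _ _]addr0 lin_lin.
rewrite (eq_lin (g := fun b' => m [:: b'])); last by move=> b'; rewrite lin1.
pose r := lin (oapp (fun b => << b >>) 0) : {malg Q[option B]} -> {malg Q[B]}.
have rl x : r (letters x) = x.
  by rewrite /r lin_lin -[RHS]lin_id; apply: eq_lin => b'; rewrite lin1.
have E : dA (letters (m [:: b])) = 0.
  have := dA_sq << Some b >>; rewrite dA_Some linearB linearZ /= dA_None scaler0 sub0r.
  by move/eqP; rewrite oppr_eq0 => /eqP.
have := congr1 r E; rewrite [r 0]lin0 => F; rewrite -[RHS]oppr0 -{}F.
rewrite [dA _]linear_lin /r lin_lin -lin_oppf; apply: eq_lin => b'.
by rewrite dA_Some linD linZ lin1 scaler0 add0r linN -/r rl opprK.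
Qed.

Lemma empty_wordU c x : empty_word (x *: << c >>) = x *: << ([::] : seq B, c) >> :> U.
Proof. by rewrite [LHS]linZ lin1. Qed.

(** Among the algebra sums only those of length 2 are nonzero. On a word beginning with [b], [b']
    the head gives d_1(b) b' - d_1(b') b in front of the rest, and the second term cancels against
    the induction hypothesis prepended by [b]. On a one-letter word the module relation gives d_1(b)
    directly. *)
Theorem bar_diff_sq w c :
  lin bar_diff (bar_diff (w, c)) = if w is b :: w' then d1 dA b *: << (w', c) >> else 0.
Proof.
have z : stasheff degB m [::] = 0 by rewrite stasheffE word_diff_nil lin0.
have h0 v : head_tens v (0 : {malg Q[B]}) = 0 := lin0 _.
elim: w => [|b [|b' w] IH]; rewrite bar_diff_bar_diff /=.
- rewrite z h0 !addr0 add0r stasheffGE bar_diff_nil lin_empty_word /=.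
  rewrite (eq_lin (g := fun c' => dG << c' >>)); last exact: (ainfG_m1 ainfG).
  by rewrite -linear_linE (ainfG_m1 ainfG) dG_sq [empty_word 0]lin0.
- rewrite z stasheff_letter !h0 !addr0 !add0r IH [prepend b 0]lin0 addr0.
  by rewrite (ainfG_m2 ainfG) empty_wordU.
have gz : stasheffG degB m mG ([:: b, b' & w], c) = 0 by exact: (ainfG_stasheff ainfG).
rewrite z stasheff_letter !h0 !add0r IH gz [empty_word 0]lin0 addr0.
have -> : splittings (fun w1 w2 => head_tens (w2, c) (stasheff degB m [:: b, b' & w1])) w
    = head_tens (w, c) (stasheff degB m [:: b; b']).
  case: w {IH gz} => [|b2 w] /=; first by rewrite addr0.
  rewrite splittings_eq0 ?addr0 // => w1 w2.
  by rewrite (ainf_stasheff ainfA) // h0.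
rewrite (ainf_m2 ainfA) [head_tens _ _]linD linN !linZ !lin1 [prepend _ _]linZ lin1.
exact: subrK.
Qed.

Lemma insert_mG_deg i j w c : (0 < i)%N -> (j + i <= (size w).+1)%N ->
  supp_in (fun v => (bar_deg degB degC v).+1 = bar_deg degB degC (w, c)
     /\ (size v.1 + i = (size w).+1)%N) (insert_mG degB m mG i j (w, c)).
Proof.
move=> i0 le; apply: supp_inZ; case: (leqP (j + i) (size w)) => lei.
  apply: supp_in_lin => b Hb; apply: supp_inU; rewrite /bar_deg /=.
  have nz : take i (drop j w) != [::].
    rewrite -size_eq0 -lt0n size_take size_drop; case: (ltnP i) => _ //.
      by rewrite subn_gt0; apply: leq_trans lei; rewrite -addn1 leq_add2l.
  have := ainf_deg ainfA nz Hb => E; split; last first.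
    rewrite size_cat /= size_take size_drop.
    have lj : (j < size w)%N by apply: leq_trans lei; rewrite -addn1 leq_add2l.
    by rewrite lj addnS addSn; congr _.+1; rewrite -addnA addnC -addnA [(i + j)%N]addnC subnK.
  rewrite -[w in RHS](cat_take_drop j) -(cat_take_drop i (drop j w)) drop_drop addnC.
  rewrite [(i + j)%N]addnC !sdeg_cat sdeg_cons -E; lia.
apply: supp_in_lin => c' Hc'; apply: supp_inU; rewrite /bar_deg /=.
have Ej : (j + i = (size w).+1)%N by apply/eqP; rewrite eqn_leq le lei.
have := ainfG_deg ainfG Hc' => E; split; last first.
  rewrite size_take; case: ltngtP Ej => [_|lt|->] //; lia.
rewrite -[w in RHS](cat_take_drop j) sdeg_cat; move: E; rewrite /bar_deg /=; lia.
Qed.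

Lemma bar_t_deg i u : (0 < i)%N ->
  supp_in (fun v => (bar_deg degB degC v).+1 = bar_deg degB degC u
     /\ (size v.1 + i = (size u.1).+1)%N) (bar_t degB m mG i u).
Proof.
case: u => w c i0; rewrite /bar_t big_nat_cond.
apply: supp_in_sum => j; rewrite /= andbT => lt.
by apply: insert_mG_deg => //; lia.
Qed.

Lemma bar_diff_deg u : supp_in (fun v => (bar_deg degB degC v).+1 = bar_deg degB degC u) (bar_diff u).
Proof.
rewrite /bar_diff big_nat_cond; apply: supp_in_sum => i /andP[/andP[i0 _] _].
by have := bar_t_deg (u := u) i0; apply: supp_inW => v [].
Qed.

End BarSquare.

(** * The bar resolution of M over R *)

Lemma lin_retract (S : nzRingType) (U V : choiceType) (i : U -> V) (r : V -> {malg S[U]})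
    (x : {malg S[U]}) :
  (forall u, r (i u) = << u >>) -> lin r (lin (fun u => << i u >>) x) = x.
Proof.
by move=> E; rewrite lin_lin -[RHS]lin_id; apply: eq_lin => u; rewrite lin1 E.
Qed.

Lemma choice_of (X Y : Type) (P : X -> Y -> Prop) :
  (forall x, exists y, P x y) -> exists f, forall x, P x (f x).
Proof.
move=> ex; exists (fun x => proj1_sig (constructive_indefinite_description _ (ex x))) => x.
exact: proj2_sig.
Qed.

Section BarResolution.
Context {Q R : comNzRingType} (pi : {rmorphism Q -> R}) {M : lmodType R}.
Context {B C : choiceType} {degB : B -> nat} {degC : C -> nat}.
Context {dA : {linear {malg Q[option B]} -> {malg Q[option B]}}}.
Context {epsA : {malg Q[option B]} -> R^o}.
Context {dG : {linear {malg Q[C]} -> {malg Q[C]}}} {epsG : {malg Q[C]} -> M}.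
Context {m : seq B -> {malg Q[B]}} {mG : seq B -> C -> {malg Q[C]}}.
Hypothesis pi_surj : surjective pi.
Hypothesis degB_gt0 : forall b, (0 < degB b)%N.
Hypothesis resA : free_resolution pi (odeg degB) dA epsA.
Hypothesis epsA1 : epsA << None >> = 1.
Hypothesis resG : free_resolution pi degC dG epsG.
Hypothesis ainfA : ainf_algebra degB dA m.
Hypothesis ainfG : ainf_module degB degC dA dG m mG.

Local Notation W := (seq B * C)%type.
Local Notation U := {malg Q[W]}.
Local Notation bar_diff := (bar_diff degB m mG).
Local Notation delta := (lin bar_diff).
Local Notation bar_deg := (bar_deg degB degC).
Implicit Types (b : B) (w : seq B) (c : C) (u v t : W).

Lemma dA_None : dA << None >> = 0.
Proof. by apply: (res_diff_eq0 resA). Qed.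

Let dAA := res_diff_sq resA.
Let dGG := res_diff_sq resG.

Lemma delta_sq u :
  delta (bar_diff u) = if u.1 is b :: w then d1 dA b *: << (w, u.2) >> else 0.
Proof. by case: u => w c; exact: (bar_diff_sq ainfA ainfG dAA dA_None dGG). Qed.

Lemma delta_delta (x : U) : delta (delta x)
  = lin (fun u => if u.1 is b :: w then d1 dA b *: << (w, u.2) >> else 0) x.
Proof. by rewrite lin_lin; apply: eq_lin => u; rewrite delta_sq. Qed.

Definition strip_None : {malg Q[option B]} -> {malg Q[B]} :=
  lin (oapp (fun b => << b >>) 0).

HB.instance Definition _ := GRing.Linear.on strip_None.

Lemma lettersK x : strip_None (letters x) = x.
Proof. exact: lin_retract. Qed.

Lemma dA_letters x :
  dA (letters x) = lin (fun b => << d1 dA b *g None >>) x - letters (lin (fun b => m [:: b]) x).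
Proof.
rewrite [dA _]linear_lin [letters (lin _ _)]lin_lin -lin_oppf -lin_addf.
by apply: eq_lin => b; rewrite (dA_Some ainfA) -malgUZ.
Qed.

Lemma d1_eq0 b : degB b <> 1%N -> d1 dA b = 0.
Proof.
move=> ne; apply/eqP; rewrite mcoeff_eq0; apply/negP => /(res_diff_deg resA) /= E.
exact: ne.
Qed.

(** [epsA] kills the boundary of [Some b] and sees only its component at [None], on which it is
    [pi]. *)
Lemma pi_d1 b : pi (d1 dA b) = 0.
Proof.
have sA := res_aug_semilinear resA.
have := res_aug_diff resA << Some b >>; rewrite (dA_Some ainfA).
rewrite (semilinearD _ _ sA) (semilinearN _ sA) (semilinearZ _ _ sA) epsA1.
have -> : epsA (letters (m [:: b])) = 0.
  apply: (semilinear_eq0 sA) => o Ho; apply: (res_aug_deg resA).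
  case: o Ho => [b'|] /=; first by rewrite degB_gt0.
  by rewrite -mcoeff_neq0 mcoeff_letters eqxx.
by rewrite subr0 => E; rewrite -[LHS]mulr1.
Qed.

Lemma homog_strip n (y : {malg Q[option B]}) : homog (odeg degB) n.+1 y ->
  letters (strip_None y) = y /\ homog degB n.+1 (strip_None y).
Proof.
move=> Hy; split.
  rewrite [LHS]lin_lin -[RHS]lin_id; apply: eq_lin_supp => -[b|] /Hy //= _.
  by rewrite lin1.
by apply: supp_in_lin => -[b|] /Hy //= E; apply: supp_inU.
Qed.

(** Acyclicity of A in positive degrees, carried over to the letters in front of a fixed tail [t].
    The sign is that of m_1 = - d_A. The letters of [y] have degree at least 2, so [d1] vanishes on
    them; this will make delta^2 vanish on the correction built from [y]. *)
Lemma letter_fill n t (a : {malg Q[B]}) :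
  supp_in (fun b => bar_deg (b :: t.1, t.2) = n) a -> dA (letters a) = 0 ->
  exists y, [/\ supp_in (fun b => bar_deg (b :: t.1, t.2) = n.+1) y,
     lin (fun b => m [:: b]) y = - a & supp_in (fun b => d1 dA b = 0) y].
Proof.
(* The degree of the cycle in A is read off a letter [b0] of [a], so [a = 0] is treated apart. *)
move=> Ha da; have [a0|[b0 Hb0]] := fset_0Vmem (msupp a).
  have {}a0 : a = 0.
    by apply: (@supp_in_empty _ _ (fun=> False)) => [b []|b]; rewrite a0.
  exists 0; rewrite a0 oppr0 lin0; split => //; exact: supp_in0.
have degE b : b \in msupp a -> degB b = degB b0.
  move=> /Ha; rewrite -(Ha _ Hb0) /bar_deg !sdeg_cons /=; lia.
have [] := res_fill resA (n := degB b0) _ da.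
- by apply: supp_in_lin => b Hb; apply: supp_inU => /=; exact: degE.
- by move=> E; have := degB_gt0 b0; rewrite E.
move=> y Hy dy; have [yE Hs] := homog_strip Hy.
exists (strip_None y); split.
- apply: supp_inW Hs => b E; rewrite -(Ha _ Hb0) /bar_deg !sdeg_cons /= E; lia.
- have := congr1 strip_None dy; rewrite lettersK => <-.
  rewrite -{2}yE dA_letters linearB /= lettersK.
  have -> : strip_None (lin (fun b => << d1 dA b *g None >>) (strip_None y)) = 0.
    by rewrite [LHS]lin_lin; apply: lin_eq0 => b _; rewrite linE /= scaler0.
  by rewrite sub0r opprK.
apply: supp_inW Hs => b E; apply: d1_eq0; rewrite E => -[z].
by have := degB_gt0 b0; rewrite z.
Qed.

(* Exactness is shown by descending on the degree of the word after the first
   letter: the part of a cycle with tail [t] of top degree is an [A]-cycle. *)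
Definition tails_lt n : U -> Prop :=
  supp_in (fun u => if u.1 is b :: w then (bar_deg (w, u.2) < n)%N else True).

(** Only m_1 on the first letter keeps the tail [t]. Longer operations at the head eat into the
    tail, and operations behind [b] lower its degree by one; empty words are unconstrained in
    [tails_lt]. *)
Lemma bar_diff_tail b t :
  tails_lt (bar_deg t) (bar_diff (b :: t.1, t.2) - head_tens t (m [:: b])).
Proof.
case: t => w c /=; rewrite bar_diff_cons splittingsE big_nat_recl // take0 drop0.
rewrite -!addrA addrC -!addrA addNr addr0 !addrA; apply: supp_inD; last first.
  apply: supp_inZ; apply: supp_in_lin => v /(bar_diff_deg ainfA ainfG) E.
  by apply: supp_inU; rewrite /= -surjective_pairing -E.
apply: supp_inD; last by apply: supp_in_lin => c' _; apply: supp_inU.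
rewrite big_nat_cond; apply: supp_in_sum => i /andP[/andP[_ lt] _].
apply: supp_in_lin => b' _; apply: supp_inU; rewrite /bar_deg /=.
case: (w) lt => [//|b2 w'] /= _.
by rewrite -{2}[w'](cat_take_drop i) sdeg_cons sdeg_cat; lia.
Qed.

Definition head_letters t : U -> {malg Q[B]} :=
  lin (fun u => if u.1 is b :: w then if (w, u.2) == t then << b >> else 0 else 0).

Lemma head_letters_lt t x : tails_lt (bar_deg t) x -> head_letters t x = 0.
Proof.
move=> Hx; apply: lin_eq0 => -[[|b w] c] // /Hx /=.
by case: eqP => // <-; rewrite ltnn.
Qed.

(** Two components of [dA] have to vanish. The one in A_+ is, up to sign, the part of [delta x] with
    tail [t], to which only m_1 contributes because [t] has top degree. The one in A_0 is the
    coefficient of [t] in [delta (delta x)]. *)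
Lemma head_letters_cycle n x t : bar_deg t = n -> tails_lt n.+1 x -> delta x = 0 ->
  dA (letters (head_letters t x)) = 0.
Proof.
move=> En Hx dx; rewrite dA_letters.
have -> : lin (fun b => m [:: b]) (head_letters t x) = head_letters t (delta x).
  rewrite /head_letters !lin_lin; apply: eq_lin_supp => -[[|b w] c] Hu /=.
    rewrite lin0 bar_diff_nil lin_empty_word lin_eq0 //.
  have := @bar_diff_tail b (w, c) => /=; set z := bar_diff _ - _ => Hz.
  have -> : bar_diff (b :: w, c) = head_tens (w, c) (m [:: b]) + z.
    by rewrite addrC subrK.
  rewrite linD lin_head_tens /= -[lin _ z]/(head_letters t z) head_letters_lt; last first.
    apply: supp_inW Hz => -[[|b' w'] c'] //= lt; rewrite En.
    by move/Hx: Hu => /=; rewrite ltnS; apply: leq_trans.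
  rewrite addr0; case: eqP => E; last by rewrite lin0 lin_eq0.
  by rewrite lin1 lin_id.
rewrite dx [head_letters t 0]lin0 [letters 0]lin0 subr0.
have -> : lin (fun b => << d1 dA b *g None >>) (head_letters t x)
   = lin (fun u => if u == t then << None >> else 0) (delta (delta x)) :> {malg Q[option B]}.
  rewrite delta_delta /head_letters !lin_lin; apply: eq_lin => -[[|b w] c] /=.
    by rewrite !lin0.
  rewrite linZ lin1; case: ((w, c) == t); first by rewrite lin1 -malgUZ.
  by rewrite lin0 scaler0.
by rewrite dx !lin0.
Qed.

Definition bar_aug : {malg R[W]} -> M :=
  lin (fun u => if u.1 is [::] then epsG << u.2 >> else 0).
HB.instance Definition _ := GRing.Linear.on bar_aug.

Lemma bar_aug_semilinear : semilinear_along pi (fun x => bar_aug (base_change pi x)).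
Proof. by move=> c x y; rewrite base_changeP linearP. Qed.

Lemma bar_aug_empty y : bar_aug (base_change pi (empty_word y)) = epsG y.
Proof.
have sG := res_aug_semilinear resG.
apply: (semilinear_eq_supp (phi := pi) (F := fun y => bar_aug (base_change pi (empty_word y)))) => //.
  by move=> c x z; rewrite linearP base_changeP linearP.
by move=> c _; rewrite /= [empty_word _]lin1 base_change1 [LHS]lin1.
Qed.

Lemma bar_aug_deg u : (0 < bar_deg u)%N -> bar_aug << u >> = 0.
Proof.
case: u => -[|b w] c; rewrite /bar_deg [bar_aug _]lin1 //= sdeg_nil.
exact: (res_aug_deg resG).
Qed.

Lemma bar_aug_delta x : bar_aug (base_change pi (delta x)) = 0.
Proof.
apply: (semilinear_eq0 (phi := pi) (F := fun x => bar_aug (base_change pi (delta x)))).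
  by move=> c y z; rewrite linP base_changeP linearP.
move=> -[[|b w] c] _ /=; rewrite lin1.
  by rewrite bar_diff_nil bar_aug_empty (ainfG_m1 ainfG) (res_aug_diff resG).
apply: (semilinear_eq0 bar_aug_semilinear) => v /(bar_diff_deg ainfA ainfG) E.
rewrite base_change1; apply: bar_aug_deg.
move: E; rewrite {2}/bar_deg sdeg_cons; have := degB_gt0 b; rewrite /bar_deg; lia.
Qed.

Lemma delta_part n x :
  part (fun u => bar_deg u == n) (delta x) = delta (part (fun u => bar_deg u == n.+1) x).
Proof.
apply: (part_linear (F := delta)) => u /=; rewrite lin1 => v /(bar_diff_deg ainfA ainfG) <-.
by rewrite eqSS.
Qed.

Lemma tails_lt_delta_head t (y : {malg Q[B]}) :
  tails_lt (bar_deg t) (delta (head_tens t y) - head_tens t (lin (fun b => m [:: b]) y)).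
Proof.
rewrite lin_head_tens [head_tens t (lin _ _)]lin_lin -lin_oppf -lin_addf.
apply: supp_in_lin => b _; exact: bar_diff_tail.
Qed.

(** The letters in front of each tail of degree [N] are bounded in A, and the finitely many
    corrections are added up. They use letters on which [d1] is zero, so [delta y] is again a cycle
    although [delta] does not square to zero. *)
Lemma tails_lt_reduce n N x : homog bar_deg n x -> delta x = 0 -> tails_lt N.+1 x ->
  exists y, [/\ homog bar_deg n.+1 y, delta (delta y) = 0 & tails_lt N (x + delta y)].
Proof.
move=> Hx dx tx.
(* [top] selects the words whose tail has degree exactly [N]; [ts] lists these tails without
   repetition, so that each is corrected once. *)
pose top u := if u.1 is b :: w then bar_deg (w, u.2) == N else false.
pose ts := undup [seq (behead u.1, u.2) | u <- msupp x & top u].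
have tsN t : t \in ts -> bar_deg t = N.
  by rewrite mem_undup => /mapP[[[|b w] c]]; rewrite mem_filter // => /andP[/eqP E _] ->.
have ex t : t \in ts -> exists y,
   [/\ supp_in (fun b => bar_deg (b :: t.1, t.2) = n.+1) y,
     lin (fun b => m [:: b]) y = - head_letters t x & supp_in (fun b => d1 dA b = 0) y].
  move=> /tsN Et; apply: letter_fill; last exact: head_letters_cycle tx dx.
  apply: supp_in_lin => -[[|b w] c] Hu /=; first exact: supp_in0.
  case: eqP => [<-|_]; last exact: supp_in0.
  by apply: supp_inU => /=; apply: Hx.
pose h t := epsilon (inhabits 0) (fun y : {malg Q[B]} =>
   [/\ supp_in (fun b => bar_deg (b :: t.1, t.2) = n.+1) y,
     lin (fun b => m [:: b]) y = - head_letters t x & supp_in (fun b => d1 dA b = 0) y]).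
have hP t : t \in ts -> [/\ supp_in (fun b => bar_deg (b :: t.1, t.2) = n.+1) (h t),
     lin (fun b => m [:: b]) (h t) = - head_letters t x & supp_in (fun b => d1 dA b = 0) (h t)].
  by move=> /ex; exact: epsilon_spec.
have topE : \sum_(t <- ts) head_tens t (head_letters t x) = part top x.
  transitivity (\sum_(t <- ts) lin (fun u => if u.1 is b :: w then if (w, u.2) == t then << u >> else 0 else 0 : U) x).
    apply: eq_bigr => t _; rewrite [LHS]lin_lin; apply: eq_lin => -[[|b w] c] /=.
      by rewrite lin0.
    by case: eqP => [<-|_]; rewrite ?lin1 ?lin0.
  rewrite -lin_sumf; apply: eq_lin_supp => -[[|b w] c] Hu /=.
    by rewrite /top /= big1.
  case E : (top (b :: w, c)); last first.
    rewrite big1_seq // => t /andP[_ /tsN Et]; case: eqP => // Et2.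
    by move: E; rewrite /top /= Et2 Et eqxx.
  have Ht : (w, c) \in ts.
    by rewrite mem_undup; apply/mapP; exists (b :: w, c); rewrite ?mem_filter ?E.
  rewrite (bigD1_seq (w, c)) ?undup_uniq //= eqxx big1 ?addr0 // => t.
  by rewrite eq_sym => /negPf ->.
exists (\sum_(t <- ts) head_tens t (h t)); split.
- apply: supp_in_sum_seq => t /hP[H _ _].
  by apply: supp_in_lin => b Hb; apply: supp_inU; apply: H.
- rewrite [delta (\sum_(t <- ts) _)]lin_sum lin_sum; apply: big1_seq => t /andP[_ Ht]; have [_ _ H] := hP t Ht.
  by rewrite delta_delta lin_head_tens /=; apply: lin_eq0 => b /H ->; rewrite scale0r.
rewrite lin_sum [x](partC top) -topE addrAC -big_split /=.
apply: supp_inD; last first.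
  move=> [[|b w] c] //= Hu; have ne := supp_in_part Hu.
  have := tx _ (supp_in_part_sub (P' := fun u => u \in msupp x) (fun _ h => h) Hu).
  by rewrite /= ltnS leq_eqVlt => /predU1P[E|//]; rewrite /= /top /= E eqxx in ne.
apply: supp_in_sum_seq => t Ht; have [_ E _] := hP t Ht.
have := @tails_lt_delta_head t (h t); rewrite E tsN //.
by rewrite [head_tens t (- _)]linN opprK addrC.
Qed.

(** Each reduction changes the cycle by some [delta y] and lowers the bound on the tails. At bound 0
    no letters are left, and exactness of G finishes. *)
Lemma delta_exact n x : homog bar_deg n x -> delta x = 0 ->
  (n = 0%N -> bar_aug (base_change pi x) = 0) -> exists y, x = delta y.
Proof.
move=> Hx dx ex.
have [N] : exists N, tails_lt N x.
  exists n => -[[|b w] c] // /Hx <-; rewrite /bar_deg /= sdeg_cons; lia.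
elim: N x Hx dx ex => [|N IH] x Hx dx ex tx.
  have xE : x = empty_word (lin (fun u => << u.2 >>) x).
    rewrite [RHS]lin_lin -[LHS]lin_id; apply: eq_lin_supp => -[[|b w] c] /tx //= _.
    by rewrite lin1.
  move: (lin _ x) xE => z xE.
  have dz : dG z = 0.
    have := dx; rewrite xE lin_empty_word => /(congr1 (lin (fun u => << u.2 >>))).
    rewrite lin0 lin_lin => E; rewrite -[RHS]E linear_linE; apply: eq_lin => c.
    by rewrite bar_diff_nil (ainfG_m1 ainfG) [RHS]lin_retract.
  have Hz : homog degC n z.
    have -> : z = lin (fun u => << u.2 >>) x by rewrite xE lin_retract.
    apply: supp_in_lin => -[[|b w] c]; first by move=> /Hx; rewrite /bar_deg /= sdeg_nil => E; apply: supp_inU.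
    by move/tx.
  have [|y Hy Ey] := res_fill resG Hz dz.
    by move=> n0; rewrite -bar_aug_empty -xE ex.
  exists (empty_word y); rewrite xE -Ey lin_empty_word [dG y]linear_linE [LHS]lin_lin.
  by apply: eq_lin => c; rewrite bar_diff_nil (ainfG_m1 ainfG).
have [y [Hy ddy ty]] := tails_lt_reduce Hx dx tx.
have [||||z Ez] := IH (x + delta y).
- apply: supp_inD => //; apply: supp_in_lin => u /Hy [Eu] v /(bar_diff_deg ainfA ainfG).
  by rewrite Eu => -[].
- by rewrite linD dx ddy addr0.
- move=> n0; rewrite raddfD /= linearD /= (ex n0) bar_aug_delta addr0 //.
- exact: ty.
by exists (z - y); rewrite linD linN -Ez addrK.
Qed.

Definition bar_diffR : {malg R[W]} -> {malg R[W]} := bc_map pi delta.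
HB.instance Definition _ := GRing.Linear.on bar_diffR.

Lemma bar_diffR_base_change x : bar_diffR (base_change pi x) = base_change pi (delta x).
Proof. exact: bc_map_base_change. Qed.

Lemma base_change_delta_sq u : base_change pi (delta (bar_diff u)) = 0.
Proof.
rewrite delta_sq; case: (u.1) => [|b w]; first exact: raddf0.
by rewrite base_changeZ pi_d1 scale0r.
Qed.

(* The ideal [I] is the image of [d1], so [delta^2] has image [I * U]. *)
Lemma kernel_in_delta_sq x : base_change pi x = 0 -> exists y, delta (delta y) = x.
Proof.
move=> x0; have sA := res_aug_semilinear resA.
have ex u : exists a, homog degB 1 a /\ dA (letters a) = << x@_u *g None >>.
  have [||| y Hy dy] := @res_fill _ _ _ _ _ _ _ _ resA 0 << x@_u *g None >>.
  - exact: supp_inU.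
  - by rewrite malgUZ linearZ /= dA_None scaler0.
  - move=> _; rewrite malgUZ (semilinearZ _ _ sA) -mcoeff_base_change x0 mcoeff0.
    by rewrite scale0r.
  have [E H] := homog_strip Hy; exists (strip_None y); split; first exact: H.
  by rewrite E.
have [a Ha] := choice_of ex.
exists (\sum_(u <- msupp x) head_tens u (a u)).
rewrite [delta (\sum_(u <- msupp x) _)]lin_sum lin_sum [RHS]monalgE; apply: eq_bigr => u _.
have [_ /(congr1 (mcoeff None))] := Ha u.
rewrite delta_delta lin_head_tens dA_letters mcoeffB mcoeff_letters subr0 mcoeffUU => <-.
rewrite /lin raddf_sum /= malgUZ scaler_suml; apply: eq_bigr => b _.
by rewrite mcoeffZ mcoeffUU -surjective_pairing scalerA.
Qed.

(** A lift [v] of the cycle is corrected by [delta y], which reduces to a boundary over [R]. Since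
    [y] need not be homogeneous, [v - delta y] is cut down to degree [n] before [delta_exact] is
    applied. *)
Lemma bar_exact n x : homog bar_deg n x -> bar_diffR x = 0 ->
  (n = 0%N -> bar_aug x = 0) -> exists y, x = bar_diffR y.
Proof.
move=> Hx dx ex; have [v Hv Ev] := base_change_surj pi_surj Hx.
move: dx; rewrite -Ev bar_diffR_base_change => /kernel_in_delta_sq[y Ey].
pose P k u := bar_deg u == k.
have vE : part (P n) v = v by apply: part_id => u /Hv E; apply/eqP.
have [||| z Ez] := @delta_exact n (part (P n) (v - delta y)).
- by move=> u /supp_in_part /eqP.
(* In degree 0 there is nothing below, so [delta] vanishes; in higher degrees the cut commutes with
   [delta] up to a shift. *)
- case: n {Hx Hv ex} vE => [|n] vE; last first.
    by rewrite -delta_part linD linN Ey subrr linear0.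
  rewrite linear_linE /=; apply: lin_eq0 => u /supp_in_part /eqP Eu; rewrite lin1.
  apply: (@supp_in_empty _ _ (fun v => (bar_deg v).+1 = bar_deg u)); last exact: bar_diff_deg ainfA ainfG _.
  by rewrite Eu.
- move=> n0; rewrite linearB /= vE delta_part raddfB /= linearB /= bar_aug_delta subr0 Ev.
  exact: ex.
exists (base_change pi (z + part (P n.+1) y)).
rewrite bar_diffR_base_change linD -Ez linearB /= vE delta_part subrK; exact: erefl.
Qed.

Theorem bar_resolution : free_resolution idfun bar_deg bar_diffR bar_aug.
Proof.
split.
- move=> u v; rewrite /= /bar_diffR bc_map1 lin1 => Hv.
  exact: (supp_in_base_change (bar_diff_deg ainfA ainfG (u := u)) Hv).
- move=> x; suff E : bar_diffR \o bar_diffR =1 \0 by exact: E.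
  apply: linear_eq => u; rewrite /= {2}/bar_diffR bc_map1 bar_diffR_base_change lin1.
  exact: base_change_delta_sq.
- by move=> c x y; rewrite linearP.
- exact: bar_aug_deg.
- move=> x; suff E : bar_aug \o bar_diffR =1 \0 by exact: E.
  apply: linear_eq => u; rewrite /= {1}/bar_diffR bc_map1; exact: bar_aug_delta.
- move=> a; have [y <-] := res_aug_surj resG a.
  by exists (base_change pi (empty_word y)); rewrite bar_aug_empty.
- move=> x Hx ex; apply: (bar_exact Hx) => //.
  rewrite linear_linE; apply: lin_eq0 => u /Hx Eu; rewrite /= /bar_diffR bc_map1 lin1.
  apply: (@supp_in_empty _ _ (fun v => (bar_deg v).+1 = bar_deg u)); first by rewrite Eu.
  exact: (supp_in_base_change (bar_diff_deg ainfA ainfG (u := u))).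
by case=> [//|n] x _ Hx dx; apply: (bar_exact Hx).
Qed.

End BarResolution.

(** * The filtration by word length, survival and the differentials *)

Lemma big_nat_widen_zero (N : nmodType) (a n K : nat) (F : nat -> N) :
  (a <= n <= K)%N -> (forall i, (n <= i < K)%N -> F i = 0) ->
  \sum_(a <= i < n) F i = \sum_(a <= i < K) F i.
Proof.
move=> /andP[an nK] F0; rewrite [RHS](big_cat_nat an nK) /= [X in _ + X]big_nat_cond.
by rewrite [X in _ + X]big1 ?addr0 // => i; rewrite andbT => /F0.
Qed.

Section FilteredBar.
Context {Q : comNzRingType} {k : fieldType} (kap : {rmorphism Q -> k}).
Context {B C : choiceType} {degB : B -> nat} {degC : C -> nat}.
Context {dA : {linear {malg Q[option B]} -> {malg Q[option B]}}}.
Context {dG : {linear {malg Q[C]} -> {malg Q[C]}}}.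
Context {m : seq B -> {malg Q[B]}} {mG : seq B -> C -> {malg Q[C]}}.
Hypothesis ainfA : ainf_algebra degB dA m.
Hypothesis ainfG : ainf_module degB degC dA dG m mG.

Local Notation W := (seq B * C)%type.
Local Notation X := {malg k[W]}.
Local Notation D := (dX degB m mG kap).
Local Notation t := (t_ degB m mG kap).
Local Notation bar_deg := (bar_deg degB degC).
Implicit Types (p r s : int) (x y z : X) (u v : W).

HB.instance Definition _ := GRing.Linear.on D.
HB.instance Definition _ i := GRing.Linear.on (t i).

Definition word_part s : X -> X := part (fun u => (size u.1)%:Z == s).
HB.instance Definition _ s := GRing.Linear.on (word_part s).

Lemma FilW p p' x : p <= p' -> Fil p x -> Fil p' x.
Proof. by move=> le H u /H h; lia. Qed.

Lemma Fil0 p : Fil p (0 : X). Proof. exact: supp_in0. Qed.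

Lemma FilB p x y : Fil p x -> Fil p y -> Fil p (x - y).
Proof. exact: supp_inB. Qed.

Lemma FilD p x y : Fil p x -> Fil p y -> Fil p (x + y).
Proof. exact: supp_inD. Qed.

Lemma Fil_lt0 p x : p < 0 -> Fil p x -> x = 0.
Proof. by move=> lt; apply: supp_in_empty => -[w c] /=; lia. Qed.

Lemma E0_Fil p x : E0 p x -> Fil p x.
Proof. by apply: supp_inW => u ->. Qed.

Lemma E0_word_part p x : E0 p (word_part p x).
Proof. by move=> u /supp_in_part /eqP. Qed.

Lemma word_part_E0 p s x : E0 p x -> word_part s x = if p == s then x else 0.
Proof.
move=> Hx; case: eqP => [E|ne].
  by apply: part_id => u /Hx ->; rewrite E eqxx.
by apply: part_eq0 => u /Hx ->; apply/eqP.
Qed.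

Lemma Fil_word_part p x : (forall s, p < s -> word_part s x = 0) -> Fil p x.
Proof.
move=> H u Hu; case: (boolP ((size u.1)%:Z <= p)) => // gt.
have /malgP /(_ u) : word_part (size u.1) x = 0 by apply: H; move: gt; case: (u) => w c /=; lia.
by rewrite mcoeff_part eqxx mcoeff0 => /eqP; rewrite mcoeff_eq0 Hu.
Qed.

Lemma word_part_Fil p s x : Fil p x -> p < s -> word_part s x = 0.
Proof. by move=> Hx lt; apply: part_eq0 => -[w c] /Hx /= le; lia. Qed.

Lemma Fil_sub_word_part p x : Fil p x -> Fil (p - 1) (x - word_part p x).
Proof.
move=> Hx; apply: Fil_word_part => s lt; rewrite linearB /=.
rewrite (word_part_E0 s (@E0_word_part p x)); case: eqP => [->|ne]; first exact: subrr.
by rewrite subr0; apply: (word_part_Fil Hx); lia.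
Qed.

Lemma t_deg i u : (0 < i)%N ->
  supp_in (fun v => (bar_deg v).+1 = bar_deg u /\ (size v.1 + i = (size u.1).+1)%N) (t i << u >>).
Proof.
by move=> i0; rewrite /t lin1; apply: supp_in_base_change; exact: (bar_t_deg ainfA ainfG i0).
Qed.

Lemma t_ge i u : (size u.1 + 2 <= i)%N -> t i << u >> = 0.
Proof.
move=> le; rewrite /t lin1 /bar_t big_geq ?raddf0 //; lia.
Qed.

Lemma D_sum_t u K : (size u.1 + 2 <= K)%N -> D << u >> = \sum_(1 <= i < K) t i << u >>.
Proof.
move=> le; rewrite /dX lin1 raddf_sum /=.
rewrite -(@big_nat_widen_zero _ 1 (size u.1).+2 K); [|lia|].
  by apply: eq_bigr => i _; rewrite /t lin1.
by move=> i lei; apply: t_ge; lia.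
Qed.

(** [t i] shortens words by [i - 1], so length [p - n + 1] is reached from length [p - n + i]. For
    [i > n] this would require words longer than [p]. *)
Lemma word_part_D p x (n : nat) : Fil p x ->
  word_part (p - n%:Z + 1) (D x) = \sum_(1 <= i < n.+1) t i (word_part (p - n%:Z + i%:Z) x).
Proof.
move=> Hx.
have tE i s : t i (word_part s x) = lin (fun u => t i (word_part s << u >>)) x.
  exact: (linear_linE (t i \o word_part s)).
rewrite [LHS](linear_linE (word_part _ \o D)) (eq_bigr _ (fun i _ => tE i _)) -lin_sumf.
apply: eq_lin_supp => -[w c] /Hx /= le; set u := (w, c).
(* [size w + 2 + n] bounds the ranges of both sums; the added terms are zero. *)
rewrite (@D_sum_t u (size w + 2 + n)) ?leq_addr // linear_sum /=.
rewrite [RHS](@big_nat_widen_zero _ 1 n.+1 (size w + 2 + n)); [|lia|]; last first.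
  move=> i lei; rewrite [word_part _ << u >>]part_eq0 ?linear0 //.
  by apply: supp_inU => /=; move: lei le; lia.
apply: eq_big_nat => i /andP[i0 _].
case E : ((size w)%:Z == p - n%:Z + i%:Z).
  rewrite [word_part _ << u >>]part_id; last by apply: supp_inU.
  by apply: part_id => -[w' c'] /(t_deg i0) [_ /= Es]; apply/eqP; lia.
rewrite [word_part _ << u >>]part_eq0 ?linear0; last by apply: supp_inU; rewrite /= E.
by apply: part_eq0 => -[w' c'] /(t_deg i0) [_ /= Es]; lia.
Qed.

Lemma D_Fil p x : Fil p x -> Fil p (D x).
Proof.
move=> Hx; apply: supp_in_linear => -[w c] /Hx /= le.
rewrite (D_sum_t (leqnn _)) big_nat_cond; apply: supp_in_sum => i /andP[/andP[i0 _] _].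
by have := @t_deg i (w, c) i0; apply: supp_inW => -[w' c'] /= [_ E]; lia.
Qed.

Lemma Z_of_components (p r : nat) (xs : int -> X) :
  (forall i : int, p%:Z - r%:Z <= i < p%:Z -> E0 i (xs i)) -> E0 p (xs p) ->
  let z := \sum_(0 <= j < r.+1) xs (p%:Z - j%:Z) in
  Fil p z /\ forall s : int, p%:Z - r%:Z <= s <= p%:Z -> word_part s z = xs s.
Proof.
move=> Hxs Hx z.
have H j : (j < r.+1)%N -> E0 (p%:Z - j%:Z) (xs (p%:Z - j%:Z)).
  by case: j => [|j] lt; [rewrite subr0 | apply: Hxs; lia].
split=> [|s /andP[les lep]].
  rewrite /z big_nat_cond; apply: supp_in_sum => j /andP[/andP[_ /H E] _].
  by apply: FilW (E0_Fil E); lia.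
have [j Ej] : exists j : nat, s = p%:Z - j%:Z by exists `|p%:Z - s|%N; lia.
rewrite /z linear_sum /= (bigD1_seq j) ?iota_uniq //=; last by rewrite mem_index_iota; lia.
rewrite -Ej (word_part_E0 s (p := s)) ?eqxx; last by rewrite Ej; apply: H; lia.
rewrite big1_seq ?addr0 // => i /andP[/eqP ne]; rewrite mem_index_iota => /andP[_ lt].
by rewrite (word_part_E0 s (H i lt)); case: eqP => // E; case: ne; lia.
Qed.

(** By [word_part_D] the equation for [n] says that [D z] has no component of length [p - n + 1];
    for [n] from 1 to [r] together they say [Fil (p - r)]. The [xs i] are the components of [z], and
    for negative [i] the predicate [E0 i] forces [xs i = 0]. *)
Lemma survivesP (p r : nat) x : E0 p x ->
  survives degB m mG kap r p x <->
  exists xs : int -> X,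
    [/\ forall i : int, p%:Z - r%:Z <= i < p%:Z -> E0 i (xs i), xs p = x &
        forall n : nat, (1 <= n <= r)%N ->
          \sum_(1 <= i < n.+1) t i (xs (p%:Z - n%:Z + i%:Z)) = 0].
Proof.
move=> Hx; split=> [[z [_ [Fz FDz] Fzx]]|[xs [Hxs xsp Hn]]].
  exists (fun s => word_part s z); split=> [i _||n /andP[n1 nr]].
  - exact: E0_word_part.
  - apply/eqP; rewrite -subr_eq0 -[X in _ - X](part_id (P := fun u => (size u.1)%:Z == p%:Z)).
      by rewrite -linearB; apply/eqP; apply: (word_part_Fil Fzx); lia.
    by move=> u /Hx /eqP.
  by rewrite -word_part_D //; apply: (word_part_Fil FDz); lia.
have Hx' : E0 p (xs p) by rewrite xsp.
have [Fz cz] := Z_of_components Hxs Hx'; set z := (\sum_(_ <= _ < _) _) in Fz cz.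
exists z; split=> //; last first.
  rewrite -xsp -(cz p); last by lia.
  exact: Fil_sub_word_part.
split=> //; apply: Fil_word_part => s lt.
case: (boolP (s <= p)) => [le|gt]; last by apply: (word_part_Fil (D_Fil Fz)); lia.
have [n En] : exists n : nat, s = p%:Z - n%:Z + 1 by exists (absz (p%:Z + 1 - s)%R); lia.
rewrite En word_part_D // -[RHS](Hn n); last by lia.
by apply: eq_big_nat => i ilt; rewrite cz //; lia.
Qed.

Hypothesis D_sq : forall x, D (D x) = 0.

(** The proposed value is the component of length [p - r] of [D z], for the [z] assembled from the
    [xs i], so [D z] itself represents it. *)
Lemma differential_mapsP (p r : nat) x (xs : int -> X) :
  E0 p x -> (forall i : int, p%:Z - r%:Z <= i < p%:Z -> E0 i (xs i)) -> xs p = x ->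
  (forall n : nat, (1 <= n <= r)%N ->
     \sum_(1 <= i < n.+1) t i (xs (p%:Z - n%:Z + i%:Z)) = 0) ->
  differential_maps degB m mG kap r p x
    (\sum_(1 <= i < r.+2) t i (xs (p%:Z - r%:Z - 1 + i%:Z))).
Proof.
move=> Hx Hxs xsp Hn.
have Hx' : E0 p (xs p) by rewrite xsp.
have [Fz cz] := Z_of_components Hxs Hx'; set z := (\sum_(_ <= _ < _) _) in Fz cz.
have FDz : Fil (p%:Z - r%:Z) (D z).
  apply: Fil_word_part => s lt.
  case: (boolP (s <= p)) => [le|gt]; last by apply: (word_part_Fil (D_Fil Fz)); lia.
  have [n En] : exists n : nat, s = p%:Z - n%:Z + 1 by exists (absz (p%:Z + 1 - s)%R); lia.
  rewrite En word_part_D // -[RHS](Hn n); last by lia.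
  by apply: eq_big_nat => i ilt; rewrite cz //; lia.
have Fzx : Fil (p%:Z - 1) (z - x).
  by rewrite -xsp -(cz p); [exact: Fil_sub_word_part | lia].
have yE : \sum_(1 <= i < r.+2) t i (xs (p%:Z - r%:Z - 1 + i%:Z)) = word_part (p%:Z - r%:Z) (D z).
  rewrite [in RHS](_ : p%:Z - r%:Z = p%:Z - r.+1%:Z + 1); last by lia.
  rewrite (word_part_D _ Fz); apply: eq_big_nat => i ilt.
  by rewrite cz; [congr (t i (xs _)); lia | lia].
rewrite yE; split.
- by apply/survivesP => //; exists xs.
- exists (D z); split; first exact: E0_word_part.
    by split; [exact: FDz | rewrite D_sq; apply: Fil0].
  exact: Fil_sub_word_part.
move=> z' w' [_ [Fz' FDz'] Fz'x] [_ [Fw FDw] Fwy].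
(* Independence of the representatives: [D z] and [w'] have the same leading component, so their
   difference drops one step of the filtration, and so does [z' - z], whose image under [D] is
   therefore in [B_ (r - 1)]. *)
exists (D z - w'), (D (z' - z)); split.
- split.
    rewrite (_ : D z - w' = (D z - word_part (p%:Z - r%:Z) (D z)) - (w' - word_part (p%:Z - r%:Z) (D z))).
      by apply: FilB => //; exact: Fil_sub_word_part.
    by rewrite opprB addrA subrK.
  rewrite linearB /= D_sq sub0r; apply: supp_inN.
  by apply: FilW FDw; lia.
- exists (z' - z); last exact: erefl.
  split.
    rewrite (_ : z' - z = (z' - x) - (z - x)); last by rewrite opprB addrA subrK.
    by apply: FilB; [apply: FilW Fz'x | apply: FilW Fzx]; lia.
  rewrite linearB /=; apply: FilB; [apply: FilW FDz' | apply: FilW FDz]; lia.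
by rewrite linearB /= [RHS]addrC addrA subrK.
Qed.

End FilteredBar.

(** * Convergence to Tor over R *)

Section Convergence.
Context {Q R : comNzRingType} {k : fieldType} { pi : {rmorphism Q -> R}}.
Context {kap : {rmorphism Q -> k}} {rho : {rmorphism R -> k}} {M : lmodType R}.
Context {B C : choiceType} {degB : B -> nat} {degC : C -> nat}.
Context {dA : {linear {malg Q[option B]} -> {malg Q[option B]}}}.
Context {epsA : {malg Q[option B]} -> R^o}.
Context {dG : {linear {malg Q[C]} -> {malg Q[C]}}} {epsG : {malg Q[C]} -> M}.
Context {m : seq B -> {malg Q[B]}} {mG : seq B -> C -> {malg Q[C]}}.
Hypothesis pi_surj : surjective pi.
Hypothesis rho_pi : forall q, rho (pi q) = kap q.
Hypothesis degB_gt0 : forall b, (0 < degB b)%N.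
Hypothesis resA : free_resolution pi (odeg degB) dA epsA.
Hypothesis epsA1 : epsA << None >> = 1.
Hypothesis resG : free_resolution pi degC dG epsG.
Hypothesis ainfA : ainf_algebra degB dA m.
Hypothesis ainfG : ainf_module degB degC dA dG m mG.

Local Notation W := (seq B * C)%type.
Local Notation X := {malg k[W]}.
Local Notation D := (dX degB m mG kap).
Local Notation bar_deg := (bar_deg degB degC).
Local Notation bar_diffR := (bar_diffR pi (degB := degB) (m := m) (mG := mG)).

Let resB := bar_resolution pi_surj degB_gt0 resA epsA1 resG ainfA ainfG.

Lemma dX_base_change x : D x = bc_map rho bar_diffR x.
Proof.
apply: eq_lin => u; rewrite /bar_diffR bc_map1 lin1 (base_change_comp _ rho_pi).
exact: erefl.
Qed.

Lemma dX_sq x : D (D x) = 0.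
Proof.
rewrite !dX_base_change -bc_map_comp; apply: lin_eq0 => u _.
by rewrite /= (res_diff_sq resB) raddf0.
Qed.

Lemma dX_deg u : supp_in (fun v => (bar_deg v).+1 = bar_deg u) (D << u >>).
Proof.
rewrite /dX lin1; apply: supp_in_base_change; exact: (bar_diff_deg ainfA ainfG).
Qed.

Lemma dX_part n x :
  part (fun u => bar_deg u == n) (D x) = D (part (fun u => bar_deg u == n.+1) x).
Proof. by apply: (part_linear (F := D)) => u v /dX_deg <-; rewrite eqSS. Qed.

(** Every letter has suspended degree at least 1. Hence the filtration is finite in each total
    degree, on which convergence rests. *)
Lemma size_le_bar_deg u : (size u.1 <= bar_deg u)%N.
Proof.
case: u => w c; rewrite /Defs.bar_deg /=; elim: w => [//|b w IH].
by rewrite sdeg_cons /=; lia.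
Qed.

Context {V : choiceType} {hdeg : V -> nat} {dP : {linear {malg R[V]} -> {malg R[V]}}}.
Context {epsP : {malg R[V]} -> M}.
Hypothesis resP : free_resolution idfun hdeg dP epsP.
Local Notation d' := (bc_map rho dP).

(** The maps [F] and [G] compare X with the complex of the given resolution, inverse to each other
    up to homotopy. The filtration of the homology is the image under [F] of the filtration by word
    length, and on late pages the numerators consist of cycles, so [F] induces the isomorphisms. *)
Theorem bar_converges n :
  converges_in_degree degB degC m mG kap n
    (tor_cycles rho hdeg dP n) (tor_boundaries rho hdeg dP n).
Proof.
have [f [fdeg fd fe]] := chain_map_exists resP resB.
have [g [gdeg gd ge]] := chain_map_exists resB resP.
have [|||s [_ Hs]] := homotopy_id resB (F := lin g \o lin f).
- move=> u; rewrite /= lin1; apply: supp_in_lin => v /fdeg <-; exact: gdeg.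
- by move=> u; rewrite /= gd fd.
- by move=> u; rewrite /= ge fe.
have [|||s' [_ Hs']] := homotopy_id resP (F := lin f \o lin g).
- move=> u; rewrite /= lin1; apply: supp_in_lin => v /gdeg <-; exact: fdeg.
- by move=> u; rewrite /= fd gd.
- by move=> u; rewrite /= fe ge.
pose F := bc_map rho (lin f); pose G := bc_map rho (lin g).
have FD x : d' (F x) = F (D x).
  by rewrite dX_base_change /F -!bc_map_comp; apply: eq_bc_map => y /=; exact: fd.
have GD y : D (G y) = G (d' y).
  by rewrite dX_base_change /G -!bc_map_comp; apply: eq_bc_map => z /=; exact: gd.
have Fdeg j x : homog bar_deg j x -> homog hdeg j (F x).
  by move=> Hx; apply: supp_in_bc_map => u /Hx <-; rewrite lin1; exact: fdeg.
have Gdeg j y : homog hdeg j y -> homog bar_deg j (G y).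
  by move=> Hx; apply: supp_in_bc_map => u /Hx <-; rewrite lin1; exact: gdeg.
pose sk := bc_map rho (lin s).
have GF x : G (F x) = x + D (sk x) + sk (D x).
  by rewrite !dX_base_change; apply: bc_map_homotopy_id.
have FG y : F (G y) = y + d' (bc_map rho (lin s') y) + bc_map rho (lin s') (d' y).
  exact: bc_map_homotopy_id.
have d'sq y : d' (d' y) = 0.
  by rewrite -bc_map_comp; apply: lin_eq0 => v _; rewrite /= (res_diff_sq resP) raddf0.
have d'homog j y : homog hdeg j.+1 y -> homog hdeg j (d' y).
  move=> Hy; apply: supp_in_bc_map => v /Hy E v' /(res_diff_deg resP).
  by rewrite E => -[].
pose Bn := tor_boundaries rho hdeg dP n.
have Bn0 : Bn 0 by split; [exact: supp_in0 | exists 0; rewrite linear0].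
have BnP c x y : Bn x -> Bn y -> Bn (c *: x + y).
  move=> [Hx [x' Ex]] [Hy [y' Ey]]; split; first by apply: supp_inD => //; exact: supp_inZ.
  by exists (c *: x' + y'); rewrite linearP Ex Ey.
have F0 : F 0 = 0 by exact: linear0.
have D0 : D 0 = 0 by exact: linear0.
have DL c x y : D (c *: x + y) = c *: D x + D y by exact: linearP.
have DB x y : D (x - y) = D x - D y by exact: linearB.
have DD x y : D (x + y) = D x + D y by exact: linearD.
have GB x y : G (x - y) = G x - G y by exact: linearB.
have sk0 : sk 0 = 0 by exact: linear0.
have G0 : G 0 = 0 by exact: linear0.
have d'D x y : d' (x + y) = d' x + d' y by exact: linearD.
have FL c x y : F (c *: x + y) = c *: F x + F y by exact: linearP.
have FB x y : F (x - y) = F x - F y by exact: linearB.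
(* Classes with a representative in [Fil p]. Working modulo [Bn] makes [Phi p] equal to the
   boundaries for negative [p]. *)
pose Phi (p : int) y := exists x, [/\ Fil p x, homog bar_deg n x, D x = 0 & Bn (y - F x)].
exists Phi; split.
- move=> p; split.
    by exists 0; split; [exact: supp_in0 | exact: supp_in0 | exact: D0 | rewrite F0 subr0].
  move=> c y1 y2 [x1 [F1 H1 D1 B1]] [x2 [F2 H2 D2 B2]].
  exists (c *: x1 + x2); split.
  + by apply: FilD => //; exact: supp_inZ.
  + by apply: supp_inD => //; exact: supp_inZ.
  + by rewrite DL D1 D2 scaler0 addr0.
  have -> : c *: y1 + y2 - F (c *: x1 + x2) = c *: (y1 - F x1) + (y2 - F x2).
    by rewrite FL scalerBr opprD addrACA.
  exact: BnP.
- by move=> p y [x [Fx Hx Dx Bx]]; exists x; split => //; apply: FilW Fx; lia.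
- move=> p y p0; split.
    by move=> [x [/(Fil_lt0 p0) -> _ _]]; rewrite F0 subr0.
  by move=> By; exists 0; split; [exact: supp_in0 | exact: supp_in0 | exact: D0 | rewrite F0 subr0].
- exists n%:Z => p y np; split.
    move=> [x [_ Hx Dx [Hb [b Eb]]]]; split.
      by rewrite -(subrK (F x) y); apply: supp_inD => //; exact: Fdeg.
    by rewrite -(subrK (F x) y) d'D FD Dx F0 addr0 /= Eb d'sq.
  move=> [Hy dy]; exists (G y); split.
  + move=> u /(Gdeg _ _ Hy); have := size_le_bar_deg u; case: (u) => w c /=; lia.
  + exact: Gdeg.
  + by rewrite GD dy G0.
  split; first by apply: supp_inB => //; exact/Fdeg/Gdeg.
  exists (- bc_map rho (lin s') y).
  by rewrite FG dy [bc_map _ _ 0]linear0 addr0 linearN opprD addrA subrr sub0r.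
(* For such [r] one has [p - r < 0], so membership of [D z] in [Fil (p - r)] means [D z = 0]; and
   [p + r - 1] is at least [n + 1], so [Fil (p + r - 1)] contains all elements of degree [n + 1]. *)
move=> p; exists (absz p + n + 2)%N => r ler.
have cyc z (q : int) : q < 0 -> Fil q (D z) -> D z = 0 by move=> ? /Fil_lt0 ->.
have small (z : X) j (q : int) : homog bar_deg j z -> (j%:Z <= q)%R -> Fil q z.
  by move=> Hz jq u /Hz; have := size_le_bar_deg u; case: (u) => w c /=; lia.
split.
- move=> z [[Fz FDz] Hz]; have -> : D z = 0 by apply: cyc FDz; lia.
  exists 0, 0; split; last by rewrite addr0.
    by split; rewrite ?D0; exact: supp_in0.
  exists 0; last by rewrite linear0.
  by split; rewrite ?D0; exact: supp_in0.
- move=> z [[Fz FDz] Hz]; exists 0, (D z); split; last by rewrite add0r.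
    by split; rewrite ?D0; exact: supp_in0.
  exists z; last exact: erefl.
  split; first by apply: small Hz _; lia.
  by apply: FilW FDz; lia.
exists F; split.
- move=> x [[Fx FDx] Hx]; have Dx : D x = 0 by apply: cyc FDx; lia.
  by exists x; split; [exact: Fx | exact: Hx | exact: Dx | rewrite subrr].
- move=> x [[Fx FDx] Hx]; have Dx : D x = 0 by apply: cyc FDx; lia.
  split=> [[a [Fa Ha Da [_ [y Ey]]]]|[[a [b [[Fa FDa] [w _ Eb] Ex]]] _]].
    split; last exact: Hx.
    (* [F (x - a)] is the boundary of [y]. Applying [G] and the homotopy from [G (F (x - a))] to
       [x - a] gives [G y - sk (x - a)] as a preimage, whose degree [n.+1] part is kept. *)
    have [w [Hw Ew]] : exists w, homog bar_deg n.+1 w /\ D w = x - a.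
      exists (part (fun u => bar_deg u == n.+1) (G y - sk (x - a))); split.
        by move=> u /supp_in_part /eqP.
      rewrite -dX_part DB GD -Ey -FB GF DB Dx Da subrr sk0 addr0.
      rewrite addrK; apply: part_id => u Hu; apply/eqP; exact: (supp_inB Hx Ha) Hu.
    exists a, (x - a); split; last by rewrite addrC subrK.
      split; first exact: Fa.
      by rewrite Da; exact: supp_in0.
    exists w; last exact: esym Ew.
    split; first by apply: small Hw _; lia.
    rewrite Ew; apply: FilB; first by apply: FilW Fx; lia.
    by apply: FilW Fa; lia.
  have Da : D a = 0 by apply: cyc FDa; lia.
  (* The two summands of an element of [E_den] need not be homogeneous when their sum is, so each is
     projected to the relevant degree. *)
  pose Pn u := bar_deg u == n.
  have Hpart (z : X) : homog bar_deg n (part Pn z) by move=> u /supp_in_part /eqP.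
  have xE : x = part Pn a + D (part (fun u => bar_deg u == n.+1) w).
    rewrite -dX_part -Eb -linearD -Ex /=; apply/esym/part_id => u /Hx E; exact/eqP.
  exists (part Pn a); split.
  + exact: supp_in_part_sub.
  + exact: Hpart.
  + case: (n) @Pn Hpart xE => [|j] Pn Hpart xE; last by rewrite -dX_part Da linear0.
    apply: (@supp_in_empty _ _ (fun=> False)) => [_ []|].
    apply: (supp_in_linear (F := D)) => u /Hpart E v /dX_deg; by rewrite E.
  have H1 := Fdeg n x Hx; have H2 := Fdeg n _ (Hpart a).
  split; first exact: (supp_inB H1 H2).
  exists (F (part (fun u => bar_deg u == n.+1) w)).
  by rewrite FD -FB {1}xE addrC addKr.
move=> y [x [Fx Hx Dx Bx]]; exists x; first by split; [split; [exact: Fx | rewrite Dx; exact: supp_in0] | exact: Hx].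
by exists 0; split; [exact: supp_in0 | exact: supp_in0 | exact: D0 | rewrite F0 subr0].
Qed.

End Convergence.

(** * Products on Tor over Q and their lifts by m_2 *)

Lemma base_change_lin (S S' : nzRingType) (phi : {rmorphism S -> S'}) (U V : choiceType)
    (f : U -> {malg S[V]}) (x : {malg S[U]}) :
  base_change phi (lin f x) = lin (fun u => base_change phi (f u)) (base_change phi x).
Proof.
by rewrite -bc_map_base_change; apply: eq_lin => u; rewrite /= lin1.
Qed.

Section Tensor.
Context {S : comNzRingType} {U V : choiceType}.

Lemma tensE (x : {malg S[U]}) (y : {malg S[V]}) :
  tens x y = lin (fun u => lin (fun v => << (u, v) >>) y) x.
Proof.
apply: eq_bigr => u _; rewrite scaler_sumr; apply: eq_bigr => v _.
by rewrite scalerA malgUZ.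
Qed.

Lemma tens1l (u : U) (y : {malg S[V]}) : tens << u >> y = lin (fun v => << (u, v) >>) y.
Proof. by rewrite tensE lin1. Qed.

Lemma tens1r (x : {malg S[U]}) (v : V) : tens x << v >> = lin (fun u => << (u, v) >>) x.
Proof. by rewrite tensE; apply: eq_lin => u; rewrite lin1. Qed.

Lemma lin_tens (N : lmodType S) (F : U * V -> N) (x : {malg S[U]}) (y : {malg S[V]}) :
  lin F (tens x y) = lin (fun u => lin (fun v => F (u, v)) y) x.
Proof.
rewrite tensE lin_lin; apply: eq_lin => u; rewrite lin_lin.
by apply: eq_lin => v; rewrite lin1.
Qed.

Lemma tens0r (x : {malg S[U]}) : tens x (0 : {malg S[V]}) = 0.
Proof. by rewrite tensE; apply: lin_eq0 => u _; rewrite lin0. Qed.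

Lemma tens0l (y : {malg S[V]}) : tens (0 : {malg S[U]}) y = 0.
Proof. by rewrite tensE lin0. Qed.

End Tensor.

Section LiftsUnique.
Context {Q R : comNzRingType} {k : fieldType} {phi : {rmorphism Q -> R}}.
Context {kap : {rmorphism Q -> k}} {N : lmodType R} {U V : choiceType}.
Context {degU : U -> nat} {degV : V -> nat}.
Context {dU : {linear {malg Q[U]} -> {malg Q[U]}}} {dV : {linear {malg Q[V]} -> {malg Q[V]}}}.
Context {epsU : {malg Q[U]} -> R^o} {epsV : {malg Q[V]} -> N}.
Hypothesis resU : free_resolution phi degU dU epsU.
Hypothesis resV : free_resolution phi degV dV epsV.
Hypothesis minU : minimal_differential kap dU.
Hypothesis minV : minimal_differential kap dV.

Definition tens_diff : {malg Q[(U * V)%type]} -> {malg Q[(U * V)%type]} :=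
  lin (fun p => tens (dU << p.1 >>) << p.2 >> + (-1) ^+ degU p.1 *: tens << p.1 >> (dV << p.2 >>)).
HB.instance Definition _ := GRing.Linear.on tens_diff.

Lemma tens_diff1 u v : tens_diff << (u, v) >>
  = tens (dU << u >>) << v >> + (-1) ^+ degU u *: tens << u >> (dV << v >>).
Proof. exact: lin1. Qed.

Lemma tens_diff_deg p q : q \in msupp (tens_diff << p >>) ->
  (degU q.1 + degV q.2).+1 = (degU p.1 + degV p.2)%N.
Proof.
case: p => u v; rewrite tens_diff1; move: q; apply: supp_inD.
  rewrite tens1r; apply: supp_in_lin => u' /(res_diff_deg resU) <-; exact: supp_inU.
apply: supp_inZ; rewrite tens1l; apply: supp_in_lin => v' /(res_diff_deg resV) <-.
by apply: supp_inU; rewrite addnS.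
Qed.

Lemma tens_diff_sq p : tens_diff (tens_diff << p >>) = 0.
Proof.
case: p => u v; rewrite tens_diff1 linearD linearZ /= tens1l tens1r.
have -> : tens_diff (lin (fun u' => << (u', v) >>) (dU << u >>))
    = - (-1) ^+ degU u *: tens (dU << u >>) (dV << v >>).
  rewrite linear_lin -[RHS]add0r.
  have z : tens (dU (dU << u >>)) << v >> = 0 :> {malg Q[(U * V)%type]}.
    by rewrite (res_diff_sq resU) tens0l.
  rewrite -{1}z tens1r [dU (dU _)]linear_linE lin_lin tensE -lin_scalef -lin_addf.
  apply: eq_lin_supp => u' Hu'; rewrite /= tens_diff1 tens1r tens1l.
  by rewrite -(res_diff_deg resU Hu') exprS mulN1r opprK.
have -> : tens_diff (lin (fun v' => << (u, v') >>) (dV << v >>)) = tens (dU << u >>) (dV << v >>).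
  rewrite linear_lin -[RHS]addr0.
  have z : (-1) ^+ degU u *: tens << u >> (dV (dV << v >>)) = 0 :> {malg Q[(U * V)%type]}.
    by rewrite (res_diff_sq resV) tens0r scaler0.
  rewrite -{1}z tens1l [dV (dV _)]linear_linE lin_lin tensE lin_swap -lin_scalef -lin_addf.
  by apply: eq_lin => v'; rewrite /= tens_diff1 tens1r tens1l.
by rewrite scaleNr addNr.
Qed.

Lemma minimal_bc_map (Z : choiceType) (d : {malg Q[Z]} -> {malg Q[Z]}) x :
  minimal_differential kap d -> bc_map kap d x = 0.
Proof.
move=> mind; apply: lin_eq0 => z _; apply/malgP => w.
by rewrite mcoeff_base_change mind mcoeff0.
Qed.

(** Two lifts differ by a homotopy, since the source is free and the target exact. By minimality the
    differentials of both complexes vanish over [k], hence so do both terms of the homotopy formula,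
    and the lifts become equal. *)
Lemma lifts_action_unique mu mu' :
  lifts_action degU degV dU dV epsU epsV mu ->
  lifts_action degU degV dU dV epsU epsV mu' ->
  bc_map kap mu =1 bc_map kap mu'.
Proof.
move=> L L'; have sV := res_aug_semilinear resV.
have chain nu : lifts_action degU degV dU dV epsU epsV nu ->
    forall p, dV (nu << p >>) = nu (tens_diff << p >>).
  by move=> Ln [u v]; rewrite (lift_chain Ln) tens_diff1 linearD linearZ.
have [|||||s [_ E]] := @homotopy_exists _ _ _ _ _ _ _ _ resV _
  (fun p => degU p.1 + degV p.2)%N tens_diff (mu \- mu').
- exact: tens_diff_deg.
- exact: tens_diff_sq.
- by move=> [u v]; apply: supp_inB; [apply: (lift_deg L) | apply: (lift_deg L')].
- by move=> p; rewrite /= linearB (chain _ L) (chain _ L').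
- move=> [u v] _; rewrite /= (semilinearD _ _ sV) (semilinearN _ sV).
  by rewrite (lift_aug L) (lift_aug L') subrr.
have Dmin x : bc_map kap tens_diff x = 0.
  have vanU u : base_change kap (dU << u >>) = 0.
    by rewrite -bc_map1 minimal_bc_map.
  have vanV v : base_change kap (dV << v >>) = 0.
    by rewrite -bc_map1 minimal_bc_map.
  apply: lin_eq0 => -[u v] _; rewrite tens_diff1 raddfD /= base_changeZ.
  by rewrite tens1l tens1r !base_change_lin vanU vanV !lin0 scaler0 addr0.
move=> x; have := bc_map_homotopy kap E x.
have z0 : bc_map kap (lin s) 0 = 0 by exact: linear0.
rewrite Dmin z0 (minimal_bc_map _ minV) addr0 => Z.
apply/eqP; rewrite -subr_eq0; apply/eqP; rewrite -[RHS]Z.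
by rewrite -lin_oppf -lin_addf; apply: eq_lin => p; rewrite raddfB.
Qed.

End LiftsUnique.

Lemma linear_combination4 (S : comNzRingType) (N N' : lmodType S) (f : {linear N -> N'})
    (p q e : S) (x y z t : N) :
  f (p *: x - q *: y - z + e *: t) = p *: f x - q *: f y - f z + e *: f t.
Proof. by rewrite linearD !linearB !linearZ. Qed.

(** Sign bookkeeping for the Leibniz rule below: [e] is the sign of a letter [b], and [p] and [q]
    are the values of d_1 on the two letters. *)
Lemma signed_rearrange (S : comNzRingType) (N : lmodType S) (e p q : S) (x y z t : N) :
  p = - e * p -> e * e = 1 ->
  e *: - (p *: x - q *: y - z + e *: t) = p *: x + e *: z + e *: (q *: y - e *: t).
Proof.
move=> pe ee; rewrite scalerN scalerDr !scalerBr !scalerA ee !opprD !opprK -!scaleNr -mulNr -pe.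
by rewrite !addrA; congr (_ + _); rewrite addrAC.
Qed.

Section AInfinityLifts.
Context {Q R : comNzRingType} {phi : {rmorphism Q -> R}} {M : lmodType R}.
Context {B C : choiceType} {degB : B -> nat} {degC : C -> nat}.
Context {dA : {linear {malg Q[option B]} -> {malg Q[option B]}}}.
Context {epsA : {malg Q[option B]} -> R^o}.
Context {dG : {linear {malg Q[C]} -> {malg Q[C]}}} {epsG : {malg Q[C]} -> M}.
Context {m : seq B -> {malg Q[B]}} {mG : seq B -> C -> {malg Q[C]}}.
Hypothesis degB_gt0 : forall b, (0 < degB b)%N.
Hypothesis resA : free_resolution phi (odeg degB) dA epsA.
Hypothesis epsA1 : epsA << None >> = 1.
Hypothesis resG : free_resolution phi degC dG epsG.
Hypothesis ainfA : ainf_algebra degB dA m.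
Hypothesis ainfG : ainf_module degB degC dA dG m mG.

(* The sign comes from the suspensions: [m_2] is a product on [A_+[1]]. *)
Definition ainf_mul : {malg Q[(option B * option B)%type]} -> {malg Q[option B]} :=
  lin (fun p => match p with
    | (Some b, Some b') => (-1) ^+ degB b *: letters (m [:: b; b'])
    | (None, v) => << v >>
    | (u, None) => << u >>
    end).
HB.instance Definition _ := GRing.Linear.on ainf_mul.

Definition ainf_act : {malg Q[(option B * C)%type]} -> {malg Q[C]} :=
  lin (fun p => if p.1 is Some b then mG [:: b] p.2 else << p.2 >>).
HB.instance Definition _ := GRing.Linear.on ainf_act.

Lemma epsA_letters x : epsA (letters x) = 0.
Proof.
apply: (semilinear_eq0 (res_aug_semilinear resA)) => -[b|].
  by move=> _; apply: (res_aug_deg resA); exact: degB_gt0.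
by rewrite -mcoeff_neq0 mcoeff_letters eqxx.
Qed.

Lemma ainf_mul1 p : ainf_mul << p >> = match p with
    | (Some b, Some b') => (-1) ^+ degB b *: letters (m [:: b; b'])
    | (None, v) => << v >>
    | (u, None) => << u >>
    end.
Proof. exact: lin1. Qed.

Lemma ainf_mul_tens x y : ainf_mul (tens x y) = lin (fun u => lin (fun v => ainf_mul << (u, v) >>) y) x.
Proof.
rewrite [LHS]lin_tens; apply: eq_lin => u; apply: eq_lin => v; exact/esym/ainf_mul1.
Qed.

Lemma ainf_mul_None_l y : ainf_mul (tens << None >> y) = y.
Proof.
by rewrite ainf_mul_tens lin1 -[RHS]lin_id; apply: eq_lin => v; rewrite ainf_mul1.
Qed.

Lemma ainf_mul_None_r x : ainf_mul (tens x << None >>) = x.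
Proof.
rewrite ainf_mul_tens -[RHS]lin_id; apply: eq_lin => u.
by rewrite lin1 ainf_mul1; case: u.
Qed.

Lemma letters_lin (V : choiceType) (f : V -> {malg Q[B]}) x :
  letters (lin f x) = lin (fun v => letters (f v)) x.
Proof. exact: lin_lin. Qed.

Lemma stasheff2E b b' : stasheff degB m [:: b; b']
  = lin (fun b2 => m [:: b2; b']) (m [:: b]) + lin (fun b2 => m [:: b2]) (m [:: b; b'])
    - (-1) ^+ degB b *: lin (fun b2 => m [:: b; b2]) (m [:: b']).
Proof.
rewrite stasheffE !word_diff_cons word_diff_nil lin0 scaler0 !addr0 /= !addr0.
rewrite !linD linZ !lin_lin exprS mulN1r scaleNr.
by do ![apply: eq_addf | apply: (congr1 -%R) | apply: eq_scale];
  apply: eq_lin => b2; rewrite !lin1.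
Qed.

(** The Stasheff identity of length 2, rewritten through m_1 = - d_A and the sign in [ainf_mul]. Its
    curvature terms are the products with the A_0 components of the boundaries. *)
Lemma ainf_mul_chain b b' :
  dA (ainf_mul << (Some b, Some b') >>)
  = ainf_mul (tens (dA << Some b >>) << Some b' >>)
    + (-1) ^+ degB b *: ainf_mul (tens << Some b >> (dA << Some b' >>)).
Proof.
(* [d1] is nonzero only on letters of degree 1, where the sign factor is 1. *)
have d1b : d1 dA b = - (-1) ^+ degB b * d1 dA b.
  case: (eqVneq (degB b) 1%N) => [->|/eqP ne]; last by rewrite (d1_eq0 resA ne) mulr0.
  by rewrite expr1 opprK mul1r.
set Lb := lin (fun b2 => m [:: b2; b']) (m [:: b]).
set Lb' := lin (fun b2 => m [:: b; b2]) (m [:: b']).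
have E1 : ainf_mul (tens (dA << Some b >>) << Some b' >>)
    = d1 dA b *: << Some b' >> + (-1) ^+ degB b *: letters Lb.
  rewrite ainf_mul_tens (dA_Some ainfA) linD linN linZ [lin _ << None >>]lin1 lin1 ainf_mul1.
  apply: eq_addf; first exact: erefl.
  rewrite [lin _ (letters _)]lin_lin letters_lin -lin_scalef -lin_oppf.
  apply: eq_lin_supp => b2 Hb2; rewrite lin1 lin1 ainf_mul1 -scaleNr.
  have := ainf_deg ainfA (isT : [:: b] != [::]) Hb2; rewrite sdeg_cons sdeg_nil addn0 => -[<-].
  by rewrite exprS mulN1r.
have E2 : ainf_mul (tens << Some b >> (dA << Some b' >>))
    = d1 dA b' *: << Some b >> - (-1) ^+ degB b *: letters Lb'.
  rewrite ainf_mul_tens lin1 (dA_Some ainfA) linD linN linZ lin1 ainf_mul1.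
  apply: eq_addf; first exact: erefl.
  rewrite [lin _ (letters _)]lin_lin letters_lin -lin_scalef; congr (- _).
  by apply: eq_lin => b2; rewrite lin1 ainf_mul1.
have st : lin (fun b2 => m [:: b2]) (m [:: b; b'])
    = d1 dA b *: << b' >> - d1 dA b' *: << b >> - Lb + (-1) ^+ degB b *: Lb'.
  by rewrite -(ainf_m2 ainfA) stasheff2E addrAC subrK [_ + lin _ _]addrC addrK.
(* The letters of m_2 on two letters have degree at least 2, so their boundaries have no A_0
   component. *)
have d10 : lin (fun b2 => << d1 dA b2 *g None >>) (m [:: b; b']) = 0 :> {malg Q[option B]}.
  apply: lin_eq0 => b2 Hb2.
  have -> : d1 dA b2 = 0.
    apply: (d1_eq0 resA); have := ainf_deg ainfA (isT : [:: b; b'] != [::]) Hb2.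
    rewrite !sdeg_cons sdeg_nil; have := degB_gt0 b; have := degB_gt0 b'; lia.
  exact: monalgU0.
rewrite E1 E2 ainf_mul1 linearZ /= (dA_letters ainfA) d10 sub0r st.
have ee : (-1) ^+ degB b * (-1) ^+ degB b = 1 :> Q by rewrite -exprMn mulrNN mulr1 expr1n.
have -> : letters (d1 dA b *: << b' >> - d1 dA b' *: << b >> - Lb + (-1) ^+ degB b *: Lb')
    = d1 dA b *: << Some b' >> - d1 dA b' *: << Some b >> - letters Lb + (-1) ^+ degB b *: letters Lb'.
  have /= := linear_combination4 (lin (fun b => << Some b >> : {malg Q[option B]}))
    (d1 dA b) (d1 dA b') ((-1) ^+ degB b) << b' >> << b >> Lb Lb'.
  by rewrite (lin1 _ b) (lin1 _ b').
by apply: signed_rearrange; [exact: d1b | exact: ee].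
Qed.

Lemma ainf_mul_lifts : lifts_action (odeg degB) (odeg degB) dA dA epsA epsA ainf_mul.
Proof.
split.
- move=> [b|] [b'|]; rewrite /= ainf_mul1; try exact: supp_inU.
    apply: supp_inZ; apply: supp_in_lin => b2 Hb; apply: supp_inU => /=.
    have := ainf_deg ainfA (isT : [:: b; b'] != [::]) Hb.
    rewrite !sdeg_cons sdeg_nil; lia.
  by apply: supp_inU; rewrite /= addn0.
- move=> [b|] v; last first.
    rewrite /= (dA_None resA) tens0l linear0 add0r expr0 scale1r ainf_mul_None_l.
    by rewrite ainf_mul1; case: v.
  case: v => [b'|]; first exact: ainf_mul_chain.
  by rewrite /= (dA_None resA) tens0r linear0 scaler0 addr0 ainf_mul_None_r ainf_mul1.
move=> u v; rewrite /= ainf_mul1.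
have sA := res_aug_semilinear resA.
case: u => [b|]; last by rewrite epsA1 scale1r; case: v.
have eb : epsA << Some b >> = 0 by apply: (res_aug_deg resA); exact: degB_gt0.
rewrite eb scale0r; case: v => [b'|]; last exact: eb.
by rewrite (semilinearZ _ _ sA) epsA_letters scaler0.
Qed.

Lemma ainf_act1 u c : ainf_act << (u, c) >> = if u is Some b then mG [:: b] c else << c >>.
Proof. exact: lin1. Qed.

Lemma ainf_act_tens x y :
  ainf_act (tens x y) = lin (fun u => lin (fun c => ainf_act << (u, c) >>) y) x.
Proof.
rewrite [LHS]lin_tens; apply: eq_lin => u; apply: eq_lin => c; exact/esym/ainf_act1.
Qed.

Lemma ainf_act_None y : ainf_act (tens << None >> y) = y.
Proof.
by rewrite ainf_act_tens lin1 -[RHS]lin_id; apply: eq_lin => c; rewrite ainf_act1.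
Qed.

Lemma stasheffG2E b c : stasheffG degB m mG ([:: b], c)
  = lin (fun b2 => mG [:: b2] c) (m [:: b]) + dG (mG [:: b] c)
    - (-1) ^+ degB b *: lin (fun c2 => mG [:: b] c2) (dG << c >>).
Proof.
rewrite stasheffGE bar_diff_cons bar_diff_nil (ainfG_m1 ainfG) /= addr0.
rewrite !linD linZ lin_head_tens lin_empty_word lin_prepend lin_empty_word /=.
rewrite exprS mulN1r scaleNr; apply: eq_addf; last exact: erefl.
apply: eq_addf; first exact: erefl.
rewrite [RHS]linear_linE; apply: eq_lin => c'; exact: (ainfG_m1 ainfG).
Qed.

Lemma ainf_act_lifts : lifts_action (odeg degB) degC dA dG epsA epsG ainf_act.
Proof.
split.
- move=> [b|] c; rewrite /= ainf_act1; last exact: supp_inU.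
  move=> c' Hc'; have := ainfG_deg ainfG Hc'.
  rewrite /bar_deg !sdeg_cons sdeg_nil /=; lia.
- move=> [b|] c; last first.
    by rewrite /= (dA_None resA) tens0l linear0 add0r expr0 scale1r ainf_act_None ainf_act1.
  rewrite /= !ainf_act_tens lin1 (dA_Some ainfA) ainf_act1 linD linN linZ lin1 lin1 ainf_act1.
  rewrite [lin _ (letters _)]lin_lin.
  have -> : lin (fun u => lin (fun u0 => lin (fun c0 => ainf_act << (u0, c0) >>) << c >>) << Some u >>) (m [:: b])
     = lin (fun b2 => mG [:: b2] c) (m [:: b]).
    by apply: eq_lin => b2; rewrite !lin1 ainf_act1.
  have -> : lin (fun c0 => ainf_act << (Some b, c0) >>) (dG << c >>) = lin (fun c2 => mG [:: b] c2) (dG << c >>).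
    by apply: eq_lin => c2; rewrite ainf_act1.
  have := stasheffG2E b c; rewrite (ainfG_m2 ainfG) => ->.
  by rewrite [RHS]addrAC subrK [RHS]addrC addKr.
move=> u c; rewrite /= ainf_act1; case: u => [b|]; last by rewrite epsA1 scale1r.
have -> : epsA << Some b >> = 0 by apply: (res_aug_deg resA); exact: degB_gt0.
rewrite scale0r; apply: (semilinear_eq0 (res_aug_semilinear resG)) => c' Hc'.
apply: (res_aug_deg resG); have := ainfG_deg ainfG Hc'.
rewrite /bar_deg !sdeg_cons sdeg_nil /=; have := degB_gt0 b; lia.
Qed.

End AInfinityLifts.

(** * The second page as the homology of t_2 *)

Arguments insert_mG : simpl never.
Arguments insert_m : simpl never.

Section BaseChangeWords.
Context {Q k : comNzRingType} (kap : {rmorphism Q -> k}) {B C : choiceType}.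

Lemma base_change_letters (x : {malg Q[B]}) :
  base_change kap (letters x) = letters (base_change kap x).
Proof. by rewrite base_change_lin; apply: eq_lin => b; rewrite base_change1. Qed.

Lemma base_change_head_tens (v : seq B * C) (x : {malg Q[B]}) :
  base_change kap (head_tens v x) = head_tens v (base_change kap x).
Proof. by rewrite base_change_lin; apply: eq_lin => b; rewrite base_change1. Qed.

Lemma base_change_prepend b (x : {malg Q[(seq B * C)%type]}) :
  base_change kap (prepend b x) = prepend b (base_change kap x).
Proof. by rewrite base_change_lin; apply: eq_lin => u; rewrite base_change1. Qed.

Lemma base_change_empty_word (x : {malg Q[C]}) :
  base_change kap (empty_word x : {malg Q[(seq B * C)%type]}) = empty_word (base_change kap x).
Proof. by rewrite base_change_lin; apply: eq_lin => u; rewrite base_change1. Qed.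

End BaseChangeWords.

Section SecondPage.
Context {Q : comNzRingType} {k : fieldType} (kap : {rmorphism Q -> k}).
Context {B C : choiceType} {degB : B -> nat} {degC : C -> nat}.
Context {dA : {linear {malg Q[option B]} -> {malg Q[option B]}}}.
Context {dG : {linear {malg Q[C]} -> {malg Q[C]}}}.
Context {m : seq B -> {malg Q[B]}} {mG : seq B -> C -> {malg Q[C]}}.
Hypothesis ainfA : ainf_algebra degB dA m.
Hypothesis ainfG : ainf_module degB degC dA dG m mG.
Hypothesis minA : minimal_differential kap dA.
Hypothesis minG : minimal_differential kap dG.

Local Notation W := (seq B * C)%type.
Local Notation X := {malg k[W]}.
Local Notation D := (dX degB m mG kap).
Local Notation t := (t_ degB m mG kap).
Local Notation bar_deg := (bar_deg degB degC).
Implicit Types (x y z : X) (u v : W).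

Hypothesis D_sq : forall x, D (D x) = 0.

Lemma t1_eq0 x : t 1 x = 0.
Proof.
apply: lin_eq0 => -[w c] _; rewrite /bar_t raddf_sum /= big_nat_cond.
apply: big1 => j; rewrite andbT /= subn1 /= => lej; rewrite base_changeZ.
have mb b : base_change kap (m [:: b]) = 0.
  by apply/malgP => b'; rewrite mcoeff_base_change (ainf_m1 ainfA) rmorphN minA oppr0 mcoeff0.
have mc : base_change kap (mG [::] c) = 0.
  by apply/malgP => c'; rewrite mcoeff_base_change (ainfG_m1 ainfG) minG mcoeff0.
rewrite [X in _ *: X](_ : _ = 0) ?scaler0 //.
case: (leqP (j + 1) (size w)) => lt; rewrite base_change_lin.
  case E: (drop j w) => [|b s] /=; last by rewrite take0 mb lin0.
  by have := size_drop j w; rewrite E /=; lia.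
by rewrite drop_oversize ?mc ?lin0 //; lia.
Qed.

Lemma t2_nil c : t 2 << ([::], c) >> = 0.
Proof. by rewrite /t lin1 /bar_t big_geq // raddf0. Qed.

(** The recursion by which [t 2] is recognised as a reduced bar differential: the first letter
    merges with the next one, or acts on the generator when it is the only letter. *)
Lemma t2_cons b w c : t 2 << (b :: w, c) >>
  = (if w is b' :: w' then head_tens (w', c) (base_change kap (m [:: b; b']))
     else empty_word (base_change kap (mG [:: b] c)))
    + (-1) ^+ (degB b).+1 *: prepend b (t 2 << (w, c) >>).
Proof.
rewrite /t !lin1 /bar_t /= subSS subn1 subn2 /= big_nat_recl // raddfD /=.
apply: eq_addf.
  case: w => [|b' w].
    have -> : insert_mG degB m mG 2 0 ([:: b], c) = empty_word (mG [:: b] c).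
      exact: (insert_mG_total _ _ _ ([:: b], c)).
    exact: base_change_empty_word.
  by rewrite insert_mG_head // base_change_head_tens /= take0 drop0.
have sg : kap ((-1) ^+ (degB b).+1) = (-1) ^+ (degB b).+1 by rewrite rmorphXn rmorphN1.
rewrite -base_change_prepend -sg -base_changeZ; congr (base_change kap _).
rewrite (linear_sum (prepend b)) scaler_sumr.
by apply: eq_bigr => j _; rewrite insert_mG_cons.
Qed.

Lemma word_part_t2 s x : word_part s (t 2 x) = t 2 (word_part (s + 1) x).
Proof.
apply: (part_linear (F := t 2)) => -[w c].
have := @t_deg _ _ kap _ _ _ _ _ _ _ _ ainfA ainfG 2 (w, c) isT; apply: supp_inW => -[w' c'] /= [_ H].
by apply/eqP/eqP; lia.
Qed.

Lemma D_Fil_pred p x : Fil p x -> Fil (p - 1) (D x).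
Proof.
move=> Hx; have FD : Fil p (D x) by exact: (D_Fil ainfA ainfG Hx).
have E : word_part p (D x) = 0.
  by have := word_part_D kap ainfA ainfG 1 Hx; rewrite subrK => ->; rewrite big_nat1 t1_eq0.
by have := Fil_sub_word_part FD; rewrite E subr0.
Qed.

Lemma word_part_D_pred p x : Fil p x -> word_part (p - 1) (D x) = t 2 (word_part p x).
Proof.
move=> Hx; have := word_part_D kap ainfA ainfG 2 Hx.
have -> : p - 2%:Z + 1 = p - 1 by lia.
by move=> ->; rewrite big_nat_recr // big_nat1 /= t1_eq0 [LHS]add0r subrK.
Qed.

(** Since [t 1] is zero, [D] lowers word length with leading part [t 2], so the leading part of
    [D (D x) = 0] is the square of [t 2]. *)
Lemma t2_sq x : t 2 (t 2 x) = 0.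
Proof.
suff E : t 2 \o t 2 =1 \0 by exact: E.
apply: linear_eq => u /=.
pose p := (size u.1)%:Z.
have Fu : Fil p (<< u >> : X).
  by move=> v /(fsubsetP msuppU_le); rewrite in_fset1 => /eqP ->; rewrite /p; case: (u) => w c /=; lia.
have cu : word_part p << u >> = << u >> :> X.
  by apply: part_id => v /(fsubsetP msuppU_le); rewrite in_fset1 => /eqP ->; exact: eqxx.
have E2 := word_part_D_pred Fu; rewrite cu in E2.
have E1 := word_part_D_pred (D_Fil_pred Fu); rewrite D_sq E2 in E1.
by rewrite -E1; exact: linear0.
Qed.

Lemma word_partK s x : word_part s (word_part s x) = word_part s x.
Proof. by apply: part_id; exact: supp_in_part. Qed.

(** [D] always lowers the filtration by one here, so belonging to [Z_ 2 p] is a condition on the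
    component of [D x] of length [p - 1] alone. *)
Lemma E2_num (p n : nat) x : E_num_deg degB degC m mG kap 2 p n x <->
  [/\ Fil p x, homog bar_deg n x & t 2 (word_part p x) = 0].
Proof.
split=> [[[Fx FDx] Hx]|[Fx Hx tx]].
  split; [exact: Fx | exact: Hx | rewrite -(word_part_D_pred Fx)].
  by apply: (word_part_Fil FDx); lia.
split; last exact: Hx.
split; first exact: Fx.
have := Fil_sub_word_part (D_Fil_pred Fx); rewrite (word_part_D_pred Fx) tx subr0.
by apply: FilW; lia.
Qed.

(** What is divided out comes from [Fil (p + 1)], on which [D] has leading part [t 2], and from
    [Fil (p - 1)], which has no component of length [p]. *)
Lemma E2_den (p n : nat) x : Fil p x -> homog bar_deg n x ->
  E_den_deg degB degC m mG kap 2 p n x <-> exists y, word_part p x = t 2 y.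
Proof.
move=> Fx Hx; split=> [[[a [b [[Fa _] [w [Fw FDw] Eb] Ex]]] _]|[y Ey]].
  exists (word_part (p%:Z + 1) w).
  have Fw' : Fil (p%:Z + 1) w by apply: FilW Fw; lia.
  rewrite -(word_part_D_pred Fw') addrK Ex -Eb.
  have -> : word_part p (a + b) = word_part p a + word_part p b by exact: linearD.
  rewrite (word_part_Fil Fa); last by lia.
  exact: add0r.
(* The component of [y] of length [p + 1] already hits the leading component of [x]; then [x - D w]
   falls into [Fil (p - 1)]. *)
pose w := word_part (p%:Z + 1) y.
have Fw : Fil (p%:Z + 1) w by apply/E0_Fil/E0_word_part.
have cw : word_part (p%:Z + 1) w = w by exact: word_partK.
have FDw : Fil p (D w) by have := D_Fil_pred Fw; rewrite addrK.
have cDw : word_part p (D w) = word_part p x.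
  have := word_part_D_pred Fw; rewrite addrK cw => ->; rewrite -word_part_t2 -Ey.
  exact: word_partK.
split; last exact: Hx.
exists (x - D w), (D w); split; last by rewrite subrK.
  have F : Fil (p%:Z - 1) (x - D w).
    have E : word_part p (x - D w) = 0.
      have -> : word_part p (x - D w) = word_part p x - word_part p (D w) by exact: linearB.
      by rewrite cDw subrr.
    by have := Fil_sub_word_part (FilB Fx FDw); rewrite E subr0.
  by split; [apply: FilW F | apply: FilW (D_Fil_pred F)]; lia.
exists w; last exact: erefl.
by split; [apply: FilW Fw | apply: FilW FDw]; lia.
Qed.

End SecondPage.

(** * The bar resolution of N over T, built on words *)

Lemma semilinear_opp (S S' : nzRingType) (phi : {rmorphism S -> S'}) (V : choiceType)
    (N : lmodType S') (F : {malg S[V]} -> N) :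
  semilinear_along phi F -> semilinear_along phi (fun x => - F x).
Proof. by move=> sF c x y; rewrite sF opprD scalerN. Qed.

(** Sign bookkeeping for [tor_diff_f]: [q] is the sign of the first letter and [p] that of the
    remaining word. *)
Lemma signed_comb (S : comNzRingType) (S' : nzRingType) (phi : {rmorphism S -> S'})
    (N : lmodType S') (p q : S) (x y : N) : q * q = 1 ->
  phi p *: (phi q *: x - y) = - (phi (- q * p) *: (x + phi (- q) *: y)).
Proof.
move=> qq; have E : - q * p * - q = p by rewrite mulrN mulNr mulNr opprK mulrAC qq mul1r.
by rewrite scalerBr scalerDr !scalerA -!rmorphM E mulNr rmorphN scaleNr opprD opprK mulrC.
Qed.

Lemma mcoeff_strip_None (S : comNzRingType) (B : choiceType) (h : {malg S[option B]}) b :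
  (strip_None h)@_b = h@_(Some b).
Proof.
apply: (semilinear_eq_supp (phi := idfun) (F := fun h => (strip_None h)@_b : S^o)
  (H := fun h => h@_(Some b) : S^o) (x := h)).
- by move=> c x y; rewrite linearP mcoeffD mcoeffZ.
- by move=> c x y; rewrite mcoeffD mcoeffZ.
by move=> [b'|] _; rewrite [strip_None _]lin1 /= ?mcoeff0 !mcoeffU.
Qed.

Section BarTor.
Context {k : fieldType} {B C : choiceType} (degB : B -> nat) (degC : C -> nat).
Context {T : algType k} {N : lmodType T}.
Context (clsT : {linear {malg k[option B]} -> T}) (clsN : {malg k[C]} -> N).
Local Notation W := (seq B * C)%type.
Local Notation X := {malg k[W]}.
Local Notation TX := {malg T[W]}.
Context (t2 : {linear X -> X}) (mul2 : B -> B -> {malg k[B]}) (act2 : B -> C -> {malg k[C]}).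
Local Notation bar_deg := (bar_deg degB degC).
Implicit Types (x y : X) (z : TX) (u : W) (b : B) (c : C).

Local Notation iota := (in_alg T).
Local Notation e := (base_change iota).
Local Notation letter b := (clsT << Some b >>).

Hypothesis clsT_surj : forall a, exists h, clsT h = a.
Hypothesis clsT_inj : forall h, clsT h = 0 -> h = 0.
Hypothesis clsN_surj : forall a, exists h, clsN h = a.
Hypothesis clsN_inj : forall h, clsN h = 0 -> h = 0.
Hypothesis clsN_lin : semilinear_along iota clsN.
Hypothesis clsT1 : clsT << None >> = 1.
Hypothesis clsTM : forall b b',
  letter b * letter b' = (-1) ^+ degB b *: clsT (letters (mul2 b b')).
Hypothesis clsTN : forall b c, letter b *: clsN << c >> = clsN (act2 b c).
Hypothesis t2_nil : forall c, t2 << ([::], c) >> = 0.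
Hypothesis t2_cons : forall b (s : seq B) c, t2 << (b :: s, c) >>
  = (if s is b' :: s' then head_tens (s', c) (mul2 b b') else empty_word (act2 b c))
    + (-1) ^+ (degB b).+1 *: prepend b (t2 << (s, c) >>).
Hypothesis t2_sq : forall x, t2 (t2 x) = 0.
Hypothesis t2_deg : forall u, supp_in (fun v => (bar_deg v).+1 = bar_deg u
  /\ (size v.1).+1 = size u.1) (t2 << u >>).

(* As [T = k + T_+], the [T]-free module on words is [e X + f X]: [e] gives
   coefficients in [k], and [f] turns the first letter into a coefficient in
   [T_+].  The bar complex is contracted by [e x + f y |-> e (signed y)]. *)
Definition remove_head : TX -> TX :=
  lin (fun u => if u.1 is b :: s then letter b *: << (s, u.2) >> else 0).
HB.instance Definition _ := GRing.Linear.on remove_head.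

Local Notation f x := (remove_head (e x)).

(** Composition with [signed] removes the Koszul sign that [t2] acquires when it passes a letter.
    This is what allows [tor_diff] to be strictly T-linear. *)
Definition signed : X -> X := lin (fun u => (-1) ^+ bar_deg u *: << u >>).
HB.instance Definition _ := GRing.Linear.on signed.

Definition tor_diff : TX -> TX :=
  lin (fun u => f (signed << u >>) - e (t2 (signed << u >>))).
HB.instance Definition _ := GRing.Linear.on tor_diff.

Definition tor_aug : TX -> N := lin (fun u => if u.1 is [::] then clsN << u.2 >> else 0).
HB.instance Definition _ := GRing.Linear.on tor_aug.

Lemma signed1 u : signed << u >> = (-1) ^+ bar_deg u *: << u >>.
Proof. exact: lin1. Qed.

Lemma signedN x : signed (- x) = - signed x.
Proof. exact: linearN. Qed.

Lemma signedK x : signed (signed x) = x.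
Proof.
suff E : signed \o signed =1 idfun by exact: E.
apply: linear_eq => u; rewrite /= signed1 linearZ /= signed1 scalerA -exprMn.
by rewrite mulrNN mulr1 expr1n scale1r.
Qed.

Lemma t2_signed x : t2 (signed x) = - signed (t2 x).
Proof.
suff E : t2 \o signed =1 \- (signed \o t2) by exact: E.
apply: linear_eq => u; rewrite /= signed1 linearZ /=.
rewrite [signed (t2 _)]linear_linE /= (@eq_lin_supp _ _ _ _ (fun v => - (-1) ^+ bar_deg u *: << v >>)).
  by rewrite lin_scalef lin_id scaleNr opprK.
by move=> v /t2_deg[E _]; rewrite signed1 -E exprS mulN1r opprK.
Qed.

Lemma f_semilinear : semilinear_along iota (fun x : X => f x).
Proof. by move=> c x y; rewrite base_changeP linearP. Qed.

Lemma fD x y : f (x + y) = f x + f y.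
Proof. exact: (semilinearD _ _ f_semilinear). Qed.

Lemma fZ (a : k) x : f (a *: x) = iota a *: f x.
Proof. exact: (semilinearZ _ _ f_semilinear). Qed.

Lemma fN x : f (- x) = - f x.
Proof. exact: (semilinearN _ f_semilinear). Qed.

Lemma f0 : f 0 = 0.
Proof. exact: (semilinear0 f_semilinear). Qed.

Lemma t2Z (a : k) x : t2 (a *: x) = a *: t2 x.
Proof. exact: linearZ. Qed.

Lemma f_cons b (s : seq B) c : f << (b :: s, c) >> = letter b *: << (s, c) >>.
Proof. by rewrite base_change1 [LHS]lin1. Qed.

Lemma f_nil c : f << ([::], c) >> = 0.
Proof. by rewrite base_change1 [LHS]lin1. Qed.

Lemma f_empty_word (h : {malg k[C]}) : f (empty_word h) = 0.
Proof.
have semi : semilinear_along iota (fun h : {malg k[C]} => f (empty_word h)).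
  by move=> c h1 h2; rewrite linearP; exact: f_semilinear.
apply: (semilinear_eq0 semi) => c _.
by have -> : empty_word << c >> = << ([::], c) >> :> X; [exact: lin1 | exact: f_nil].
Qed.

Lemma scalar_comm (a : T) (c : k) : a * iota c = iota c * a.
Proof. by rewrite /= mulr_algl mulr_algr. Qed.

Lemma letter_comb b (a : k) z1 z2 :
  letter b *: (iota a *: z1 - iota a *: z2) = iota a *: (letter b *: z1 - letter b *: z2).
Proof. by rewrite -scalerBr scalerA scalar_comm -scalerA scalerBr. Qed.

Lemma letter_e b x : letter b *: e x = f (prepend b x).
Proof.
apply: (semilinear_eq_supp (phi := iota) (F := fun x => letter b *: e x)
  (H := fun x => f (prepend b x)) (x := x)).
- move=> c y y'; have := base_changeP iota c y y' => ->.
  by rewrite scalerDr !scalerA (scalar_comm _ c).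
- by move=> c y y'; rewrite linearP; exact: f_semilinear.
by move=> [s c] _; rewrite prepend1 f_cons base_change1.
Qed.

Lemma f_head_tens v (h : {malg k[B]}) : f (head_tens v h) = clsT (letters h) *: << v >>.
Proof.
apply: (semilinear_eq_supp (phi := iota) (F := fun h : {malg k[B]} => f (head_tens v h))
  (H := fun h => clsT (letters h) *: << v >>) (x := h)).
- by move=> c h1 h2; rewrite linearP; exact: f_semilinear.
- move=> c h1 h2; rewrite [letters _]linP linearP scalerDl scalerA /=.
  by rewrite mulr_algl.
move=> b _; have -> : letters << b >> = << Some b >> :> {malg k[option B]} by exact: lin1.
have -> : head_tens v << b >> = << (b :: v.1, v.2) >> :> X by exact: lin1.
by rewrite f_cons -surjective_pairing.
Qed.

(** The product of two letters in T is the merging of letters in [t2], up to the sign in [clsTM].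
    For the empty word [f] annihilates both sides. *)
Lemma letter_f b (s : seq B) c :
  letter b *: f << (s, c) >> = iota ((-1) ^+ degB b) *:
    f (if s is b' :: s' then head_tens (s', c) (mul2 b b') else empty_word (act2 b c)).
Proof.
case: s => [|b' s]; first by rewrite f_nil f_empty_word !scaler0.
by rewrite f_cons f_head_tens !scalerA clsTM /= mulr_algl.
Qed.

Lemma tor_diff_e x : tor_diff (e x) = f (signed x) - e (t2 (signed x)).
Proof.
apply: (semilinear_eq_supp (phi := iota) (F := fun x => tor_diff (e x))
  (H := fun x => f (signed x) - e (t2 (signed x))) (x := x)).
- by move=> c y y'; rewrite base_changeP linearP.
- move=> c y y'; rewrite !linearP f_semilinear base_changeP scalerBr opprD.
  exact: addrACA.
by move=> u _; rewrite base_change1 [LHS]lin1.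
Qed.

(** Extracting the first letter and differentiating what remains reproduces [t2_cons]: the product
    with the next letter is its head term, and the differential behind the letter is its prepended
    term. *)
Lemma tor_diff_f x : tor_diff (f x) = - f (t2 (signed x)).
Proof.
have semi : semilinear_along iota (fun x => f (t2 (signed x))).
  by move=> c y y'; rewrite !linearP; exact: f_semilinear.
apply: (semilinear_eq_supp (phi := iota) (F := fun x => tor_diff (f x))
  (H := fun x => - f (t2 (signed x))) (x := x)).
- by move=> c y y'; rewrite f_semilinear linearP.
- exact: (semilinear_opp semi).
move=> [[|b s] c] _.
  by rewrite f_nil linear0 signed1 linearZ /= t2_nil scaler0 raddf0 linear0 oppr0.
have E1 : f (signed << (s, c) >>) = iota ((-1) ^+ bar_deg (s, c)) *: f << (s, c) >>.
  by rewrite signed1; exact: fZ.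
have E2 : e (t2 (signed << (s, c) >>)) = iota ((-1) ^+ bar_deg (s, c)) *: e (t2 << (s, c) >>).
  by rewrite signed1 t2Z; exact: base_changeZ.
have E3 : tor_diff (f << (b :: s, c) >>)
    = iota ((-1) ^+ bar_deg (s, c)) *: (letter b *: f << (s, c) >> - letter b *: e (t2 << (s, c) >>)).
  rewrite f_cons linearZ /= -[<< (s, c) >>](base_change1 iota) tor_diff_e E1 E2.
  exact: letter_comb.
rewrite E3 letter_f letter_e signed1 t2Z fZ t2_cons fD fZ.
have -> : bar_deg (b :: s, c) = ((degB b).+1 + bar_deg (s, c))%N.
  by rewrite /bar_deg sdeg_cons addnA.
rewrite exprD exprS mulN1r; apply: signed_comb.
by rewrite -exprMn mulrNN mulr1 expr1n.
Qed.

Lemma tor_diff_sq z : tor_diff (tor_diff z) = 0.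
Proof.
suff E : tor_diff \o tor_diff =1 \0 by exact: E.
apply: linear_eq => u; rewrite /= -(base_change1 iota) tor_diff_e linearB /=.
rewrite tor_diff_f tor_diff_e signedK t2_signed.
have -> : signed (- signed (t2 << u >>)) = - t2 << u >> by rewrite linearN /= signedK.
rewrite linearN /= t2_sq oppr0 raddf0 subr0.
by rewrite fN opprK addNr.
Qed.

Lemma option_split (h : {malg k[option B]}) :
  h = h@_None *: << None >> + letters (strip_None h).
Proof.
apply/malgP => o; rewrite mcoeffD mcoeffZ mcoeffU mcoeff_letters.
case: o => [b|]; last by rewrite eqxx mulr1 addr0.
rewrite mulr0 add0r; have := mcoeff_strip_None h b; exact: esym.
Qed.

Lemma e_sum (I : Type) (r : seq I) (F : I -> X) :
  e (\sum_(i <- r) F i) = \sum_(i <- r) e (F i).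
Proof. exact: raddf_sum. Qed.

Lemma f_sum (I : Type) (r : seq I) (F : I -> X) :
  f (\sum_(i <- r) F i) = \sum_(i <- r) f (F i).
Proof. by rewrite e_sum; exact: linear_sum. Qed.

(** A chain is chosen for each coefficient in T; its part at [None] goes to [x], its letters to [y].
    As [f] kills empty words, excluding them from [y] is what makes the decomposition unique. *)
Lemma decompose z : exists x y, z = e x + f y /\
  supp_in (fun u => if u.1 is [::] then False else True) y.
Proof.
have [r rK] := choice_of clsT_surj.
exists (\sum_(u <- msupp z) (r z@_u)@_None *: << u >>),
  (\sum_(u <- msupp z) head_tens u (strip_None (r z@_u))); split; last first.
  by apply: supp_in_sum => u _; apply: supp_in_lin => b _; apply: supp_inU.
rewrite [LHS]monalgE e_sum f_sum -big_split /=.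
apply: eq_bigr => u _; rewrite f_head_tens base_changeZ base_change1 -scalerDl.
rewrite -malgUZ; congr << _ *g u >>.
rewrite -{1}(rK z@_u) [in LHS](option_split (r z@_u)) linearD linearZ /= clsT1.
by [].
Qed.

Definition coefficient u x y : {malg k[option B]} :=
  x@_u *: << None >> + letters (head_letters u y).

Lemma mcoeff_decomposition u x y : (e x + f y)@_u = clsT (coefficient u x y).
Proof.
rewrite mcoeffD mcoeff_base_change linearD linearZ /= clsT1; congr (_ + _).
apply: (semilinear_eq_supp (phi := iota) (N := T^o) (F := fun y => (f y)@_u)
   (H := fun y => clsT (letters (head_letters u y))) (x := y)).
- by move=> c y1 y2; rewrite (f_semilinear c y1 y2) mcoeffD mcoeffZ.
- move=> c y1 y2; rewrite [head_letters _ _]linP [letters _]linP linearP /=.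
  by have <- := mulr_algl c (clsT (letters (head_letters u y1))).
move=> [[|b s] c] _.
  rewrite f_nil mcoeff0 [head_letters _ _]lin1 /= [letters _]lin0; exact: esym (linear0 _).
rewrite f_cons mcoeffZ mcoeffU [head_letters _ _]lin1 /=.
case: eqP => _; last by rewrite mulr0 [letters 0]lin0 linear0.
by rewrite mulr1 [letters _]lin1.
Qed.

Lemma mcoeff_head_letters u y b : (head_letters u y)@_b = y@_(b :: u.1, u.2).
Proof.
suff E : (fun y => (head_letters u y)@_b : k^o) =1 (fun y => y@_(b :: u.1, u.2)) by exact: E.
move=> y'; apply: (semilinear_eq_supp (phi := idfun) (F := fun y => (head_letters u y)@_b : k^o)
  (H := fun y => y@_(b :: u.1, u.2) : k^o)).
- by move=> c y1 y2; rewrite [head_letters _ _]linP mcoeffD mcoeffZ.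
- by move=> c y1 y2; rewrite mcoeffD mcoeffZ.
move=> [[|b' s] c] _; rewrite [head_letters _ _]lin1 mcoeffU /= ?mcoeff0 //.
case: (u) => s' c' /=; have -> : ((b' :: s, c) == (b :: s', c')) = ((s, c) == (s', c')) && (b' == b).
  by rewrite !xpair_eqE eqseq_cons -andbA andbC.
by case: ((s, c) == (s', c')); rewrite ?mcoeff0 ?mcoeffU.
Qed.

Lemma coefficient_eq0 u x y : (e x + f y)@_u = 0 ->
  x@_u = 0 /\ forall b, y@_(b :: u.1, u.2) = 0.
Proof.
rewrite mcoeff_decomposition => /clsT_inj E; split.
  have := congr1 (mcoeff None) E.
  by rewrite mcoeff0 mcoeffD mcoeffZ mcoeff_letters mcoeffUU mulr1 addr0.
move=> b; have := congr1 (mcoeff (Some b)) E.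
rewrite mcoeff0 mcoeffD mcoeffZ mcoeff_letters mcoeffU mulr0 add0r => <-.
exact/esym/mcoeff_head_letters.
Qed.

(** By injectivity of [clsT], the coefficient of the sum at [u] determines that of [x] at [u] and
    those of [y] at all words consisting of one letter followed by [u]. *)
Lemma decomposition_supp (P : W -> Prop) x y : supp_in P (e x + f y) ->
  supp_in (fun u => if u.1 is [::] then False else True) y ->
  supp_in P x /\ supp_in (fun u => if u.1 is b :: s then P (s, u.2) else False) y.
Proof.
move=> HP ney; split.
  apply/supp_inP => u nz; apply: NNPP => nP; apply: nz.
  suff : (e x + f y)@_u = 0 by move/coefficient_eq0=> [].
  by apply/eqP; rewrite mcoeff_eq0; apply/negP => /HP.
move=> [[|b s] c] Hu; first exact: ney Hu.
apply: NNPP => nP; move: Hu; rewrite -mcoeff_neq0 => /eqP; apply.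
suff : (e x + f y)@_(s, c) = 0 by move/coefficient_eq0=> [_ /(_ b)].
by apply/eqP; rewrite mcoeff_eq0; apply/negP => /HP.
Qed.

Lemma tor_aug_e_empty_word (h : {malg k[C]}) : tor_aug (e (empty_word h)) = clsN h.
Proof.
apply: (semilinear_eq_supp (phi := iota) (F := fun h => tor_aug (e (empty_word h)))) => //.
  by move=> c h1 h2; rewrite linearP base_changeP linearP.
move=> c _; have -> : empty_word << c >> = << ([::], c) >> :> X by exact: lin1.
by rewrite base_change1 [LHS]lin1.
Qed.

Lemma size0_empty_word x : homog (fun u => size u.1) 0 x ->
  x = empty_word (lin (fun u => << u.2 >>) x).
Proof.
move=> Hx; rewrite [RHS]lin_lin -[LHS]lin_id; apply: eq_lin_supp => -[[|b s] c] /Hx //= _.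
by rewrite lin1.
Qed.

Lemma tor_aug_f y : homog (fun u => size u.1) 1 y -> tor_aug (f y) = tor_aug (e (t2 y)).
Proof.
move=> Hy.
apply: (semilinear_eq_supp (phi := iota) (F := fun y => tor_aug (f y))
  (H := fun y => tor_aug (e (t2 y)))).
- by move=> c y1 y2; rewrite f_semilinear linearP.
- by move=> c y1 y2; rewrite linearP base_changeP linearP.
move=> [[|b [|b' s]] c] /Hy //= _.
rewrite f_cons t2_cons t2_nil linear0 scaler0 addr0 tor_aug_e_empty_word linearZ /=.
by rewrite -clsTN [tor_aug _]lin1.
Qed.

Lemma t2_size n x : homog (fun u => size u.1) n.+1 x -> homog (fun u => size u.1) n (t2 x).
Proof.
move=> Hx; apply: supp_in_linear => u /Hx E v /t2_deg [_].
by rewrite E => -[].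
Qed.

Lemma signed_supp (P : W -> Prop) x : supp_in P x -> supp_in P (signed x).
Proof.
by move=> HP; apply: supp_in_linear => u /HP h; rewrite /= signed1; apply: supp_inZ; apply: supp_inU.
Qed.

(** Since [tor_diff (e (signed y))] is [f y - e (t2 y)], the point is that [x = - t2 y]. In positive
    degree this is the [f] component of the cycle equation; in degree 0 it follows from the
    augmentation and the injectivity of [clsN]. *)
Lemma tor_cycle_boundary n x y : homog (fun u => size u.1) n (e x + f y) ->
  supp_in (fun u => if u.1 is [::] then False else True) y ->
  tor_diff (e x + f y) = 0 -> (n = 0%N -> tor_aug (e x + f y) = 0) ->
  homog (fun u => size u.1) n.+1 y /\ e x + f y = tor_diff (e (signed y)).
Proof.
move=> Hz ney dz ez; have [Hx Hy] := decomposition_supp Hz ney.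
have {}Hy : homog (fun u => size u.1) n.+1 y.
  by apply: supp_inW Hy => -[[|b s] c] //= ->.
split; first exact: Hy.
rewrite tor_diff_e signedK.
have yE : e (t2 y) = - e x.
  suff -> : x = - t2 y by rewrite raddfN opprK.
  case: n Hz Hx Hy ez => [|n] Hz Hx Hy ez.
    have E : tor_aug (e (x + t2 y)) = 0.
      by rewrite raddfD linearD /= -tor_aug_f // -linearD; exact: ez.
    have H0 : homog (fun u => size u.1) 0 (x + t2 y).
      by apply: supp_inD; [exact: Hx | exact: t2_size Hy].
    move: E; rewrite [X in e X](size0_empty_word H0) tor_aug_e_empty_word => /clsN_inj h0.
    have E : x + t2 y = 0 by rewrite (size0_empty_word H0) h0; exact: linear0.
    by rewrite -[LHS](addrK (t2 y)) E sub0r.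
  have D0 : e (- t2 (signed x)) + f (signed x - t2 (signed y)) = 0.
    rewrite -dz linearD /= tor_diff_e tor_diff_f fD fN raddfN /=.
    by rewrite [LHS]addrCA [LHS]addrA.
  have ne : supp_in (fun u => if u.1 is [::] then False else True) (signed x - t2 (signed y)).
    have : homog (fun u => size u.1) n.+1 (signed x - t2 (signed y)).
      apply: supp_inB; first exact: signed_supp.
      by apply: t2_size; exact: signed_supp.
    by apply: supp_inW => -[[|b s] c].
  (* Zero is supported nowhere, so [decomposition_supp] for the empty predicate says that the [f]
     component vanishes. *)
  have P0 : supp_in (fun=> False) (e (- t2 (signed x)) + f (signed x - t2 (signed y))).
    by rewrite D0; exact: supp_in0.
  have [_ E0] := decomposition_supp P0 ne.
  have {}E0 : signed x - t2 (signed y) = 0.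
    by apply: (supp_in_empty _ E0) => -[[|b s] c].
  have E1 : signed x = - signed (t2 y) by rewrite -t2_signed -[LHS](subrK (t2 (signed y))) E0 add0r.
  by rewrite -[LHS]signedK E1 linearN /= signedK.
by rewrite yE opprK addrC.
Qed.

Theorem tor_bar_resolution :
  free_resolution idfun (fun u : W => size u.1) tor_diff tor_aug.
Proof.
split.
- move=> u v; rewrite /= [tor_diff _]lin1; move: v; apply: supp_inB.
    rewrite signed1 fZ; apply: supp_inZ; case: u => [[|b s] c].
      by rewrite f_nil; exact: supp_in0.
    by rewrite f_cons; apply: supp_inZ; exact: supp_inU.
  apply: supp_in_base_change; rewrite signed1 t2Z; apply: supp_inZ.
  by have := @t2_deg u; apply: supp_inW => v [].
- exact: tor_diff_sq.
- by move=> c x y; rewrite linearP.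
- by move=> [[|b s] c] // _; rewrite [LHS]lin1.
- move=> z; suff E : tor_aug \o tor_diff =1 \0 by exact: E.
  apply: linear_eq => u; rewrite /= -[<< u >>](base_change1 iota) tor_diff_e linearB /=.
  have far x : supp_in (fun u => if u.1 is [::] then False else True) x -> tor_aug (e x) = 0.
    move=> Hx; apply: (semilinear_eq0 (phi := iota) (F := fun x => tor_aug (e x))).
      by move=> c x1 x2; rewrite base_changeP linearP.
    by move=> [[|b s] c] /Hx // _; rewrite base_change1 [LHS]lin1.
  have augZ a z' : tor_aug (iota a *: z') = iota a *: tor_aug z' by exact: linearZ.
  suff Eu : tor_aug (f << u >>) = tor_aug (e (t2 << u >>)).
    by rewrite signed1 fZ t2Z base_changeZ !augZ Eu subrr.
  case: u => [[|b [|b' s]] c].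
  + rewrite f_nil t2_nil; congr (tor_aug _); exact/esym/raddf0.
  + by rewrite tor_aug_f //; apply: supp_inU.
  rewrite f_cons linearZ /= [tor_aug << _ >>]lin1 /= scaler0 far //.
  have := @t2_deg (b :: b' :: s, c); apply: supp_inW => -[[|b2 s2] c2] //= [_].
  by [].
- move=> a; have [h <-] := clsN_surj a.
  by exists (e (empty_word h)); exact: tor_aug_e_empty_word.
- move=> z Hz ez; have [x [y [zE ne]]] := decompose z; rewrite zE in Hz ez *.
  have dz : tor_diff (e x + f y) = 0.
    rewrite linear_linE; apply: lin_eq0 => u /Hz; case: u => [[|b s] c] //= _.
    rewrite -[<< _ >>](base_change1 iota) tor_diff_e signed1 fZ f_nil t2Z t2_nil.
    by rewrite !scaler0 raddf0 subr0.
  have [_ ->] := tor_cycle_boundary Hz ne dz (fun=> ez).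
  by exists (e (signed y)).
move=> [//|n] z _ Hz dz; have [x [y [zE ne]]] := decompose z; rewrite zE in Hz dz *.
have [//|_ ->] := tor_cycle_boundary Hz ne dz.
by exists (e (signed y)).
Qed.

(** * The internal grading and comparison with a graded resolution *)

Context (eta : {rmorphism T -> k}).
Hypothesis eta_cls : forall h, eta (clsT h) = h@_None.
Hypothesis mul2_deg : forall b b',
  supp_in (fun b2 => degB b2 = (degB b + degB b')%N) (mul2 b b').

Definition internal_deg u : nat := (\sum_(b <- u.1) degB b + degC u.2)%N.

Lemma internal_deg_cons b (s : seq B) c :
  internal_deg (b :: s, c) = (degB b + internal_deg (s, c))%N.
Proof. by rewrite /internal_deg big_cons addnA. Qed.

Lemma bar_deg_internal u : bar_deg u = (internal_deg u + size u.1)%N.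
Proof.
case: u => s c /=; elim: s => [|b s IH]; first by rewrite /bar_deg sdeg_nil /internal_deg big_nil addn0.
by rewrite internal_deg_cons -[size _]/(size s).+1 addnS -addnA -IH /bar_deg sdeg_cons /=; lia.
Qed.

Lemma t2_internal_deg u : supp_in (fun v => internal_deg v = internal_deg u) (t2 << u >>).
Proof.
have := @t2_deg u; apply: supp_inW => v [].
rewrite !bar_deg_internal => E1 E2; move: E1; rewrite -E2 !addnS => -[]; exact: addIn.
Qed.

(* [T] is only given with the degrees of its homology classes, so the internal
   grading is read off the [e x + f y] decomposition. *)
Definition graded_part q z : Prop :=
  exists x y, [/\ z = e x + f y, homog internal_deg q x & homog internal_deg q y].

Lemma graded_part0 q : graded_part q 0.
Proof.
exists 0, 0; split; [|exact: supp_in0|exact: supp_in0].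
have e0 : e (0 : X) = 0 by exact: raddf0.
by rewrite e0 linear0 addr0.
Qed.

Lemma graded_partD q z1 z2 : graded_part q z1 -> graded_part q z2 -> graded_part q (z1 + z2).
Proof.
move=> [x1 [y1 [-> Hx1 Hy1]]] [x2 [y2 [-> Hx2 Hy2]]].
exists (x1 + x2), (y1 + y2); split; [|exact: supp_inD|exact: supp_inD].
have eD : e (x1 + x2) = e x1 + e x2 by exact: raddfD.
by rewrite eD fD addrACA.
Qed.

Lemma graded_partZ q (a : k) z : graded_part q z -> graded_part q (iota a *: z).
Proof.
move=> [x [y [-> Hx Hy]]]; exists (a *: x), (a *: y); split; [|exact: supp_inZ|exact: supp_inZ].
have eZ : e (a *: x) = iota a *: e x by exact: base_changeZ.
by rewrite eZ fZ scalerDr.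
Qed.

(** A product with a letter lies in the [f] part: [e x] is handled by prepending the letter, [f y]
    by merging it with the first letters of [y]. *)
Lemma graded_part_letter b q z : graded_part q z -> graded_part (degB b + q) (letter b *: z).
Proof.
move=> [x [y [-> Hx Hy]]].
pose h u := if u.1 is b' :: s' then (-1) ^+ degB b *: head_tens (s', u.2) (mul2 b b') else 0 : X.
have Eh : letter b *: f y = f (lin h y).
  apply: (semilinear_eq_supp (phi := iota) (F := fun y => letter b *: f y)
    (H := fun y => f (lin h y)) (x := y)).
  - move=> c y1 y2; rewrite (f_semilinear c y1 y2) scalerDr !scalerA.
    by rewrite (scalar_comm (letter b) c).
  - by move=> c y1 y2; rewrite linP; exact: f_semilinear.
  move=> [s c] _; rewrite lin1 letter_f; case: s => [|b' s] /=.
    by rewrite f_empty_word scaler0 f0.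
  by rewrite fZ.
exists 0, (prepend b x + lin h y); split; last first.
- apply: supp_inD.
    apply: supp_in_lin => -[s c] /Hx E; apply: supp_inU.
    by rewrite internal_deg_cons E.
  apply: supp_in_lin => -[[|b' s] c] /Hy E; first exact: supp_in0.
  apply: supp_inZ; apply: supp_in_lin => b2 /mul2_deg E2; apply: supp_inU.
  by rewrite /= internal_deg_cons E2 -E internal_deg_cons addnA.
- exact: supp_in0.
have e0 : e (0 : X) = 0 by exact: raddf0.
by rewrite e0 add0r fD scalerDr letter_e Eh.
Qed.

Lemma graded_part_sum q (I : eqType) (r : seq I) (F : I -> TX) :
  (forall i, i \in r -> graded_part q (F i)) -> graded_part q (\sum_(i <- r) F i).
Proof.
elim: r => [|i r IH] H; first by rewrite big_nil; exact: graded_part0.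
rewrite big_cons; apply: graded_partD; first by apply: H; rewrite inE eqxx.
by apply: IH => j Hj; apply: H; rewrite inE Hj orbT.
Qed.

Lemma graded_part_cls j q h z : homog (odeg degB) j h -> graded_part q z ->
  graded_part (j + q) (clsT h *: z).
Proof.
move=> Hh Hz; rewrite [h]monalgE linear_sum scaler_suml.
suff H o : o \in msupp h -> graded_part (j + q) (clsT << h@_o *g o >> *: z).
  exact: graded_part_sum.
move=> Ho; rewrite malgUZ linearZ /= -mulr_algl -scalerA; apply: graded_partZ.
move: (Hh o Ho); case: o {Ho} => [b|] /= <-; first exact: graded_part_letter.
by rewrite clsT1 scale1r.
Qed.

Lemma eta_iota (a : k) : eta (iota a) = a.
Proof.
have -> : iota a = clsT (a *: << None >>) by rewrite linearZ /= clsT1.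
by rewrite eta_cls mcoeffZ mcoeffUU mulr1.
Qed.

Lemma eta_e x : base_change eta (e x) = x.
Proof. by apply/malgP => u; rewrite !mcoeff_base_change eta_iota. Qed.

Lemma eta_f y : base_change eta (f y) = 0.
Proof.
apply/malgP => u; rewrite mcoeff_base_change mcoeff0.
have e0 : e (0 : X) = 0 by exact: raddf0.
have := mcoeff_decomposition u 0 y; rewrite e0 add0r => ->.
by rewrite eta_cls mcoeffD mcoeffZ mcoeff0 mul0r add0r mcoeff_letters.
Qed.

(** [eta] kills T_+ and with it the [f] part. Tensoring the bar resolution with [k] over T thus
    leaves the reduced bar complex, up to sign. *)
Lemma bc_tor_diff x : bc_map eta tor_diff x = - t2 (signed x).
Proof.
suff E : bc_map eta tor_diff =1 \- (t2 \o signed) by exact: E.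
apply: linear_eq => u; rewrite /= bc_map1 -[<< u >>](base_change1 iota) tor_diff_e.
by rewrite raddfB /= eta_f eta_e sub0r.
Qed.

Context {degT : nat -> T -> Prop} {degN : nat -> N -> Prop}.
Hypothesis degTP : forall j a, degT j a -> exists2 h, homog (odeg degB) j h & clsT h = a.
Hypothesis degNP : forall j a, degN j a -> exists2 h, homog degC j h & clsN h = a.
Context {V : choiceType} {hdeg ideg : V -> nat}.
Context {dP : {linear {malg T[V]} -> {malg T[V]}}} {epsP : {malg T[V]} -> N}.
Hypothesis gres : graded_free_resolution degT degN hdeg ideg dP epsP.

Let resP := gres_res gres.

(** The general lifting lemma does not control the internal degree. Here preimages are taken with
    the explicit contraction, which respects it. *)
Lemma graded_lift_exists : exists g : V -> TX, forall v,
  [/\ homog (fun u : W => size u.1) (hdeg v) (g v), graded_part (ideg v) (g v),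
      tor_diff (g v) = lin g (dP << v >>) & hdeg v = 0%N -> tor_aug (g v) = epsP << v >>].
Proof.
pose good v (g : V -> TX) z := [/\ homog (fun u : W => size u.1) (hdeg v) z,
  graded_part (ideg v) z, tor_diff z = lin g (dP << v >>) & hdeg v = 0%N -> tor_aug z = epsP << v >>].
apply: (@recursion_on_degree V TX 0 hdeg good).
  move=> v g g' x E [h1 h2 h3 h4]; split; [exact: h1|exact: h2| |exact: h4].
  rewrite h3; apply: eq_lin_supp => v' /(res_diff_deg resP) lt; apply: E; by rewrite -lt.
move=> v g IH.
have {}IH v' : v' \in msupp (dP << v >>) -> _ := fun H => IH v' (eq_leq (res_diff_deg resP H)).
case En : (hdeg v) => [|n].
  have [h Hh Eh] := degNP (gres_aug_deg gres v).
  exists (e (empty_word h)); split.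
  - apply: supp_in_base_change; apply: supp_in_lin => c _; exact: supp_inU.
  - exists (empty_word h), 0; split; [by rewrite f0 addr0| |exact: supp_in0].
    apply: supp_in_lin => c /Hh E; apply: supp_inU.
    by rewrite /internal_deg /= big_nil.
  - rewrite (res_diff_eq0 resP En) linear0 linear_linE; apply: lin_eq0 => u Hu.
    apply: (res_diff_eq0 tor_bar_resolution); move: u Hu.
    by apply: supp_in_base_change; apply: supp_in_lin => c _; exact: supp_inU.
  by move=> _; rewrite tor_aug_e_empty_word.
pose z := lin g (dP << v >>).
have degv' v' : v' \in msupp (dP << v >>) -> hdeg v' = n.
  by move=> H; have := res_diff_deg resP H; rewrite En => -[].
have Hz : homog (fun u : W => size u.1) n z.
  by apply: supp_in_lin => v' H; have [h _ _ _] := IH v' H; rewrite -(degv' v' H).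
have gz : graded_part (ideg v) z.
  apply: graded_part_sum => v' H; have [_ gv _ _] := IH v' H.
  have [le /degTP[h Hh <-]] := gres_diff_deg gres H.
  by rewrite -(subnK le); exact: graded_part_cls.
have dz : tor_diff z = 0.
  rewrite linear_lin (@eq_lin_supp _ _ _ _ (fun v' => lin g (dP << v' >>))); last first.
    by move=> v' /IH [].
  by rewrite -lin_lin -linear_linE (res_diff_sq resP) lin0.
have ez : n = 0%N -> tor_aug z = 0.
  move=> n0; rewrite linear_lin -(res_aug_diff resP << v >>).
  rewrite (semilinear_sumE _ (res_aug_semilinear resP)).
  apply: eq_big_seq => v' H; have [_ _ _ a0] := IH v' H.
  by rewrite /= a0 // (degv' v' H).
have [x [y0 [zE Hx Hy0]]] := gz.
(* Empty words in [y0] do not affect [f y0]; dropping them gives the normalised form that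
   [tor_cycle_boundary] requires. *)
pose y := part (fun u => u.1 != [::]) y0.
have fy : f y0 = f y.
  rewrite [in LHS](partC (fun u => u.1 != [::]) y0) fD.
  rewrite [X in _ + X](semilinear_eq0 f_semilinear) ?addr0 // => -[[|b s] c].
    by move=> _; exact: f_nil.
  by move=> Hu; have /= := supp_in_part Hu.
have ne : supp_in (fun u => if u.1 is [::] then False else True) y.
  by case=> [[|b s] c] Hu; [have /= := supp_in_part Hu | exact: I].
rewrite fy in zE; rewrite zE in Hz dz ez.
have [Hy Ey] := tor_cycle_boundary Hz ne dz ez.
have Hsy := signed_supp Hy.
have Hqy : homog internal_deg (ideg v) y := supp_in_part_sub Hy0.
exists (e (signed y)); split.
- by rewrite En; exact: (supp_in_base_change Hsy).
- exists (signed y), 0; split; [by rewrite f0 addr0|exact: (signed_supp Hqy)|exact: supp_in0].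
- by rewrite -Ey -zE.
by rewrite En.
Qed.

Let dk : {malg k[V]} -> {malg k[V]} := bc_map eta dP.

(** A coefficient of the differential of [P] has degree equal to the drop in internal degree, and
    [eta] kills it unless that drop is 0. *)
Lemma dk_ideg q h : part (fun v => ideg v == q) (dk h) = dk (part (fun v => ideg v == q) h).
Proof.
apply: (part_linear (F := bc_map eta dP)) => v v' /=; rewrite bc_map1 => Hv'.
have HP : supp_in (fun w => (ideg w <= ideg v)%N /\ degT (ideg v - ideg w) (dP << v >>)@_w)
    (base_change eta (dP << v >>)).
  by apply: supp_in_base_change => w; exact: (gres_diff_deg gres).
have [le /degTP[a Ha Ea]] := HP v' Hv'.
congr (_ == q); apply/eqP; rewrite eqn_leq le /= leqNgt; apply/negP => lt.
move: Hv'; rewrite -mcoeff_neq0 mcoeff_base_change -Ea eta_cls => /eqP; apply.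
apply/eqP; rewrite mcoeff_eq0; apply/negP => /Ha /= E.
by move: lt; rewrite -subn_gt0 -E.
Qed.

Lemma signed_homog n x : homog bar_deg n x -> signed x = (-1) ^+ n *: x.
Proof.
move=> Hx; rewrite -[x in RHS]lin_id -lin_scalef; apply: eq_lin_supp => u /Hx <-.
exact: erefl.
Qed.

(** Of the two comparison maps only [g], into the bar resolution, is graded. The other is followed
    by the projection to internal degree [q], which commutes with the differentials over [k] and
    with [G]. *)
Theorem tor_second_page p q : exists F : {linear X -> {malg k[V]}},
  let A x := [/\ homog (fun u => size u.1) p x, homog internal_deg q x & t2 x = 0] in
  let Z h := tor_cycles eta hdeg dP p h /\ homog ideg q h in
  let Bd h := tor_boundaries eta hdeg dP p h /\ homog ideg q h in
  [/\ forall x, A x -> Z (F x),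
      forall x, A x -> (Bd (F x) <-> exists y, x = t2 y) &
      forall h, Z h -> exists2 x, A x & Bd (h - F x)].
Proof.
have resB := tor_bar_resolution.
have [g Hg] := graded_lift_exists.
have gdeg v : homog (fun u => size u.1) (hdeg v) (g v) by have [] := Hg v.
have gd r : tor_diff (lin g r) = lin g (dP r).
  by rewrite (linear_linE dP) !linear_lin; apply: eq_lin => v; have [_ _ E _] := Hg v; rewrite /= E.
have ge r : tor_aug (lin g r) = epsP r.
  rewrite linear_lin (semilinear_sumE _ (res_aug_semilinear resP)).
  apply: eq_bigr => v _ /=; have [hv _ _ e0] := Hg v; case: (posnP (hdeg v)) => [/e0 -> //|pos].
  rewrite (res_aug_deg resP pos); congr (_ *: _).
  rewrite linear_linE; apply: lin_eq0 => u /hv E; apply: (res_aug_deg resB); by rewrite E.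
have [l [ldeg ld le]] := chain_map_exists resP resB.
have [|||s [_ Hs]] := homotopy_id resB (F := lin g \o lin l).
- move=> u; rewrite /= lin1; apply: supp_in_lin => v /ldeg <-; exact: gdeg.
- by move=> u; rewrite /= gd ld.
- by move=> u; rewrite /= ge le.
have [|||s' [_ Hs']] := homotopy_id resP (F := lin l \o lin g).
- move=> v; rewrite /= lin1; apply: supp_in_lin => u /gdeg <-; exact: ldeg.
- by move=> v; rewrite /= ld /= gd.
- by move=> v; rewrite /= le ge.
pose L := bc_map eta (lin l); pose G := bc_map eta (lin g).
pose db := bc_map eta tor_diff.
have LD x : dk (L x) = L (db x).
  by rewrite /L /dk /db -!bc_map_comp; apply: eq_bc_map => z /=; exact: ld.
have GD h : db (G h) = G (dk h).
  by rewrite /G /dk /db -!bc_map_comp; apply: eq_bc_map => z /=; exact: gd.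
have Ldeg j x : homog (fun u => size u.1) j x -> homog hdeg j (L x).
  by move=> Hx; apply: supp_in_bc_map => u /Hx <-; rewrite lin1; exact: ldeg.
have Gdeg j h : homog hdeg j h -> homog (fun u => size u.1) j (G h).
  by move=> Hx; apply: supp_in_bc_map => v /Hx <-; rewrite lin1; exact: gdeg.
have Gint v : homog internal_deg (ideg v) (G << v >>).
  rewrite /G bc_map1 lin1; have [_ [x [y [-> Hx _]]] _ _] := Hg v.
  by rewrite raddfD /= eta_e eta_f addr0.
have GL x : G (L x) = x + db (bc_map eta (lin s) x) + bc_map eta (lin s) (db x).
  exact: bc_map_homotopy_id.
have LG h : L (G h) = h + dk (bc_map eta (lin s') h) + bc_map eta (lin s') (dk h).
  exact: bc_map_homotopy_id.
pose prV : {malg k[V]} -> {malg k[V]} := part (fun v => ideg v == q).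
pose prW : X -> X := part (fun u => internal_deg u == q).
have Gpr h : prW (G h) = G (prV h).
  by apply: (part_linear (F := bc_map eta (lin g))) => v u /(Gint v) ->.
have t2pr x : prW (t2 x) = t2 (prW x).
  by apply: (part_linear (F := t2)) => u v /t2_internal_deg ->.
have dbE x : db x = - t2 (signed x) by exact: bc_tor_diff.
(* In a fixed bidegree [signed] is a scalar sign, so [db] and [t2] have the same cycles there. *)
have A_cycle x : homog (fun u => size u.1) p x -> homog internal_deg q x ->
    t2 (signed x) = (-1) ^+ (q + p) *: t2 x.
  move=> Hp Hq; rewrite (signed_homog (n := (q + p)%N)) ?t2Z //.
  by move=> u Hu; rewrite bar_deg_internal (Hp u Hu) (Hq u Hu).
have dk_hdeg j h : homog hdeg j.+1 h -> homog hdeg j (dk h).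
  move=> Hh; apply: supp_in_bc_map => v /Hh E v' /(res_diff_deg resP).
  by rewrite E => -[].
have sk0 : bc_map eta (lin s) 0 = 0 by exact: linear0.
have sk0' : bc_map eta (lin s') 0 = 0 by exact: linear0.
have L0 : L 0 = 0 by exact: linear0.
have G0 : G 0 = 0 by exact: linear0.
have t20 : t2 0 = 0 by exact: linear0.
have prWD x y : prW (x + y) = prW x + prW y by exact: linearD.
have prVD h h' : prV (h + h') = prV h + prV h' by exact: linearD.
have prWid x : homog internal_deg q x -> prW x = x.
  by move=> Hx; apply: part_id => u /Hx ->; exact: eqxx.
have prVid h : homog ideg q h -> prV h = h.
  by move=> Hh; apply: part_id => v /Hh ->; exact: eqxx.
have prVq h : homog ideg q (prV h) by move=> v /supp_in_part /eqP.
have db0 x : homog (fun u => size u.1) p x -> homog internal_deg q x -> t2 x = 0 -> db x = 0.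
  by move=> Hp Hq tx; rewrite dbE (A_cycle x Hp Hq) tx scaler0 oppr0.
have dbT x : exists y, db x = t2 y.
  by exists (- signed x); rewrite dbE linearN.
exists (part (fun v => ideg v == q) \o bc_map eta (lin l) : {linear X -> {malg k[V]}}) => A Z Bd.
rewrite /= -/L -/prV; split.
- move=> x [Hp Hq tx]; split; last exact: prVq.
  split; first by apply: supp_in_part_sub; exact: Ldeg.
  by rewrite -/dk /= -dk_ideg LD db0 // L0; exact: linear0.
- move=> x [Hp Hq tx]; split=> [[[_ [h Eh]] _]|[y Ey]].
    (* Applying [G] moves the projection to words, where [G (L x)] is [x] plus a boundary. *)
    have E : G (prV (L x)) = db (G h) by rewrite GD; congr (G _); exact: Eh.
    move: E; rewrite -Gpr GL (db0 x Hp Hq tx) sk0 addr0 prWD (prWid x Hq).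
    have [y1 ->] := dbT (bc_map eta (lin s) x); have [y2 ->] := dbT (G h).
    rewrite t2pr => E; exists (y2 - prW y1).
    by rewrite linearB /= -E addrK.
  split; last exact: prVq.
  split; first by apply: supp_in_part_sub; exact: Ldeg.
  have Ex : db (- signed y) = x by rewrite dbE signedN signedK linearN opprK Ey.
  by exists (prV (L (- signed y))); rewrite -/dk -dk_ideg LD Ex.
move=> h [[Hp dh] Hq]; exists (G h).
  have Hq' : homog internal_deg q (G h) by apply: supp_in_linear => v /Hq <-; exact: Gint.
  have Hp' := Gdeg p h Hp; split; [exact: Hp'|exact: Hq'|].
  have := GD h; rewrite [dk h]dh G0 dbE (A_cycle _ Hp' Hq') => /eqP.
  rewrite oppr_eq0 scaler_eq0 signr_eq0 /= => /eqP; exact.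
split; last by apply: supp_inB; [exact: Hq | exact: prVq].
split.
  by apply: supp_inB; [exact: Hp | apply: supp_in_part_sub; exact/Ldeg/Gdeg].
exists (- prV (bc_map eta (lin s') h)).
have prVdk r : prV (dk r) = dk (prV r) by exact: dk_ideg.
have dkN r : dk (- r) = - dk r by exact: linearN.
rewrite -/dk dkN LG [dk h]dh sk0' addr0 prVD (prVid h Hq) prVdk.
by rewrite opprD addrA subrr sub0r.
Qed.

End BarTor.

(** * Identification of the second page with Tor over the Tor algebra *)

Lemma bc_map_tens (Q k : comNzRingType) (kap : {rmorphism Q -> k}) (U V W : choiceType)
    (F : {malg Q[(U * V)%type]} -> {malg Q[W]}) (x : {malg k[U]}) (y : {malg k[V]}) :
  bc_map kap F (tens x y) = lin (fun u => lin (fun v => base_change kap (F << (u, v) >>)) y) x.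
Proof. exact: lin_tens. Qed.

Section SecondPageIso.
Context {Q R : comNzRingType} {k : fieldType} { pi : {rmorphism Q -> R}}.
Context {kap : {rmorphism Q -> k}} {M : lmodType R}.
Context {B C : choiceType} {degB : B -> nat} {degC : C -> nat}.
Context {dA : {linear {malg Q[option B]} -> {malg Q[option B]}}}.
Context {epsA : {malg Q[option B]} -> R^o}.
Context {dG : {linear {malg Q[C]} -> {malg Q[C]}}} {epsG : {malg Q[C]} -> M}.
Context {m : seq B -> {malg Q[B]}} {mG : seq B -> C -> {malg Q[C]}}.
Hypothesis degB_gt0 : forall b, (0 < degB b)%N.
Hypothesis resA : free_resolution pi (odeg degB) dA epsA.
Hypothesis epsA1 : epsA << None >> = 1.
Hypothesis minA : minimal_differential kap dA.
Hypothesis resG : free_resolution pi degC dG epsG.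
Hypothesis minG : minimal_differential kap dG.
Hypothesis ainfA : ainf_algebra degB dA m.
Hypothesis ainfG : ainf_module degB degC dA dG m mG.
Hypothesis D_sq : forall x, dX degB m mG kap (dX degB m mG kap x) = 0.

Context {mu : {linear {malg Q[(option B * option B)%type]} -> {malg Q[option B]}}}.
Context {muG : {linear {malg Q[(option B * C)%type]} -> {malg Q[C]}}}.
Hypothesis mu_lifts : lifts_action (odeg degB) (odeg degB) dA dA epsA epsA mu.
Hypothesis muG_lifts : lifts_action (odeg degB) degC dA dG epsA epsG muG.
Context {T : algType k} {N : lmodType T}.
Context {clsT : {linear {malg k[option B]} -> T}} {clsN : {malg k[C]} -> N}.
Context {eta : {rmorphism T -> k}}.
Hypothesis tor : tor_algebra_module kap dA dG mu muG clsT clsN eta.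

Let dA0 x : bc_map kap dA x = 0 := minimal_bc_map x minA.
Let dG0 x : bc_map kap dG x = 0 := minimal_bc_map x minG.

Lemma tor_clsT_surj a : exists h, clsT h = a.
Proof. by have [h _ <-] := (tor_clsT tor).1 a; exists h. Qed.

(** By minimality every chain over [k] is a cycle and only 0 is a boundary. *)
Lemma tor_clsT_inj h : clsT h = 0 -> h = 0.
Proof. by move/((tor_clsT tor).2 h (dA0 h)).1 => [y ->]; exact: dA0. Qed.

Lemma tor_clsN_surj a : exists h, clsN h = a.
Proof. by have [h _ <-] := (tor_clsN tor).1 a; exists h. Qed.

Lemma tor_clsN_inj h : clsN h = 0 -> h = 0.
Proof. by move/((tor_clsN tor).2 h (dG0 h)).1 => [y ->]; exact: dG0. Qed.

(** Uniqueness of lifts over [k] replaces the given [mu] by the product made from m_2. *)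
Lemma tor_clsT_mul x y :
  clsT x * clsT y = clsT (bc_map kap (ainf_mul (degB:=degB) (m:=m)) (tens x y)).
Proof.
apply: etrans (tor_mul tor (dA0 x) (dA0 y)) _; congr (clsT _).
exact: (lifts_action_unique resA resA minA minA mu_lifts
  (ainf_mul_lifts degB_gt0 resA epsA1 ainfA)).
Qed.

Lemma tor_clsT_act x y :
  clsT x *: clsN y = clsN (bc_map kap (ainf_act (mG:=mG)) (tens x y)).
Proof.
apply: etrans (tor_act tor (dA0 x) (dG0 y)) _; congr (clsN _).
exact: (lifts_action_unique resA resG minA minG muG_lifts
  (ainf_act_lifts degB_gt0 resA epsA1 resG ainfA ainfG)).
Qed.

(** Take a chain [h] with class 1. As [None] is a left unit for [ainf_mul], its class multiplied by
    that of [h] is the class of [h], that is 1. *)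
Lemma tor_clsT_None : clsT << None >> = 1.
Proof.
have [h Eh] := tor_clsT_surj 1; rewrite -[LHS]mulr1 -{1}Eh tor_clsT_mul bc_map_tens lin1 -[RHS]Eh.
congr (clsT _); rewrite -[RHS]lin_id; apply: eq_lin => v.
by rewrite ainf_mul1 base_change1.
Qed.

Lemma base_changeXN n (V : choiceType) (x : {malg Q[V]}) :
  base_change kap ((-1) ^+ n *: x) = (-1) ^+ n *: base_change kap x.
Proof. by rewrite base_changeZ rmorphXn rmorphN1. Qed.

Lemma tor_clsT_letters b b' : clsT << Some b >> * clsT << Some b' >>
  = (-1) ^+ degB b *: clsT (letters (base_change kap (m [:: b; b']))).
Proof.
rewrite tor_clsT_mul bc_map_tens !lin1 ainf_mul1 base_changeXN base_change_letters.
exact: linearZ.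
Qed.

Lemma tor_clsT_letter_act b c :
  clsT << Some b >> *: clsN << c >> = clsN (base_change kap (mG [:: b] c)).
Proof. by rewrite tor_clsT_act bc_map_tens !lin1 ainf_act1. Qed.

Lemma t2_bar_deg u : supp_in (fun v => (bar_deg degB degC v).+1 = bar_deg degB degC u
  /\ (size v.1).+1 = size u.1) (t_ degB m mG kap 2 << u >>).
Proof.
have := @t_deg _ _ kap _ _ _ _ _ _ _ _ ainfA ainfG 2 u isT.
by apply: supp_inW => v [E1 E2]; split; [exact: E1 | move: E2; rewrite addn2 => -[]].
Qed.

Lemma base_change_m2_deg b b' :
  supp_in (fun b2 => degB b2 = (degB b + degB b')%N) (base_change kap (m [:: b; b'])).
Proof.
apply: supp_in_base_change => b2 Hb.
have := ainf_deg ainfA (isT : [:: b; b'] != [::]) Hb.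
rewrite !sdeg_cons sdeg_nil; lia.
Qed.

Context {V : choiceType} {hdeg ideg : V -> nat}.
Context {dP : {linear {malg T[V]} -> {malg T[V]}}} {epsP : {malg T[V]} -> N}.
Hypothesis gres : graded_free_resolution
  (homology_degree (odeg degB) (bc_map kap dA) clsT)
  (homology_degree degC (bc_map kap dG) clsN) hdeg ideg dP epsP.

(** By [E2_num] and [E2_den] a class on the second page depends on its component of word length [p]
    only, and on words of that length total degree [p + q] means internal degree [q]. *)
Theorem second_page_iso (p q : nat) :
  subquotient_iso
    (E_num_deg degB degC m mG kap 2 p (p + q))
    (E_den_deg degB degC m mG kap 2 p (p + q))
    (fun x => tor_cycles eta hdeg dP p x /\ homog ideg q x)
    (fun x => tor_boundaries eta hdeg dP p x /\ homog ideg q x).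
Proof.
have degTP j a : homology_degree (odeg degB) (bc_map kap dA) clsT j a ->
  exists2 h, homog (odeg degB) j h & clsT h = a by move=> [h [H1 _ H2]]; exists h.
have degNP j a : homology_degree degC (bc_map kap dG) clsN j a ->
  exists2 h, homog degC j h & clsN h = a by move=> [h [H1 _ H2]]; exists h.
have [F [FZ FB Fsurj]] := tor_second_page (t2 := t_ degB m mG kap 2)
  tor_clsT_surj tor_clsT_inj tor_clsN_surj tor_clsN_inj (tor_clsN_lin tor) tor_clsT_None
  tor_clsT_letters tor_clsT_letter_act (t2_nil _) (t2_cons _) (t2_sq ainfA ainfG minA minG D_sq)
  t2_bar_deg (fun h => tor_eta tor (dA0 h)) base_change_m2_deg degTP degNP gres p q.
have Anum x : E_num_deg degB degC m mG kap 2 p (p + q) x ->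
  [/\ homog (fun u => size u.1) p (word_part p x),
      homog (internal_deg degB degC) q (word_part p x) &
      t_ degB m mG kap 2 (word_part p x) = 0].
  move=> /(E2_num ainfA ainfG minA minG) [Fx Hx tx].
  have Hp : homog (fun u => size u.1) p (word_part p x).
    by move=> [w c] /E0_word_part /=; case.
  split; [exact: Hp| |exact: tx].
  move=> u Hu; have := supp_in_part_sub Hx Hu.
  by rewrite (bar_deg_internal degB degC) (Hp u Hu) addnC => /addnI.
exists (F \o word_part p : {linear _ -> _}); split.
- by move=> x /Anum; exact: FZ.
- move=> x Hx; have /(E2_num ainfA ainfG minA minG) [Fx hx _] := Hx.
  have [D1 D2] := E2_den ainfA ainfG minA minG Fx hx; have [D3 D4] := FB _ (Anum x Hx).
  by split=> [/D3/D2|/D1/D4].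
move=> y /Fsurj [x [Hp Hq tx] Bd].
have wx : word_part p x = x.
  by apply: part_id => -[w c] /Hp /= ->; exact: eqxx.
exists x; last by rewrite /= wx.
apply/(E2_num ainfA ainfG minA minG); split.
- by move=> [w c] /Hp /= ->.
- by move=> u Hu; rewrite (bar_deg_internal degB degC) (Hp u Hu) (Hq u Hu) addnC.
by rewrite wx.
Qed.

End SecondPageIso.

Theorem theoremC
  (Q R : comNzRingType) (k : fieldType)
  (* R = Q/I, and k is the residue field of Q *)
  (pi : {rmorphism Q -> R}) (kap : {rmorphism Q -> k}) (rho : {rmorphism R -> k})
  (M : lmodType R)
  (* A is free on option B, A_+ on B, and G on C *)
  (B C : choiceType) (degB : B -> nat) (degC : C -> nat)
  (dA : {linear {malg Q[option B]} -> {malg Q[option B]}})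
  (epsA : {malg Q[option B]} -> R^o)
  (dG : {linear {malg Q[C]} -> {malg Q[C]}})
  (epsG : {malg Q[C]} -> M)
  (m : seq B -> {malg Q[B]}) (mG : seq B -> C -> {malg Q[C]}) :
  local_ring Q -> noetherian Q ->
  surjective pi -> surjective kap -> (forall q, rho (pi q) = kap q) ->
  finitely_generated M ->
  (forall b, (0 < degB b)%N) ->
  free_resolution pi (odeg degB) dA epsA -> epsA << None >> = 1 ->
  minimal_differential kap dA ->
  free_resolution pi degC dG epsG -> minimal_differential kap dG ->
  ainf_algebra degB dA m -> ainf_module degB degC dA dG m mG ->
  [/\
    (* E^2_{p,q} = Tor_p^{Tor^Q(R,k)}(Tor^Q(M,k), k)_q *)
    forall mu muG,
      lifts_action (odeg degB) (odeg degB) dA dA epsA epsA mu ->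
      lifts_action (odeg degB) degC dA dG epsA epsG muG ->
      forall (T : algType k) (N : lmodType T)
        (clsT : {linear {malg k[option B]} -> T}) (clsN : {malg k[C]} -> N)
        (eta : {rmorphism T -> k}),
      tor_algebra_module kap dA dG mu muG clsT clsN eta ->
      forall (V : choiceType) (hdeg ideg : V -> nat)
        (dP : {linear {malg T[V]} -> {malg T[V]}}) (epsP : {malg T[V]} -> N),
      graded_free_resolution
        (homology_degree (odeg degB) (bc_map kap dA) clsT)
        (homology_degree degC (bc_map kap dG) clsN)
        hdeg ideg dP epsP ->
      forall p q : nat,
      subquotient_iso
        (E_num_deg degB degC m mG kap 2 p (p + q))
        (E_den_deg degB degC m mG kap 2 p (p + q))
        (fun x => tor_cycles eta hdeg dP p x /\ homog ideg q x)
        (fun x => tor_boundaries eta hdeg dP p x /\ homog ideg q x),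
    (* convergence to Tor^R_n(M,k) *)
    forall (V : choiceType) (hdeg : V -> nat)
      (dP : {linear {malg R[V]} -> {malg R[V]}}) (epsP : {malg R[V]} -> M),
    free_resolution idfun hdeg dP epsP ->
    forall n : nat,
    converges_in_degree degB degC m mG kap n
      (tor_cycles rho hdeg dP n) (tor_boundaries rho hdeg dP n),
    forall (p r : nat) (x : {malg k[(seq B * C)%type]}), E0 p x ->
      survives degB m mG kap r p x <->
      exists xs : int -> {malg k[(seq B * C)%type]},
        [/\ forall i : int, p%:Z - r%:Z <= i < p%:Z -> E0 i (xs i),
            xs p = x &
            forall n : nat, (1 <= n <= r)%N ->
              \sum_(1 <= i < n.+1)
                t_ degB m mG kap i (xs (p%:Z - n%:Z + i%:Z)) = 0] &
    forall (p r : nat) (x : {malg k[(seq B * C)%type]})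
      (xs : int -> {malg k[(seq B * C)%type]}),
      E0 p x ->
      (forall i : int, p%:Z - r%:Z <= i < p%:Z -> E0 i (xs i)) ->
      xs p = x ->
      (forall n : nat, (1 <= n <= r)%N ->
        \sum_(1 <= i < n.+1)
          t_ degB m mG kap i (xs (p%:Z - n%:Z + i%:Z)) = 0) ->
      differential_maps degB m mG kap r p x
        (\sum_(1 <= i < r.+2)
          t_ degB m mG kap i (xs (p%:Z - r%:Z - 1 + i%:Z)))].
Proof.
move=> _ _ pi_surj _ rho_pi _ degB_gt0 resA epsA1 minA resG minG ainfA ainfG.
have D_sq := dX_sq pi_surj rho_pi degB_gt0 resA epsA1 resG ainfA ainfG.
split.
- move=> mu muG mu_lifts muG_lifts T N clsT clsN eta tor V hdeg ideg dP epsP gres p q.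
  exact: (second_page_iso degB_gt0 resA epsA1 minA resG minG ainfA ainfG D_sq
    mu_lifts muG_lifts tor gres).
- move=> V hdeg dP epsP resP n.
  exact: (bar_converges pi_surj rho_pi degB_gt0 resA epsA1 resG ainfA ainfG resP).
- exact: (survivesP kap ainfA ainfG).
exact: (differential_mapsP ainfA ainfG D_sq).
Qed.
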